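(* Let $d\ge1$, $N\ge1$, and let $\varphi_1,\dots,\varphi_N\in L^2(\mathbb{R}^d)$ satisfy $\langle\varphi_i,\varphi_j\rangle=\delta_{ij}$ for $1\le i,j\le N$. Let $H=-\Delta+\sum_{j=1}^N\langle\cdot,\varphi_j\rangle\varphi_j$, $R(z)=(H-z)^{-1}$ and $R_0(z)=(-\Delta-z)^{-1}$. Then for every $z\in\mathbb{C}\setminus[0,\infty)$ the $N\times N$ matrix $A(z)=(a_{ij}(z))$ with $$a_{ij}(z)=\delta_{ij}+\langle R_0(z)\varphi_j,\varphi_i\rangle,\qquad1\le i,j\le N,$$ is invertible, and with $(g_{ij}(z))_{N\times N}=A(z)^{-1}$, $$R(z)=R_0(z)-\sum_{i,j=1}^Ng_{ij}(z)\,R_0(z)\varphi_i\,\langle R_0(z)\,\cdot\,,\varphi_j\rangle .$$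
   Context: $\langle f,g\rangle=\int f\bar g\,dx$ is the $L^2(\mathbb{R}^d)$ inner product; $\delta_{ij}$ is the Kronecker delta. *)

(* Defs.v *)
From HB Require Import structures.
From mathcomp Require Import all_boot all_order all_algebra.
From mathcomp Require Import complex.
From mathcomp Require Import all_classical all_reals all_analysis.

Set Implicit Arguments.
Unset Strict Implicit.
Unset Printing Implicit Defensive.

Import Order.TTheory GRing.Theory Num.Theory.
Import numFieldNormedType.Exports.

Local Open Scope classical_set_scope.
Local Open Scope ring_scope.
Local Open Scope complex_scope.
Local Open Scope quotient_scope.

Section measurable_rV.
Context {d : measure_display} {T : measurableType d}.
Variable n : nat.

(* The product sigma-algebra, as the library does for [n.-tuple T]; for
   [T = R] these are the Borel sets of [R^n]. *)
Let coors : 'I_n -> 'rV[T]_n -> T := fun i v => v ord0 i.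

Let rV_set0 : g_sigma_preimage coors set0.
Proof. exact: sigma_algebra0. Qed.

Let rV_setC A : g_sigma_preimage coors A -> g_sigma_preimage coors (~` A).
Proof. exact: sigma_algebraC. Qed.

Let rV_bigcup (F : _^nat) : (forall i, g_sigma_preimage coors (F i)) ->
  g_sigma_preimage coors (\bigcup_i (F i)).
Proof. exact: sigma_algebra_bigcup. Qed.

HB.instance Definition _ := @isMeasurable.Build (measure_tuple_display d)
  'rV[T]_n (g_sigma_preimage coors) rV_set0 rV_setC rV_bigcup.

Lemma measurable_rV_coord (i : 'I_n) :
  measurable_fun [set: 'rV[T]_n] (fun v : 'rV[T]_n => v ord0 i).
Proof.
move=> _ Y mY; rewrite setTI; apply: sub_sigma_algebra => /=.
rewrite -bigcup_seq/=; exists i => /=; first by rewrite mem_index_enum.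
by exists Y => //; rewrite setTI.
Qed.

Lemma measurable_fun_rV d' (S : measurableType d') (f : S -> 'rV[T]_n) :
  (forall i, measurable_fun [set: S] (fun x => f x ord0 i)) ->
  measurable_fun [set: S] f.
Proof.
move=> mf; have fE : g_sigma_preimage (fun i => coors i \o f) `<=` measurable.
  apply: smallest_sub; first exact: sigma_algebra_measurable.
  rewrite -bigcup_seq; apply: bigcup_sub => i _ A [B mB <-].
  exact: mf.
move: fE; rewrite g_sigma_preimage_comp => fE _ A mA.
by apply: fE; exists A.
Qed.

End measurable_rV.

Section lebesgue_rV.
Variable R : realType.

Section cons.
Variable n : nat.

Definition rV_cons (p : R * 'rV[R]_n) : 'rV[R]_n.+1 :=
  \row_(i < n.+1) oapp (fun j : 'I_n => p.2 ord0 j) p.1 (unlift ord0 i).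

Lemma measurable_rV_cons :
  measurable_fun [set: measurableTypeR R * 'rV[R]_n] rV_cons.
Proof.
apply: measurable_fun_rV => i.
under eq_fun do rewrite mxE.
case: (unliftP ord0 i) => [j _|_] /=; last exact: measurable_fst.
exact: (measurableT_comp (measurable_rV_coord j) measurable_snd).
Qed.

Definition rV_uncons (v : 'rV[R]_n.+1) : R * 'rV[R]_n :=
  (v ord0 ord0, \row_(j < n) v ord0 (lift ord0 j)).

Lemma rV_consK : cancel rV_cons rV_uncons.
Proof.
move=> [x v]; rewrite /rV_cons /rV_uncons /= !mxE unlift_none /=; congr pair.
by apply/rowP => j; rewrite !mxE liftK.
Qed.

Lemma measurable_rV_uncons :
  measurable_fun [set: 'rV[R]_n.+1]
    (rV_uncons : _ -> measurableTypeR R * 'rV[R]_n).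
Proof.
apply: (measurable_fun_pair (f := fun v : 'rV[measurableTypeR R]_n.+1 => v ord0 ord0)).
  exact: measurable_rV_coord.
apply: measurable_fun_rV => i.
under eq_fun do rewrite mxE.
exact: measurable_rV_coord.
Qed.

Variable mu : {sigma_finite_measure set 'rV[R]_n -> \bar R}.

Definition cons_measure : set 'rV[R]_n.+1 -> \bar R :=
  pushforward (@lebesgue_measure R \x mu)%E rV_cons.

Let cons_measure0 : cons_measure set0 = 0%E.
Proof. by rewrite /cons_measure /pushforward preimage_set0 measure0. Qed.

Let cons_measure_ge0 A : (0 <= cons_measure A)%E.
Proof. by rewrite /cons_measure /pushforward; exact: measure_ge0. Qed.

Let cons_measure_sigma_additive : semi_sigma_additive cons_measure.
Proof.
move=> F mF tF mUF; rewrite /cons_measure /pushforward preimage_bigcup.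
apply: measure_semi_sigma_additive.
- by move=> k; rewrite -[X in measurable X]setTI; exact: measurable_rV_cons.
- apply/trivIsetP => /= i j _ _ ij; rewrite -preimage_setI.
  by move/trivIsetP : tF => /(_ _ _ _ _ ij) ->//; rewrite preimage_set0.
- rewrite -preimage_bigcup -[X in measurable X]setTI.
  exact: measurable_rV_cons.
Qed.

HB.instance Definition _ := isMeasure.Build _ _ _ cons_measure
  cons_measure0 cons_measure_ge0 cons_measure_sigma_additive.

Let cons_measure_sigma_finite : sigma_finite setT cons_measure.
Proof.
have /sigma_finiteP[F [TF ndF Foo]] := sigma_finiteT (@lebesgue_measure R).
have /sigma_finiteP[G [TG ndG Goo]] := sigma_finiteT mu.
exists (fun k => rV_uncons @^-1` (F k `*` G k)).
  rewrite -preimage_bigcup (_ : \bigcup_k _ = setT) ?preimage_setT//.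
  rewrite -subTset => -[x y] _.
  have [k _ Fkx] : (\bigcup_k F k) x by rewrite -TF.
  have [l _ Gly] : (\bigcup_k G k) y by rewrite -TG.
  exists (maxn k l) => //; split => /=.
  - by move: x Fkx; exact/subsetPset/ndF/leq_maxl.
  - by move: y Gly; exact/subsetPset/ndG/leq_maxr.
move=> k; have [mF Fk] := Foo k; have [mG Gk] := Goo k; split.
  rewrite -[X in measurable X]setTI.
  by apply: measurable_rV_uncons => //; exact: measurableX.
rewrite /cons_measure /pushforward -comp_preimage.
rewrite (_ : rV_uncons \o rV_cons = id); last first.
  by apply/funext => p /=; rewrite rV_consK.
by rewrite preimage_id product_measure1E// lte_mul_pinfty// ge0_fin_numE.
Qed.

HB.instance Definition _ := Measure_isSigmaFinite.Build _ _ _ cons_measure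
  cons_measure_sigma_finite.

End cons.

Fixpoint lebesgue_rV (d : nat) : {sigma_finite_measure set 'rV[R]_d -> \bar R} :=
  match d with
  | 0 => [the {sigma_finite_measure set 'rV[R]_0 -> \bar R} of
            dirac (0 : 'rV[R]_0)]
  | n.+1 => [the {sigma_finite_measure set 'rV[R]_n.+1 -> \bar R} of
               cons_measure (lebesgue_rV n)]
  end.

End lebesgue_rV.

Section L2.
Context {d : measure_display} {T : measurableType d} {R : realType}.
Variable mu : {measure set T -> \bar R}.
Local Notation Re := (@complex.Re R).
Local Notation Im := (@complex.Im R).

Definition Cintegral (f : T -> R[i]) : R[i] :=
  (\int[mu]_x Re (f x)) +i* (\int[mu]_x Im (f x)).

(* As [|f|^2 = (Re f)^2 + (Im f)^2], a measurable complex function is square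
   integrable iff its real and imaginary parts are. *)
Definition L2fun : {pred T -> R[i]} :=
  [pred f | (Re \o f \in Lfun mu 2%:E) && (Im \o f \in Lfun mu 2%:E)].

Lemma L2fun_submod_closed : submod_closed L2fun.
Proof.
have le12 : (1 <= 2%:E :> \bar R)%E by rewrite lee_fin ler1n.
have [S0 SZ] := Lfun_submod_closed mu le12.
have SD f g : f \in Lfun mu 2%:E -> g \in Lfun mu 2%:E ->
    f + g \in Lfun mu 2%:E.
  by move=> fS gS; have := SZ 1 f g fS gS; rewrite scale1r.
have SM a f : f \in Lfun mu 2%:E -> a *: f \in Lfun mu 2%:E.
  by move=> fS; have := SZ a f 0 fS S0; rewrite addr0.
split=> [|a f g /andP[Rf If] /andP[Rg Ig]]; apply/andP; split.
- exact: S0.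
- exact: S0.
- have -> : Re \o (a *: f + g) =
      Re a *: (Re \o f) + (- Im a) *: (Im \o f) + (Re \o g).
    apply/funext => x; rewrite /= !fctE /=.
    by case: a (f x) (g x) => [? ?] [? ?] [? ?] /=; rewrite /GRing.scale /= mulNr.
  by rewrite !SD ?SM.
- have -> : Im \o (a *: f + g) =
      Re a *: (Im \o f) + Im a *: (Re \o f) + (Im \o g).
    apply/funext => x; rewrite /= !fctE /=.
    by case: a (f x) (g x) => [? ?] [? ?] [? ?].
  by rewrite !SD ?SM.
Qed.

HB.instance Definition _ :=
  GRing.isSubmodClosed.Build R[i] (T -> R[i]) L2fun L2fun_submod_closed.

Record L2rep : Type := MkL2rep {
  L2rep_fun :> T -> R[i];
  _ : L2rep_fun \in L2fun }.

HB.instance Definition _ := [isSub for L2rep_fun].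
HB.instance Definition _ := [Choice of L2rep by <:].
HB.instance Definition _ := [SubChoice_isSubLmodule of L2rep by <:].

Definition L2null : {pred L2rep} :=
  [pred f | `[< {ae mu, forall x, L2rep_fun f x = 0} >]].

Lemma L2null_submod_closed : submod_closed L2null.
Proof.
split=> [|a f g /asboolP f0 /asboolP g0]; apply/asboolP.
  by apply: aeW => x.
by apply: filterS2 f0 g0 => x; rewrite /= !fctE => -> ->; rewrite scaler0 addr0.
Qed.

HB.instance Definition _ :=
  GRing.isSubmodClosed.Build R[i] L2rep L2null L2null_submod_closed.

Definition L2 : Type := Quotient.quot L2null.

HB.instance Definition _ := Choice.on L2.
HB.instance Definition _ := EqQuotient.on L2.
HB.instance Definition _ := ZmodQuotient.on L2.

Definition L2scale (a : R[i]) (u : L2) : L2 := \pi_L2 (a *: repr u).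

Lemma pi_L2scale a (f : L2rep) : L2scale a (\pi_L2 f) = \pi_L2 (a *: f).
Proof.
apply/eqP; rewrite -Quotient.idealrBE -scalerBr rpredZ//.
by rewrite Quotient.idealrBE reprK.
Qed.

Let pi_L2D (f g : L2rep) : \pi_L2 f + \pi_L2 g = \pi_L2 (f + g) :> L2.
Proof. by rewrite -pi_addr. Qed.

Let L2scaleA a b u : L2scale a (L2scale b u) = L2scale (a * b) u.
Proof. by rewrite -[u]reprK (pi_L2scale b) !pi_L2scale scalerA. Qed.

Let L2scale1 : left_id 1 L2scale.
Proof. by move=> u; rewrite -[u]reprK pi_L2scale scale1r. Qed.

Let L2scaleDr : right_distributive L2scale +%R.
Proof.
move=> a u v; rewrite -[u]reprK -[v]reprK.
by rewrite pi_L2D !pi_L2scale pi_L2D scalerDr.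
Qed.

Let L2scaleDl u : {morph L2scale^~ u : a b / a + b}.
Proof. by move=> a b; rewrite -[u]reprK !pi_L2scale pi_L2D scalerDl. Qed.

HB.instance Definition _ := GRing.Zmodule_isLmodule.Build R[i] L2
  L2scaleA L2scale1 L2scaleDr L2scaleDl.

Definition inner (u v : L2) : R[i] :=
  Cintegral (fun x => repr u x * (repr v x)^*).

Definition L2norm (u : L2) : R := Num.sqrt (Re (inner u u)).

End L2.

Section operators.
Context {d : measure_display} {T : measurableType d} {R : realType}.
Variable mu : {measure set T -> \bar R}.

(* Only the values of [op_fun] on [op_dom] are meaningful. *)
Record operator : Type := Operator {
  op_dom : set (L2 mu);
  op_fun :> L2 mu -> L2 mu }.

(* [A - z] is a bijection from the domain of [A] onto [L^2(mu)], with bounded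
   inverse. *)
Definition resolvent_set (A : operator) : set R[i] := [set z |
  (forall f, exists! u, op_dom A u /\ A u - z *: u = f) /\
  exists M : R, forall u, op_dom A u -> L2norm u <= M * L2norm (A u - z *: u)].

(* [(A - z)^-1], meaningful for [z] in the resolvent set of [A]. *)
Definition resolvent (A : operator) (z : R[i]) (f : L2 mu) : L2 mu :=
  xget 0 [set u | op_dom A u /\ A u - z *: u = f].

End operators.

Section laplacian.
Variables (R : realType) (d : nat).
Local Notation mu := (lebesgue_rV R d).
Local Notation L2 := (L2 mu).

Definition partial (i : 'I_d) (psi : 'rV[R]_d -> R) : 'rV[R]_d -> R :=
  fun x => 'D_(delta_mx ord0 i) psi x.

(* [C^oo]: all iterated partial derivatives are differentiable everywhere. *)
Definition smooth (psi : 'rV[R]_d -> R) : Prop :=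
  forall (s : seq 'I_d) (x : 'rV[R]_d), differentiable (foldr partial psi s) x.

(* Real-valued test functions; by linearity they yield the same weak
   derivatives as complex-valued ones. *)
Definition test_function (psi : 'rV[R]_d -> R) : Prop :=
  smooth psi /\ compact (closure [set x | psi x != 0]).

Definition is_weak_partial (i : 'I_d) (u v : L2) : Prop :=
  forall psi, test_function psi ->
    Cintegral mu (fun x => repr u x * (partial i psi x)%:C) =
    - Cintegral mu (fun x => repr v x * (psi x)%:C).

Definition weak_partial (i : 'I_d) (u : L2) : L2 :=
  xget 0 [set v | is_weak_partial i u v].

Definition sobolev1 : set L2 :=
  [set u | forall i, exists v, is_weak_partial i u v].

Definition sobolev2 : set L2 :=
  [set u | sobolev1 u /\ forall i, sobolev1 (weak_partial i u)].

Definition neg_laplacian : operator mu :=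
  Operator sobolev2 (fun u => - \sum_(i < d) weak_partial i (weak_partial i u)).

Definition hamiltonian (N : nat) (phi : 'I_N -> L2) : operator mu :=
  Operator sobolev2
    (fun u => neg_laplacian u + \sum_(j < N) inner u (phi j) *: phi j).

End laplacian.

(* Main.v *)
(* The operator -Delta on H^2 is symmetric and nonnegative, and 1 - Delta maps
   H^2 onto L^2. For surjectivity, the range of 1 - Delta on test functions is
   dense: if v in L^2 is orthogonal to it, every convolution g of v with a test
   function is bounded and solves g - Delta g = 0, hence vanishes by a maximum
   principle. The estimate ||f - Delta f||^2 = ||f||^2 + 2 ||grad f||^2 + ||D^2 f||^2
   then passes to the limit by completeness. Any symmetric nonnegative T with
   T + 1 onto is such that T - z is onto with bounded inverse for all z off
   [0, oo): T - z is bounded below there, so its range is closed, and a vector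
   orthogonal to the range would be an eigenvector of T for the conjugate of z.

   H - z = (T - z) + sum_j <., phi_j> phi_j is again nonnegative, so bounded
   below. A vector of the kernel of A(z)^T yields u = sum_j v_j R_0(z) phi_j with
   (H - z) u = 0, so A(z) is invertible, and the claimed formula is checked by
   applying H - z to it. *)
Require Import Defs.
From mathcomp Require Import all_boot all_order all_algebra.
From mathcomp Require Import complex.
From mathcomp Require Import all_classical all_reals all_analysis.
From mathcomp Require Import measurable_realfun ring lra.

Set Implicit Arguments.
Unset Strict Implicit.
Unset Printing Implicit Defensive.

Import Order.TTheory GRing.Theory Num.Theory.
Import numFieldNormedType.Exports.

Local Open Scope classical_set_scope.
Local Open Scope ring_scope.
Local Open Scope complex_scope.
Local Open Scope quotient_scope.

Local Notation Re := complex.Re.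
Local Notation Im := complex.Im.

(** No Fourier transform is used, so [R_0(z)] never has a formula: it is known only as an inverse,
    through solvability and lower bounds. Two points are delicate. The convolution [g] is never
    differentiated: an integrated Taylor estimate compares its second differences with the
    convolution against a second partial derivative, up to [O(t^3)], and as the supremum of [g] may
    not be attained, the maximum principle is run at almost maximal points. Next, the domain of the
    Laplacian is defined by weak derivatives, which can only be moved onto test functions, so
    nonnegativity on the domain is not immediate. Uniqueness for [1 - Delta] repairs this: it
    identifies any [u] of the domain with a limit of test functions converging along with their
    first derivatives; symmetry then follows by polarization. All limits are taken with error
    [C * 2^-n], so that uniqueness of limits and passage to the limit in inner products reduce to
    the fact that a number below [C * 2^-n] for all [n] is at most [0]. *)

Lemma le0_of_le_geometric (R : realType) (x C : R) :
  (forall n, x <= C * 2^-1 ^+ n) -> x <= 0.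
Proof.
move=> xC; rewrite leNgt; apply/negP => x0.
have C0 : 0 < C by apply: lt_le_trans x0 _; have := xC 0%N; rewrite expr0 mulr1.
have := archi_boundP (divr_ge0 (ltW C0) (ltW x0)).
set n := Num.bound _ => nx; have := xC n; rewrite leNgt => /negP; apply.
rewrite exprVn ltr_pdivrMr ?exprn_gt0// mulrC -ltr_pdivrMr//.
by apply: lt_le_trans nx _; rewrite -natrX ler_nat ltnW// ltn_expl.
Qed.

(** * Abstract complex Hilbert spaces *)

Section hilbert.
Context {R : realType} {V : lmodType R[i]}.
Variable ip : V -> V -> R[i].

Definition sqn u : R := Re (ip u u).
Definition nrm u : R := Num.sqrt (sqn u).

Lemma ReJ (x : R[i]) : Re (conjc x) = Re x. Proof. by case: x. Qed.
Lemma ReN (x : R[i]) : Re (- x) = - Re x. Proof. by case: x. Qed.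
Lemma ReD (x y : R[i]) : Re (x + y) = Re x + Re y.
Proof. by case: x y => ? ? [? ?]. Qed.

(* Completeness is stated for geometrically convergent sequences, which is all
   that is used and is the form in which Riesz-Fischer proves it. *)
Record hilbert : Prop := Hilbert {
  ipDl : forall u v w, ip (u + v) w = ip u w + ip v w;
  ipZl : forall a u w, ip (a *: u) w = a * ip u w;
  ipC : forall u v, ip v u = conjc (ip u v);
  ip_ge0 : forall u, 0 <= sqn u;
  ip_eq0 : forall u, sqn u = 0 -> u = 0;
  ip_complete : forall (u : nat -> V) (c : R), 0 <= c ->
    (forall n, nrm (u n.+1 - u n) <= c * 2^-1 ^+ n) ->
    exists l, exists C : R, forall n, nrm (u n - l) <= C * 2^-1 ^+ n }.

Hypothesis hV : hilbert.

Lemma ipDr u v w : ip w (u + v) = ip w u + ip w v.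
Proof. by rewrite (ipC hV) (ipDl hV) rmorphD /= -!(ipC hV). Qed.
Lemma ipZr a u w : ip w (a *: u) = conjc a * ip w u.
Proof. by rewrite (ipC hV) (ipZl hV) rmorphM /= -!(ipC hV). Qed.
Lemma ip0l u : ip 0 u = 0.
Proof. by rewrite -(scale0r (0 : V)) (ipZl hV) mul0r. Qed.
Lemma ip0r u : ip u 0 = 0.
Proof. by rewrite (ipC hV) ip0l rmorph0. Qed.
Lemma ipNl u v : ip (- u) v = - ip u v.
Proof. by rewrite -scaleN1r (ipZl hV) mulN1r. Qed.
Lemma ipNr u v : ip u (- v) = - ip u v.
Proof. by rewrite (ipC hV) ipNl rmorphN /= -(ipC hV). Qed.
Lemma ipBl u v w : ip (u - v) w = ip u w - ip v w.
Proof. by rewrite (ipDl hV) ipNl. Qed.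
Lemma ipBr u v w : ip w (u - v) = ip w u - ip w v.
Proof. by rewrite ipDr ipNr. Qed.
Lemma ip_suml (I : Type) (s : seq I) (P : pred I) (F : I -> V) v :
  ip (\sum_(i <- s | P i) F i) v = \sum_(i <- s | P i) ip (F i) v.
Proof. by elim/big_rec2: _ => [|i y x _ <-]; rewrite ?ip0l ?(ipDl hV). Qed.
Lemma ip_sumr (I : Type) (s : seq I) (P : pred I) (F : I -> V) v :
  ip v (\sum_(i <- s | P i) F i) = \sum_(i <- s | P i) ip v (F i).
Proof. by elim/big_rec2: _ => [|i y x _ <-]; rewrite ?ip0r ?ipDr. Qed.

Lemma ip_re u : ip u u = (sqn u)%:C.
Proof.
have := ipC hV u u; rewrite /sqn; case: (ip u u) => a b [] /= H.
by congr Complex; lra.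
Qed.

Lemma sqnD u v : sqn (u + v) = sqn u + 2 * Re (ip u v) + sqn v.
Proof.
rewrite /sqn (ipDl hV) !ipDr (ipC hV u v).
case: (ip u u) (ip u v) (ip v v) => ? ? [? ?] [? ?] /=; ring.
Qed.

Lemma sqnZ a u : sqn (a *: u) = (Re a ^+ 2 + Im a ^+ 2) * sqn u.
Proof. rewrite /sqn (ipZl hV) ipZr ip_re; case: a => a b /=; ring. Qed.

Lemma sqnN u : sqn (- u) = sqn u.
Proof. by rewrite /sqn ipNl ipNr opprK. Qed.

Lemma sqnB u v : sqn (u - v) = sqn u - 2 * Re (ip u v) + sqn v.
Proof. rewrite sqnD sqnN ipNr; case: (ip u v) => a b /=; ring. Qed.

Lemma ReZ (a : R) u v : Re (ip (a%:C *: u) v) = a * Re (ip u v).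
Proof. rewrite (ipZl hV); case: (ip u v) => ? ? /=; ring. Qed.

Lemma Im_ip u v : Im (ip u v) = Re (ip (- 'i *: u) v).
Proof. rewrite (ipZl hV); case: (ip u v) => ? ? /=; ring. Qed.

(** Nonnegativity of [sqn] at [u - (Re <u,v> / |v|^2) v], the residual of projecting [u] onto the
    real line spanned by [v]. Only the real part is bounded here; [Im_ip] carries the bound over to
    the imaginary part. *)
Lemma cauchy_schwarz_sqn u v : Re (ip u v) ^+ 2 <= sqn u * sqn v.
Proof.
have [v0|v0] := eqVneq (sqn v) 0.
  by rewrite v0 mulr0 (ip_eq0 hV v0) ip0r /= expr0n.
have vp : 0 < sqn v by rewrite lt0r v0 (ip_ge0 hV).
have := ip_ge0 hV (u + (- (Re (ip u v) / sqn v))%:C *: v).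
rewrite sqnD sqnZ /= [ip u (_ *: v)](ipC hV) /= ReJ ReZ (ipC hV u v) ReJ.
set r := Re _; set a := sqn u; set b := sqn v in vp v0 *.
have -> : a + 2 * (- (r / b) * r) + ((- (r / b)) ^+ 2 + 0 ^+ 2) * b =
  (a * b - r ^+ 2) / b by field.
by rewrite pmulr_lge0 ?invr_gt0// subr_ge0.
Qed.

Lemma nrm_ge0 u : 0 <= nrm u. Proof. exact: sqrtr_ge0. Qed.
Lemma sqr_nrm u : nrm u ^+ 2 = sqn u.
Proof. by rewrite sqr_sqrtr// (ip_ge0 hV). Qed.
Lemma nrm_eq0 u : nrm u <= 0 -> u = 0.
Proof.
move=> u0; have {u0}u0 : nrm u = 0 by apply/eqP; rewrite eq_le u0 nrm_ge0.
by apply: (ip_eq0 hV); rewrite -sqr_nrm u0 expr0n.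
Qed.
Lemma nrm0 : nrm 0 = 0.
Proof. by rewrite /nrm /sqn ip0l sqrtr0. Qed.
Lemma nrmN u : nrm (- u) = nrm u.
Proof. by rewrite /nrm sqnN. Qed.
Lemma nrmBC u v : nrm (u - v) = nrm (v - u).
Proof. by rewrite -nrmN opprB. Qed.

Lemma cauchy_schwarz u v : `|Re (ip u v)| <= nrm u * nrm v.
Proof.
rewrite -sqrtrM ?(ip_ge0 hV)// -sqrtr_sqr ler_wsqrtr//.
exact: cauchy_schwarz_sqn.
Qed.

Lemma cauchy_schwarz_Im u v : `|Im (ip u v)| <= nrm u * nrm v.
Proof.
rewrite Im_ip; apply: le_trans (cauchy_schwarz _ _) _.
by rewrite /nrm sqnZ /= oppr0 sqrrN expr1n expr0n /= add0r mul1r.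
Qed.

Lemma nrmD u v : nrm (u + v) <= nrm u + nrm v.
Proof.
rewrite -(@ler_pXn2r _ 2) ?nnegrE ?nrm_ge0 ?addr_ge0 ?nrm_ge0//.
rewrite sqr_nrm sqnD sqrrD -!sqr_nrm lerD2r lerD2l.
have := le_trans (ler_norm _) (cauchy_schwarz u v); lra.
Qed.

Lemma nrmB_triangle w u v : nrm (u - v) <= nrm (u - w) + nrm (w - v).
Proof. by rewrite (_ : u - v = (u - w) + (w - v)) ?nrmD// subrKA. Qed.

Lemma nrmZ a u : nrm (a *: u) = Num.sqrt (Re a ^+ 2 + Im a ^+ 2) * nrm u.
Proof. by rewrite /nrm sqnZ sqrtrM// addr_ge0 ?sqr_ge0. Qed.

Definition submodule (S : set V) : Prop :=
  S 0 /\ forall a u v, S u -> S v -> S (a *: u + v).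

(* Projection theorem, in the form: a subspace with trivial orthogonal
   complement is dense. *)
Lemma dense_of_orthogonal (S : set V) : submodule S ->
  (forall v, (forall s, S s -> ip s v = 0) -> v = 0) ->
  forall f e, 0 < e -> exists2 s, S s & nrm (f - s) <= e.
Proof.
move=> [S0 SS] orth f e e0.
have SD u v : S u -> S v -> S (u + v).
  by move=> Su Sv; have := SS 1 u v Su Sv; rewrite scale1r.
have SZ a u : S u -> S (a *: u).
  by move=> Su; have := SS a u 0 Su S0; rewrite addr0.
pose A := [set sqn (f - s) | s in S].
have hA : has_inf A.
  split; first by exists (sqn (f - 0)); exists 0.
  by exists 0 => _ [s _ <-]; exact: (ip_ge0 hV).
pose d := inf A.
have dle s : S s -> d <= sqn (f - s).
  by move=> Ss; apply: ge_inf; [exact: hA.2|exists s].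
(* Squared distance within [4^-n] of the infimum: by the parallelogram identity, consecutive
   differences are then at most [2 * 2^-n], the rate that [ip_complete] asks for. *)
have /choice[s sP] n : exists s, S s /\ sqn (f - s) <= d + (2^-1 ^+ n) ^+ 2.
  have : 0 < ((2^-1 : R) ^+ n) ^+ 2 by rewrite !exprn_gt0.
  by move=> /(inf_adherent)/(_ hA) [_ [s Ss <-]] /ltW ?; exists s.
have par n : sqn (s n.+1 - s n) <= 4 * (2^-1 ^+ n) ^+ 2.
  have [Ss sn] := sP n; have [Ss1 sn1] := sP n.+1.
  have := dle _ (SZ (2^-1)%:C _ (SD _ _ Ss Ss1)).
  have -> : f - (2^-1)%:C *: (s n + s n.+1) =
      (2^-1)%:C *: ((f - s n) + (f - s n.+1)).
    rewrite addrACA -opprD scalerBr; congr (_ - _).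
    rewrite -mulr2n -(scaler_nat 2 f) scalerA.
    suff -> : (2^-1)%:C * 2%:R = 1 :> R[i] by rewrite scale1r.
    by rewrite -(rmorph_nat (real_complex R) 2) -rmorphM /= mulVf.
  have -> : s n.+1 - s n = (f - s n) - (f - s n.+1).
    by rewrite opprB [RHS]addrC subrKA.
  move: sn sn1; move: (f - s n) (f - s n.+1) => x y.
  rewrite sqnZ sqnB sqnD (exprS _ n) exprMn /=.
  have := sqr_ge0 ((2^-1 : R) ^+ n).
  move: ((2^-1 ^+ n) ^+ 2) => p; lra.
have [||l [C lP]] := ip_complete hV (u := s) (c := 2) => //.
  move=> n; rewrite -(@ler_pXn2r _ 2) ?nnegrE ?nrm_ge0 ?mulr_ge0 ?exprn_ge0//.
  by rewrite sqr_nrm exprMn -natrX; exact: par.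
(* Moving [s n] by the optimal real multiple of [t] lowers the squared distance by [Re^2 / |t|^2],
   and near-minimality allows a gain of at most [4^-n]. *)
have reE t : S t -> forall n, Re (ip t (f - s n)) ^+ 2 <= sqn t * (2^-1 ^+ n) ^+ 2.
  move=> St n; have [Ssn sn] := sP n.
  have [t0|t0] := eqVneq (sqn t) 0.
    by rewrite t0 (ip_eq0 hV t0) ip0l /= expr0n mul0r.
  have tp : 0 < sqn t by rewrite lt0r t0 (ip_ge0 hV).
  set r := Re _.
  have := dle _ (SD _ _ (SZ (r / sqn t)%:C _ St) Ssn).
  rewrite opprD addrCA sqnD sqnN sqnZ /= ipNl /=.
  rewrite ReN ReZ -/r => h.
  have : 0 <= (2^-1 ^+ n) ^+ 2 - r ^+ 2 / sqn t.
    suff : - (r ^+ 2 / sqn t) = ((r / sqn t) ^+ 2 + 0 ^+ 2) * sqn t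
       + 2 * - (r / sqn t * r) by lra.
    by field.
  by rewrite subr_ge0 ler_pdivrMr// mulrC.
have fl : f - l = 0.
  apply: orth => t0 St0.
  suff re t : S t -> Re (ip t (f - l)) = 0.
    apply/eqP; rewrite eq_complex /= Im_ip re// ?re ?eqxx//; exact: SZ.
  move=> St; apply/eqP; rewrite -normr_le0.
  apply: (@le0_of_le_geometric _ _ (nrm t * (1 + C))) => n.
  rewrite -(subrKA (s n) f) ipDr.
  rewrite ReD; apply: le_trans (ler_normD _ _) _; rewrite mulrDr mulr1 mulrDl lerD//.
    rewrite -(@ler_pXn2r _ 2) ?nnegrE ?mulr_ge0 ?exprn_ge0 ?nrm_ge0//.
    rewrite real_normK ?num_real// exprMn sqr_nrm; exact: reE.
  by apply: le_trans (cauchy_schwarz _ _) _; rewrite -mulrA ler_wpM2l ?nrm_ge0.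
have [n nP] : exists n, C * 2^-1 ^+ n <= e.
  apply: contrapT => /forallNP H.
  suff : e <= 0 by rewrite leNgt e0.
  by apply: (@le0_of_le_geometric _ _ C) => n; have /negP := H n; rewrite -ltNge => /ltW.
exists (s n); first by have [] := sP n.
move/subr0_eq : fl => ->; rewrite nrmBC; exact: le_trans (lP n) nP.
Qed.

(** Two sequences are allowed because the identities carried to the limit are adjoint relations such
    as [<u_n, d psi> = - <w_n, psi>], where [u_n] and [w_n] converge separately. *)
Lemma ip_lim (u u' : nat -> V) l l' v v' (C C' : R) :
  (forall n, nrm (u n - l) <= C * 2^-1 ^+ n) ->
  (forall n, nrm (u' n - l') <= C' * 2^-1 ^+ n) ->
  (forall n, ip (u n) v = ip (u' n) v') -> ip l v = ip l' v'.
Proof.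
move=> ul ul' uu.
have E n : ip l v - ip l' v' = ip (u' n - l') v' - ip (u n - l) v.
  by rewrite !ipBl uu; ring.
apply/eqP; rewrite -subr_eq0 eq_complex -!normr_le0; apply/andP.
split; apply: (@le0_of_le_geometric _ _ (nrm v' * C' + nrm v * C)) => n;
  rewrite (E n).
- have -> (x y : R[i]) : Re (x - y) = Re x - Re y by case: x; case: y.
  rewrite mulrDl -!mulrA; apply: le_trans (ler_normB _ _) _; apply: lerD;
  by apply: le_trans (cauchy_schwarz _ _) _; rewrite mulrC ler_wpM2l ?nrm_ge0.
- have -> (x y : R[i]) : Im (x - y) = Im x - Im y by case: x; case: y.
  rewrite mulrDl -!mulrA; apply: le_trans (ler_normB _ _) _; apply: lerD;
  by apply: le_trans (cauchy_schwarz_Im _ _) _; rewrite mulrC ler_wpM2l ?nrm_ge0.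
Qed.

(** * Resolvents of nonnegative operators *)

Section nonneg_operator.
Variables (D : set V) (T : V -> V).
Hypothesis D_submodule : submodule D.
Hypothesis TZD : forall a u v, D u -> D v -> T (a *: u + v) = a *: T u + T v.
Hypothesis T_ge0 : forall u, D u -> 0 <= ip (T u) u.

(** In [<(T - z) u, u> = t - z |u|^2] the number [t] is real and nonnegative. For real [z < 0] the
    real part is at least [- Re z * |u|^2]; otherwise the imaginary part has modulus
    [|Im z| * |u|^2]. Cauchy-Schwarz then lets one factor [|u|] be divided out. *)
Lemma nonneg_lower_bound (z : R[i]) : (forall x : R, 0 <= x -> z <> x%:C) ->
  exists2 c : R, 0 < c & forall u, D u -> c * nrm u <= nrm (T u - z *: u).
Proof.
move=> zoff.
have key (c : R) : 0 < c -> (forall u, D u ->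
    c * sqn u <= nrm (T u - z *: u) * nrm u) ->
    forall u, D u -> c * nrm u <= nrm (T u - z *: u).
  move=> c0 H u Du; have [u0|u0] := eqVneq (nrm u) 0.
    by rewrite u0 mulr0 nrm_ge0.
  have up : 0 < nrm u by rewrite lt0r u0 nrm_ge0.
  by rewrite -(ler_pM2r up) -mulrA -expr2 sqr_nrm; exact: H.
have E u : D u -> exists2 t, 0 <= t &
    ip (T u - z *: u) u = t%:C - z * (sqn u)%:C.
  move=> Du; have := T_ge0 Du; rewrite ipBl (ipZl hV) -ip_re.
  case: (ip (T u) u) => a b; rewrite lecE /= => /andP[/eqP-> a0].
  by exists a.
have [zi|zi] := eqVneq (Im z) 0.
  have zr : Re z < 0.
    rewrite ltNge; apply/negP => z0; apply: (zoff (Re z)) => //.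
    by case: z zi {zoff z0 key E} => a b /= ->.
  exists (- Re z); first by rewrite oppr_gt0.
  apply: key; first by rewrite oppr_gt0.
  move=> u Du; have [t t0 Et] := E u Du.
  apply: le_trans (cauchy_schwarz _ _); apply: le_trans (ler_norm _).
  rewrite Et; move: zi zr {zoff E Et}; case: z => a b /= -> az.
  by have := ip_ge0 hV u; nra.
exists `|Im z|; first by rewrite normr_gt0.
apply: key; first by rewrite normr_gt0.
move=> u Du; have [t t0 Et] := E u Du.
apply: le_trans (cauchy_schwarz_Im _ _); rewrite Et.
rewrite -[X in _ * X]ger0_norm ?(ip_ge0 hV)// -normrM.
case: z {zoff E Et zi} => a b /=.
by rewrite mulr0 add0r add0r normrN.
Qed.

Hypothesis T1_onto : forall f, exists2 u, D u & T u + u = f.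

Let D0 : D 0. Proof. by case: D_submodule. Qed.
Let DZ a u : D u -> D (a *: u).
Proof. by move=> Du; have := D_submodule.2 a u 0 Du D0; rewrite addr0. Qed.
Let DD u v : D u -> D v -> D (u + v).
Proof. by move=> Du Dv; have := D_submodule.2 1 u v Du Dv; rewrite scale1r. Qed.
Let TD u v : D u -> D v -> T (u + v) = T u + T v.
Proof. by move=> Du Dv; have := TZD 1 Du Dv; rewrite !scale1r. Qed.
Let T0 : T 0 = 0.
Proof.
have := TD D0 D0; rewrite addr0 => /eqP.
by rewrite -subr_eq0 opprD addrA subrr sub0r oppr_eq0 => /eqP.
Qed.
Let TZ a u : D u -> T (a *: u) = a *: T u.
Proof. by move=> Du; have := TZD a Du D0; rewrite T0 !addr0. Qed.

(** Polarization: the imaginary part of [<T w, w>] vanishes at [w = u + v] and at [w = 'i u + v],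
    which gives two real equations between [<T u, v>] and [<T v, u>]. *)
Lemma nonneg_symmetric u v : D u -> D v -> ip (T u) v = ip u (T v).
Proof.
move=> Du Dv.
have re w : D w -> Im (ip (T w) w) = 0 by move=> Dw; apply: ger0_Im; exact: T_ge0.
have := re _ (DD Du Dv); have := re _ (DD (DZ 'i Du) Dv).
rewrite !TD ?TZ//; last exact: DZ.
rewrite !(ipDl hV) !ipDr !ipZr !(ipZl hV).
have := re u Du; have := re v Dv; rewrite (ipC hV (T v) u).
case: (ip (T u) u) (ip (T v) v) (ip (T u) v) (ip (T v) u) =>
  [a b] [a' b'] [c d] [c' d'] /= b0 b'0 h1 h2.
congr Complex; lra.
Qed.

Lemma nonneg_resolvent (z : R[i]) : (forall x : R, 0 <= x -> z <> x%:C) ->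
  forall f, exists2 u, D u & T u - z *: u = f.
Proof.
move=> zoff f.
have zJoff (x : R) : 0 <= x -> conjc z <> x%:C.
  move=> /zoff zx zE; apply: zx; rewrite -(conjcK z) zE; exact: conjc_real.
have N1off (x : R) : 0 <= x -> -1 <> x%:C :> R[i].
  by move=> x0 [] ?; lra.
(* Three lower bounds: at [z] for the Cauchy property of approximate solutions, at the conjugate of
   [z] to kill vectors orthogonal to the range, at [-1] to control the inverse of [T + 1]. *)
have [c c0 cP] := nonneg_lower_bound zoff.
have [c' c'0 c'P] := nonneg_lower_bound zJoff.
have [k k0 kP] := nonneg_lower_bound N1off.
pose S := [set T u - z *: u | u in D].
have SS : submodule S.
  split; first by exists 0 => //; rewrite T0 scaler0 subr0.
  move=> a _ _ [u Du <-] [v Dv <-]; exists (a *: u + v).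
    exact: D_submodule.2.
  by rewrite TZD// scalerDr scalerBr !scalerA opprD addrACA (mulrC z).
(* If [v] is orthogonal to the range of [T - z] and [(T + 1) g = v], testing
   with [y = (T + 1)^-1 w] shows [v = (1 + conj z) g], so [v] is in [D] and
   in the kernel of [T - conj z]. *)
have orth v : (forall s, S s -> ip s v = 0) -> v = 0.
  move=> Sv.
  have [g Dg gE] := T1_onto v.
  suff vE : v = (1 + conjc z) *: g.
    apply: nrm_eq0; have Dv : D v by rewrite vE; exact: DZ.
    have := c'P v Dv; suff -> : T v - conjc z *: v = 0.
      by rewrite nrm0 pmulr_rle0.
    rewrite vE TZ// scalerA mulrC -scalerA -scalerBr.
    suff -> : T g - conjc z *: g = 0 by rewrite scaler0.
    apply/eqP; rewrite subr_eq0; apply/eqP.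
    by apply: (addIr g); rewrite gE vE scalerDl scale1r addrC.
  apply: subr0_eq; apply: nrm_eq0.
  suff : sqn (v - (1 + conjc z) *: g) = 0.
    by rewrite /nrm => ->; rewrite sqrtr0.
  set w := v - _; have [y Dy yE] := T1_onto w.
  have := Sv _ (imageP _ Dy).
  have -> : T y - z *: y = w - (1 + z) *: y.
    by rewrite -yE scalerDl scale1r opprD addrA addrK.
  rewrite ipBl (ipZl hV) => E.
  suff : ip w w = 0 by rewrite /sqn => ->.
  rewrite {2}/w ipBr ipZr.
  have -> : conjc (1 + conjc z) = 1 + z by case: (z) => a b; congr Complex => /=; ring.
  suff -> : ip w g = ip y v by [].
  rewrite -yE -{1}gE (ipDl hV) ipDr nonneg_symmetric//.
(* By [orth] the range of [T - z] is dense. Solutions up to [2^-n] form a Cauchy sequence because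
   [T - z] is bounded below by [c], whence the constant [2 / c]. *)
have /choice[u uP] n : exists u, D u /\ nrm (f - (T u - z *: u)) <= 2^-1 ^+ n.
  have [|_ [u Du <-] ?] := dense_of_orthogonal SS orth f (e := 2^-1 ^+ n).
    by rewrite exprn_gt0.
  by exists u.
have DB a b : D a -> D b -> D (a - b).
  move=> Da Db; rewrite -scaleN1r; apply: DD => //; exact: DZ.
have TB a b : D a -> D b -> T (a - b) = T a - T b.
  by move=> Da Db; have := TZD (-1) Db Da; rewrite !scaleN1r addrC => ->; rewrite addrC.
have [||l [C lP]] := ip_complete hV (u := u) (c := 2 / c).
- by rewrite divr_ge0// ltW.
- move=> n; have [Dn Pn] := uP n; have [Dn1 Pn1] := uP n.+1.
  rewrite mulrAC ler_pdivlMr// mulrC; apply: le_trans (cP _ (DB _ _ Dn1 Dn)) _.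
  have -> : T (u n.+1 - u n) - z *: (u n.+1 - u n) =
     (T (u n.+1) - z *: u n.+1) - (T (u n) - z *: u n).
    by rewrite TB// scalerBr !opprB addrACA [- T _ - _]addrC [RHS]addrACA.
  apply: le_trans (nrmB_triangle f _ _) _; rewrite nrmBC.
  apply: le_trans (lerD Pn1 Pn) _.
  have : (2^-1 : R) ^+ n >= 0 by rewrite exprn_ge0.
  rewrite exprS; lra.
(* [u n = (T + 1)^-1 ((T - z) (u n) + (1 + z) u n)] and the right-hand side
   converges, so its limit [l] is in the domain. *)
have [g Dg gE] := T1_onto (f + (1 + z) *: l).
set K := Num.sqrt (Re (1 + z) ^+ 2 + Im (1 + z) ^+ 2).
have gl : g = l.
  apply: subr0_eq; apply: nrm_eq0.
  apply: (@le0_of_le_geometric _ _ (k^-1 * (1 + K * C) + C)) => n.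
  have [Dn Pn] := uP n.
  apply: le_trans (nrmB_triangle (u n) _ _) _; rewrite mulrDl lerD//.
  rewrite -mulrA mulrC ler_pdivlMr// mulrC; apply: le_trans (kP _ (DB _ _ Dg Dn)) _.
  have -> : T (g - u n) - (-1) *: (g - u n) =
     (f - (T (u n) - z *: u n)) + (1 + z) *: (l - u n).
    rewrite scaleN1r opprK TB// addrACA gE scalerBr [RHS]addrACA; congr (_ + _).
    by rewrite [in RHS]scalerDl scale1r opprB opprD [- u n - _]addrC addrACA subrr add0r.
  apply: le_trans (nrmD _ _) _; rewrite mulrDl mul1r lerD//.
  by rewrite nrmZ -/K -mulrA ler_wpM2l ?sqrtr_ge0// nrmBC.
exists l; first by rewrite -gl.
rewrite -gl; have := gE; rewrite -gl => /(canRL (addrK _)) ->.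
by rewrite -addrA -opprD scalerDl scale1r addrK.
Qed.

End nonneg_operator.
End hilbert.

(** * Real square integrable functions and their completeness *)

Section real_L2.
Context {d : measure_display} {T : measurableType d} {R : realType}.
Variable mu : {measure set T -> \bar R}.

Lemma Lfun2P (f : T -> R) : f \in Lfun mu 2%:E <->
  measurable_fun setT f /\ mu.-integrable setT (fun x => (f x ^+ 2)%:E).
Proof.
split=> [fL|[mf /integrableP[mf2 if2]]].
  split; last exact: (Lfun2_integrable_sqr fL).
  by move: fL; rewrite inE => /andP[/[!inE]].
apply/andP; rewrite !inE /=; split=> //.
rewrite /finite_norm unlock /= poweR_lty//.
under eq_integral => x _ do rewrite powR_mulrn// -normrX.
exact: if2.
Qed.

Lemma Lfun2_measurable (f : T -> R) : f \in Lfun mu 2%:E -> measurable_fun setT f.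
Proof. by move=> /Lfun2P[]. Qed.

Lemma Lfun2_mul_integrable (f g : T -> R) :
  f \in Lfun mu 2%:E -> g \in Lfun mu 2%:E ->
  mu.-integrable setT (fun x => (f x * g x)%:E).
Proof. by move=> fL gL; have /Lfun1_integrable := Lfun2_mul_Lfun1 fL gL. Qed.

Lemma Lfun2D (f g : T -> R) : f \in Lfun mu 2%:E -> g \in Lfun mu 2%:E ->
  (fun x => f x + g x) \in Lfun mu 2%:E.
Proof.
move=> fL gL; have le12 : (1 <= 2%:E :> \bar R)%E by rewrite lee_fin ler1n.
have [_ SZ] := Lfun_submod_closed mu le12.
by have := SZ 1 f g fL gL; rewrite scale1r.
Qed.

Lemma Lfun2Z (a : R) (f : T -> R) : f \in Lfun mu 2%:E ->
  (fun x => a * f x) \in Lfun mu 2%:E.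
Proof.
move=> fL; have le12 : (1 <= 2%:E :> \bar R)%E by rewrite lee_fin ler1n.
have [S0 SZ] := Lfun_submod_closed mu le12.
by have := SZ a f 0 fL S0; rewrite addr0.
Qed.

Lemma Lfun2B (f g : T -> R) : f \in Lfun mu 2%:E -> g \in Lfun mu 2%:E ->
  (fun x => f x - g x) \in Lfun mu 2%:E.
Proof.
move=> fL /(Lfun2Z (-1)) gL; have := Lfun2D fL gL.
by under eq_fun do rewrite mulN1r.
Qed.

Lemma eq_ae_Rintegral (f g : T -> R) :
  measurable_fun setT f -> measurable_fun setT g ->
  {ae mu, forall x, f x = g x} -> (\int[mu]_x f x = \int[mu]_x g x)%R.
Proof.
move=> mf mg fg; congr fine; apply: ae_eq_integral => //; try exact/measurable_EFinP.
by rewrite /ae_eq; apply: filterS fg => x fgx _ /=; rewrite fgx.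
Qed.

Section riesz_fischer.
Variables (f : nat -> T -> R) (c : R).

Hypothesis fL : forall n, f n \in Lfun mu 2%:E.
Hypothesis f_cauchy : forall n,
  (\int[mu]_x ((f n.+1 x - f n x) ^+ 2)%:E <= ((c * 2^-1 ^+ n) ^+ 2)%:E)%E.

Let mf n : measurable_fun setT (f n). Proof. exact: Lfun2_measurable. Qed.

(** Split off the first step and use [(a + b)^2 <= 2 a^2 + 2 b^2]. The constant [4] reproduces
    itself, since passing from [n] to [n + 1] divides the squared bound by [4] and
    [2 * 4 / 4 + 2 = 4]. *)
Let cauchy m n : (\int[mu]_x ((f (n + m)%N x - f n x) ^+ 2)%:E <=
  (4 * (c * 2^-1 ^+ n) ^+ 2)%:E)%E.
Proof.
have mB p q : measurable_fun setT (fun x => ((f p x - f q x) ^+ 2)).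
  by apply: measurable_funX; exact: measurable_funB.
elim: m n => [|m IH] n.
  rewrite addn0; under eq_integral do rewrite subrr expr0n/=.
  by rewrite integral0 lee_fin mulr_ge0// sqr_ge0.
rewrite addnS -addSn.
apply: (@le_trans _ _ (\int[mu]_x ((2 * (f (n.+1 + m)%N x - f n.+1 x) ^+ 2)%:E +
    (2 * (f n.+1 x - f n x) ^+ 2)%:E))%E).
  apply: ge0_le_integral => //.
  - by move=> x _; rewrite lee_fin sqr_ge0.
  - exact/measurable_EFinP.
  - by apply: emeasurable_funD; apply/measurable_EFinP;
      exact: measurable_funM.
  move=> x _; rewrite lee_fin.
  have := sqr_ge0 ((f (n.+1 + m)%N x - f n.+1 x) - (f n.+1 x - f n x)); nra.
rewrite ge0_integralD//; first last.
- by apply/measurable_EFinP; exact: measurable_funM.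
- by move=> x _; rewrite lee_fin mulr_ge0// sqr_ge0.
- by apply/measurable_EFinP; exact: measurable_funM.
- by move=> x _; rewrite lee_fin mulr_ge0// sqr_ge0.
under eq_integral do rewrite EFinM.
rewrite ge0_integralZl//; last by move=> x _; rewrite lee_fin sqr_ge0.
  under [X in (_ + X)%E]eq_integral do rewrite EFinM.
  rewrite ge0_integralZl//; last by move=> x _; rewrite lee_fin sqr_ge0.
    apply: (le_trans (leeD (lee_wpmul2l _ (IH n.+1)) (lee_wpmul2l _ (f_cauchy n)))).
      by rewrite lee_fin.
      by rewrite lee_fin.
    rewrite -!EFinM -EFinD lee_fin (exprS _ n).
    by rewrite le_eqVlt; apply/orP; left; apply/eqP; field.
  exact/measurable_EFinP.
exact/measurable_EFinP.
Qed.

Lemma riesz_fischer : exists2 g, g \in Lfun mu 2%:E &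
  forall n, (\int[mu]_x ((f n x - g x) ^+ 2)%:E <= (4 * (c * 2^-1 ^+ n) ^+ 2)%:E)%E.
Proof.
(* The weight [2^n] does two jobs: the integral of [h n] is at most [c^2 2^-n], hence summable, and
   [|a| <= 2^n a^2 + 2^-n] turns finiteness of [G x] into absolute convergence of the telescoping
   series at [x]. *)
pose h n x := 2 ^+ n * (f n.+1 x - f n x) ^+ 2.
have mh n : measurable_fun setT (h n).
  by apply: measurable_funM => //; apply: measurable_funX; exact: measurable_funB.
have h0 n x : (0 <= (h n x)%:E)%E by rewrite lee_fin mulr_ge0 ?sqr_ge0 ?exprn_ge0.
pose G x := (\sum_(n <oo) (h n x)%:E)%E.
have intG : (\int[mu]_x G x < +oo)%E.
  rewrite integral_nneseries//; last by move=> n; exact/measurable_EFinP.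
  apply: (@le_lt_trans _ _ (\sum_(n <oo) (c ^+ 2 * 2^-1 ^+ n)%:E)%E).
    apply: lee_nneseries => [n _ _|n _]; first exact: integral_ge0.
    rewrite /h; under eq_integral do rewrite EFinM.
    rewrite ge0_integralZl//; last first.
    - by move=> x _; rewrite lee_fin sqr_ge0.
    - apply/measurable_EFinP; apply: measurable_funX; exact: measurable_funB.
    apply: (le_trans (lee_wpmul2l _ (f_cauchy n))); first by rewrite lee_fin exprn_ge0.
    rewrite -EFinM lee_fin exprMn [2 ^+ n * _]mulrC -mulrA ler_wpM2l ?sqr_ge0//.
    by rewrite expr2 -mulrA -exprMn mulVf// expr1n mulr1.
  apply: (@le_lt_trans _ _ (2 * c ^+ 2)%:E%E); last exact: ltry.
  have c2 : 0 <= 2 * c ^+ 2 by rewrite mulr_ge0 ?sqr_ge0.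
  apply: le_trans (epsilon_trick0 xpredT c2).
  apply: lee_nneseries => n _; rewrite lee_fin.
    by rewrite mulr_ge0 ?sqr_ge0 ?exprn_ge0.
  by rewrite exprVn natrX (exprS _ n) invfM mulrACA mulfV// mul1r.
have Gfin : {ae mu, forall x, G x \is a fin_num}.
  have G0 x : (0 <= G x)%E by apply: nneseries_ge0.
  have mG : measurable_fun setT G.
    by apply: ge0_emeasurable_sum => [n x _ _|n _]; [exact: h0|exact/measurable_EFinP].
  have iG : mu.-integrable setT G.
    apply/integrableP; split=> //.
    by under eq_integral do rewrite gee0_abs ?G0//.
  by apply: filterS (integrable_ae measurableT iG) => x; exact.
have fcvg x : G x \is a fin_num -> cvgn (f ^~ x).
  move=> Gx; rewrite (_ : f^~ x = (fun n => f 0%N x + series (telescope (f^~ x)) n)); last first.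
    by apply/funext => n; rewrite -eq_sum_telescope.
  apply: is_cvgD; first exact: is_cvg_cst.
  apply: normed_cvg.
  apply: (@series_le_cvg _ _ (fun n => h n x + 2^-1 ^+ n)) => [n|n|n|] /=.
  - exact: normr_ge0.
  - by rewrite addr_ge0 ?exprn_ge0// -lee_fin.
  - rewrite /telescope /= /h exprVn -real_normK ?num_real//.
    have p0 : 0 < 2 ^+ n :> R by rewrite exprn_gt0.
    move: (2 ^+ n) `|_| p0 => p a p0; rewrite -subr_ge0.
    have -> : p * a ^+ 2 + p^-1 - a = (p * a - 2^-1) ^+ 2 / p + 3 / 4 / p.
      by field; rewrite gt_eqF.
    apply: addr_ge0; apply: divr_ge0; rewrite ?sqr_ge0 ?(ltW p0)//.
  rewrite (_ : series _ = (fun n => series (h^~ x) n + series (geometric 1 2^-1) n)); last first.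
    by apply/funext => n; rewrite /series/= -big_split; apply: eq_bigr => i _ /=; rewrite mul1r.
  apply: is_cvgD; last first.
    by apply: is_cvg_geometric_series; rewrite ger0_norm// invf_lt1// ltr1n.
  apply: nondecreasing_is_cvgn.
    apply/nondecreasing_seqP => n; rewrite /series /= big_nat_recr//= lerDl.
    by rewrite -lee_fin.
  exists (fine (G x)) => _ [n _ <-]; rewrite -lee_fin fineK// /series /= -sumEFin.
  by apply: nneseries_lim_ge => m _ _; exact: h0.
(* An upper limit is measurable on the whole space. Where it is infinite [fine] returns [0], which
   happens only outside the almost sure set where [G] is finite. *)
pose g x := fine (limn_esup (fun n => (f n x)%:E)).
have mg : measurable_fun setT g.
  apply: measurableT_comp => //; apply: measurable_fun_limn_esup => n.
  exact/measurable_EFinP.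
have fg x : G x \is a fin_num -> f ^~ x @ \oo --> g x.
  move=> /fcvg/cvg_ex[l fl].
  have : (fun n => (f n x)%:E) @ \oo --> l%:E by apply: cvg_comp fl _.
  by rewrite /g => /cvg_limn_einf_sup[_ ->].
(* Fatou's lemma for [(f (n + m) - f n)^2] as [m] grows; [cauchy] bounds the integrals uniformly in
   [m]. *)
have key n : (\int[mu]_x ((f n x - g x) ^+ 2)%:E <= (4 * (c * 2^-1 ^+ n) ^+ 2)%:E)%E.
  have mB m : measurable_fun setT (fun x => ((f m x - f n x) ^+ 2)).
    by apply: measurable_funX; exact: measurable_funB.
  have -> : (\int[mu]_x ((f n x - g x) ^+ 2)%:E =
      \int[mu]_x limn_einf (fun m => ((f (n + m)%N x - f n x) ^+ 2)%:E))%E.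
    apply: ge0_ae_eq_integral => //.
    - by apply/measurable_EFinP; apply: measurable_funX; exact: measurable_funB.
    - apply: measurableT_comp => //; apply: measurable_fun_limn_esup => m.
      by apply: measurableT_comp => //; exact/measurable_EFinP.
    - by move=> x _; rewrite lee_fin sqr_ge0.
    - move=> x _; rewrite limn_einf_lim; apply: lime_ge; first exact: is_cvg_einfs.
      apply: nearW => m; apply: le_ereal_inf_tmp => _ [k _ <-].
      by rewrite lee_fin sqr_ge0.
    apply: filterS Gfin => x /fg fgx _ /=.
    have : (fun m => ((f (n + m)%N x - f n x) ^+ 2)%:E) @ \oo --> ((g x - f n x) ^+ 2)%:E.
      apply: cvg_EFin; first exact: nearW.
      rewrite (_ : fine \o _ = (fun m => (f (n + m)%N x - f n x) * (f (n + m)%N x - f n x))); last first.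
        by apply/funext => m /=; rewrite expr2.
      have fx : (fun m => f (n + m)%N x) @ \oo --> g x.
        by under eq_fun do rewrite addnC; move: fgx; rewrite -(cvg_shiftn n).
      by rewrite expr2; apply: cvgM; apply: cvgB => //; exact: cvg_cst.
    by move=> /cvg_limn_einf_sup[-> _]; rewrite -sqrrN opprB.
  apply: le_trans (fatou _ _ _ _) _ => //.
  - by move=> m; exact/measurable_EFinP.
  - by move=> m x _; rewrite lee_fin sqr_ge0.
  rewrite limn_einf_lim; apply: lime_le; first exact: is_cvg_einfs.
  apply: nearW => m; apply: le_trans (cauchy m n); apply: ereal_inf_lbound.
  by exists m => /=.
exists g => //.
have B0 : (fun x => f 0%N x - g x) \in Lfun mu 2%:E.
  apply/Lfun2P; split; first exact: measurable_funB.
  apply/integrableP; split.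
    by apply/measurable_EFinP; apply: measurable_funX; exact: measurable_funB.
  under eq_integral do rewrite gee0_abs ?lee_fin ?sqr_ge0//.
  by apply: le_lt_trans (key 0%N) _; exact: ltry.
by have := Lfun2B (fL 0%N) B0; under eq_fun do rewrite subKr.
Qed.

End riesz_fischer.
End real_L2.

(** * Complex [L^2] as a Hilbert space *)

Section complex_L2.
Context {d : measure_display} {T : measurableType d} {R : realType}.
Variable mu : {measure set T -> \bar R}.
Local Notation L2 := (L2 mu).
Local Notation L2rep := (L2rep mu).

Lemma ImD (x y : R[i]) : Im (x + y) = Im x + Im y.
Proof. by case: x y => ? ? [? ?]. Qed.

Lemma ImN (x : R[i]) : Im (- x) = - Im x.
Proof. by case: x. Qed.

Lemma repr_pi_ae (f : L2rep) : {ae mu, forall x, repr (\pi_L2 f) x = f x}.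
Proof.
have /asboolP : (repr (\pi_L2 f) - f) \in @L2null _ _ _ mu.
  by rewrite Quotient.idealrBE reprK.
by apply: filterS => x /eqP; rewrite /= !fctE subr_eq0 => /eqP.
Qed.

Lemma L2_eq_ae (u v : L2) : {ae mu, forall x, repr u x = repr v x} -> u = v.
Proof.
move=> uv; rewrite -[u]reprK -[v]reprK; apply/eqP; rewrite -Quotient.idealrBE.
by apply/asboolP; apply: filterS uv => x; rewrite /= !fctE => ->; rewrite subrr.
Qed.

Definition rdot (a b : T -> R) : R := (\int[mu]_x (a x * b x))%R.

Lemma rdotC a b : rdot a b = rdot b a.
Proof. by rewrite /rdot; under eq_Rintegral do rewrite mulrC. Qed.

Lemma rdotDl a b e : a \in Lfun mu 2%:E -> b \in Lfun mu 2%:E ->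
  e \in Lfun mu 2%:E -> rdot (fun x => a x + b x) e = rdot a e + rdot b e.
Proof.
move=> aL bL eL; rewrite /rdot -RintegralD//; [|exact: Lfun2_mul_integrable..].
by apply: eq_Rintegral => x _; rewrite mulrDl.
Qed.

Lemma rdotZl k a e : a \in Lfun mu 2%:E -> e \in Lfun mu 2%:E ->
  rdot (fun x => k * a x) e = k * rdot a e.
Proof.
move=> aL eL; rewrite /rdot -RintegralZl//; last exact: Lfun2_mul_integrable.
by apply: eq_Rintegral => x _; rewrite mulrA.
Qed.

Lemma rdotBl a b e : a \in Lfun mu 2%:E -> b \in Lfun mu 2%:E ->
  e \in Lfun mu 2%:E -> rdot (fun x => a x - b x) e = rdot a e - rdot b e.
Proof.
move=> aL bL eL; rewrite -mulN1r -rdotZl// -rdotDl//; last exact: Lfun2Z.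
by apply: eq_Rintegral => x _; rewrite mulN1r.
Qed.

Lemma L2funP (f : T -> R[i]) : f \in L2fun mu <->
  (fun x => Re (f x)) \in Lfun mu 2%:E /\ (fun x => Im (f x)) \in Lfun mu 2%:E.
Proof. by split=> [/andP[]|[? ?]] //; apply/andP. Qed.

Lemma repr_Re (u : L2) : (fun x => Re (repr u x)) \in Lfun mu 2%:E.
Proof. by have /L2funP[] := valP (repr u). Qed.
Lemma repr_Im (u : L2) : (fun x => Im (repr u x)) \in Lfun mu 2%:E.
Proof. by have /L2funP[] := valP (repr u). Qed.

(** [repr] picks an uncontrolled member of the class, so [repr (u + v)] is in general not the sum of
    the representatives. Computations are carried by an arbitrary representative instead. *)
Definition represents (u : L2) (f : T -> R[i]) : Prop :=
  f \in L2fun mu /\ {ae mu, forall x, repr u x = f x}.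

Lemma represents_repr u : represents u (repr u).
Proof. by split; [exact: valP|exact: aeW]. Qed.

Lemma represents_pi (f : L2rep) : represents (\pi_L2 f) f.
Proof. by split; [exact: valP|exact: repr_pi_ae]. Qed.

Lemma representsP (f : T -> R[i]) : f \in L2fun mu -> exists u, represents u f.
Proof. by move=> fL; exists (\pi_L2 (MkL2rep fL)); exact: represents_pi. Qed.

Lemma representsD u v f g : represents u f -> represents v g ->
  represents (u + v) (fun x => f x + g x).
Proof.
move=> [fL uf] [gL vg]; split; first exact: (rpredD fL gL).
have := repr_pi_ae (repr u + repr v); rewrite pi_addr !reprK => h.
apply: filterS3 h uf vg => x -> <- <-.
by rewrite /= !fctE.
Qed.

Lemma representsZ a u f : represents u f ->
  represents (a *: u) (fun x => a * f x).
Proof.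
move=> [fL uf]; split; first exact: (rpredZ a fL).
have := repr_pi_ae (a *: repr u); rewrite -pi_L2scale reprK => h.
by apply: filterS2 h uf => x -> <-; rewrite /= !fctE.
Qed.

Lemma representsB u v f g : represents u f -> represents v g ->
  represents (u - v) (fun x => f x - g x).
Proof.
move=> uf /(representsZ (-1)) vg; have := representsD uf vg.
by rewrite scaleN1r; under eq_fun do rewrite mulN1r.
Qed.

Lemma represents_inj u v f : represents u f -> represents v f -> u = v.
Proof.
by move=> [_ uf] [_ vf]; apply: L2_eq_ae; apply: filterS2 uf vf => x -> ->.
Qed.

Lemma inner_represents u v f g : represents u f -> represents v g ->
  inner u v = Cintegral mu (fun x => f x * conjc (g x)).
Proof.
move=> [/L2funP[Rf If] uf] [/L2funP[Rg Ig] vg].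
have mM (a b a' b' : T -> R) : a \in Lfun mu 2%:E -> b \in Lfun mu 2%:E ->
    a' \in Lfun mu 2%:E -> b' \in Lfun mu 2%:E ->
    measurable_fun setT (fun x => a x * b x - a' x * b' x).
  by move=> /Lfun2_measurable ? /Lfun2_measurable ? /Lfun2_measurable ?
    /Lfun2_measurable ?; apply: measurable_funB; exact: measurable_funM.
have mN (a : T -> R) : a \in Lfun mu 2%:E -> (fun x => - a x) \in Lfun mu 2%:E.
  by move=> /(Lfun2Z (-1)); under eq_fun do rewrite mulN1r.
have mRe f1 g1 : (fun x => Re (f1 x)) \in Lfun mu 2%:E ->
    (fun x => Im (f1 x)) \in Lfun mu 2%:E -> (fun x => Re (g1 x)) \in Lfun mu 2%:E ->
    (fun x => Im (g1 x)) \in Lfun mu 2%:E ->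
    measurable_fun setT (fun x => Re (f1 x * conjc (g1 x))) /\
    measurable_fun setT (fun x => Im (f1 x * conjc (g1 x))).
  move=> a b a' b'; split.
    rewrite (_ : (fun x => _) = (fun x => Re (f1 x) * Re (g1 x) - Im (f1 x) * - Im (g1 x))).
      by apply: mM => //; exact: mN.
    by apply/funext => x; case: (f1 x) (g1 x) => ? ? [? ?].
  rewrite (_ : (fun x => _) = (fun x => Im (f1 x) * Re (g1 x) - Re (f1 x) * Im (g1 x))).
    exact: mM.
  by apply/funext => x; case: (f1 x) (g1 x) => ? ? [? ?] /=; ring.
have [m1 m2] := mRe _ _ Rf If Rg Ig.
have [m3 m4] := mRe _ _ (repr_Re u) (repr_Im u) (repr_Re v) (repr_Im v).
rewrite /inner /Cintegral; congr Complex; apply: eq_ae_Rintegral => //;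
by apply: filterS2 uf vg => x -> ->.
Qed.

(** Reduces the complex inner product to the real form [rdot], whose bilinearity on square
    integrable functions rests on [Lfun2_mul_integrable]. *)
Lemma innerE u v f g : represents u f -> represents v g ->
  inner u v = (rdot (fun x => Re (f x)) (fun x => Re (g x)) +
    rdot (fun x => Im (f x)) (fun x => Im (g x))) +i*
   (rdot (fun x => Im (f x)) (fun x => Re (g x)) -
    rdot (fun x => Re (f x)) (fun x => Im (g x))).
Proof.
move=> uf vg; rewrite (inner_represents uf vg) /Cintegral.
have [/L2funP[Rf If] _] := uf; have [/L2funP[Rg Ig] _] := vg.
congr Complex; rewrite /rdot.
  rewrite -RintegralD//; [|exact: Lfun2_mul_integrable..].
  by apply: eq_Rintegral => x _; case: (f x) (g x) => ? ? [? ?] /=; ring.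
rewrite -RintegralB//; [|exact: Lfun2_mul_integrable..].
by apply: eq_Rintegral => x _; case: (f x) (g x) => ? ? [? ?] /=; ring.
Qed.

Local Notation ip := (@inner d T R mu).
Let reprE := represents_repr.

Lemma sqn_represents u f : represents u f ->
  sqn ip u = rdot (fun x => Re (f x)) (fun x => Re (f x)) +
                rdot (fun x => Im (f x)) (fun x => Im (f x)).
Proof. by move=> uf; rewrite /sqn (innerE uf uf). Qed.

Lemma rdot_ge0 a : 0 <= rdot a a.
Proof. by apply: Rintegral_ge0 => x _; rewrite -expr2 sqr_ge0. Qed.

Lemma rdot_eq0 a : a \in Lfun mu 2%:E -> rdot a a = 0 ->
  {ae mu, forall x, a x = 0}.
Proof.
move=> aL; have ia := Lfun2_mul_integrable aL aL.
move=> a0; have {}a0 : (\int[mu]_x (a x * a x)%:E = 0)%E.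
  by rewrite -(fineK (integrable_fin_num measurableT ia)) -[fine _]/(rdot a a) a0.
have am : measurable_fun setT (fun x => (a x * a x)%:E).
  by apply/measurable_EFinP; apply: measurable_funM; exact: Lfun2_measurable aL.
have : (\int[mu]_x `|(a x * a x)%:E| = 0)%E.
  by rewrite -[RHS]a0; apply: eq_integral => x _; rewrite gee0_abs// lee_fin -expr2 sqr_ge0.
move=> /(ae_eq_integral_abs mu measurableT am); apply: filterS => x /(_ I) [] /eqP.
by rewrite mulf_eq0 orbb => /eqP.
Qed.

Let innerDl (u v w : L2) : inner (u + v) w = inner u w + inner v w :> R[i].
Proof.
rewrite (innerE (representsD (reprE u) (reprE v)) (reprE w)).
rewrite (innerE (reprE u) (reprE w)) (innerE (reprE v) (reprE w)).
under [fun x => Re (_ + _)]eq_fun do rewrite ReD.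
under [fun x => Im (_ + _)]eq_fun do rewrite ImD.
rewrite !rdotDl ?repr_Re ?repr_Im//; congr Complex; ring.
Qed.

Let innerZl a (u w : L2) : inner (a *: u) w = a * inner u w :> R[i].
Proof.
rewrite (innerE (representsZ a (reprE u)) (reprE w)).
rewrite (innerE (reprE u) (reprE w)); case: a => a b.
rewrite (_ : (fun x => Re _) = (fun x => a * Re (repr u x) - b * Im (repr u x))); last first.
  by apply/funext => x; case: (repr u x).
rewrite (_ : (fun x => Im (_ * _)) = (fun x => a * Im (repr u x) + b * Re (repr u x))); last first.
  by apply/funext => x; case: (repr u x) => /= ? ?; ring.
rewrite !rdotBl ?Lfun2Z ?repr_Re ?repr_Im//.
rewrite !rdotDl ?rdotZl ?Lfun2Z ?repr_Re ?repr_Im//=.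
by congr Complex; ring.
Qed.

Let innerC (u v : L2) : inner v u = conjc (inner u v) :> R[i].
Proof.
rewrite (innerE (reprE u) (reprE v)) (innerE (reprE v) (reprE u)) /=.
by congr Complex; rewrite ?[rdot (fun x => _ (repr v x)) _]rdotC//; ring.
Qed.

Lemma sqr_nrm_L2 (u : L2) : nrm ip u ^+ 2 = sqn ip u.
Proof.
by rewrite sqr_sqrtr// (sqn_represents (reprE u)) addr_ge0// rdot_ge0.
Qed.

Lemma hilbert_L2 : hilbert (@inner d T R mu).
Proof.
split=> //.
- by move=> u; rewrite (sqn_represents (reprE u)) addr_ge0// rdot_ge0.
- move=> u; rewrite (sqn_represents (reprE u)) => /eqP.
  rewrite paddr_eq0 ?rdot_ge0// => /andP[/eqP R0 /eqP I0].
  have := rdot_eq0 (repr_Re u) R0; have := rdot_eq0 (repr_Im u) I0 => h1 h2.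
  apply: (represents_inj (f := cst 0)).
    split; first exact: (rpred0 (L2fun mu)).
    apply: filterS2 h1 h2 => x /=.
    by case: (repr u x) => a b /= -> ->.
  have := represents_pi (0 : L2rep).
  have -> : \pi_L2 (0 : L2rep) = 0 by rewrite pi_zeror.
  exact.
- move=> u c c0 uc.
  have cB n : represents (u n.+1 - u n) (fun x => repr (u n.+1) x - repr (u n) x).
    exact: representsB.
  have sq n : sqn ip (u n.+1 - u n) <= (c * 2^-1 ^+ n) ^+ 2.
    by rewrite -sqr_nrm_L2 ler_pXn2r ?nnegrE ?sqrtr_ge0 ?mulr_ge0 ?exprn_ge0.
  (* [P] stands for [Re] or [Im]: both parts inherit the Cauchy bound and are completed
     separately. *)
  have comp (P : R[i] -> R) : (forall x y, P (x - y) = P x - P y) ->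
      (forall n, (fun x => P (repr (u n) x)) \in Lfun mu 2%:E) ->
      (forall n, rdot (fun x => P (repr (u n.+1) x - repr (u n) x))
         (fun x => P (repr (u n.+1) x - repr (u n) x)) <= sqn ip (u n.+1 - u n)) ->
      exists2 g, g \in Lfun mu 2%:E & forall n,
        rdot (fun x => P (repr (u n) x) - g x) (fun x => P (repr (u n) x) - g x)
         <= 4 * (c * 2^-1 ^+ n) ^+ 2.
    move=> PB PL Pn.
    have EFin_rdot a : a \in Lfun mu 2%:E -> (rdot a a)%:E = (\int[mu]_x (a x ^+ 2)%:E)%E.
      move=> aL; rewrite fineK//.
      by apply: integrable_fin_num => //; exact: Lfun2_mul_integrable.
    have [||g gL gP] := @riesz_fischer _ _ _ mu (fun n x => P (repr (u n) x)) c.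
    - exact: PL.
    - move=> n; rewrite -EFin_rdot; last exact: Lfun2B.
      rewrite lee_fin; apply: le_trans (sq n); apply: le_trans (Pn n).
      by under [leRHS]eq_Rintegral do rewrite PB.
    exists g => // n; rewrite -lee_fin EFin_rdot//; exact: Lfun2B.
  have [||n|g gL gP] := comp (@Re R).
  - by case=> ? ? [].
  - by move=> n; exact: repr_Re.
  - by rewrite (sqn_represents (cB n)) lerDl rdot_ge0.
  have [||n|h hL hP] := comp (@Im R).
  - by case=> ? ? [].
  - by move=> n; exact: repr_Im.
  - by rewrite (sqn_represents (cB n)) lerDr rdot_ge0.
  have [l lgh] : exists l, represents l (fun x => g x +i* h x).
    by apply: representsP; apply/L2funP.
  (* Each part contributes at most [4 (c 2^-n)^2] to the squared norm, and [4 + 4 <= 4^2]. *)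
  exists l, (4 * c) => n.
  have cn0 : 0 <= c * 2^-1 ^+ n by rewrite mulr_ge0 ?exprn_ge0.
  rewrite -(@ler_pXn2r _ 2) ?nnegrE ?sqrtr_ge0 -?mulrA ?mulr_ge0//.
  rewrite sqr_nrm_L2 (sqn_represents (representsB (reprE (u n)) lgh)).
  rewrite exprMn; have := lerD (gP n) (hP n).
  under [fun x => Re (_ - _)]eq_fun do rewrite ReD ReN.
  under [fun x => Im (_ - _)]eq_fun do rewrite ImD ImN.
  have := sqr_ge0 (c * 2^-1 ^+ n); lra.
Qed.

End complex_L2.

(** * Cubes and Borel sets of [R^n] *)

Section cube.
Context {R : realType} {n : nat}.
Implicit Types a x : 'rV[R]_n.

(** Written by coordinates rather than through the sup norm, so that measurability for the product
    sigma-algebra and the splitting of one coordinate are direct; for [r > 0] it is the norm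
    ball. *)
Definition cube a (r : R) : set 'rV[R]_n :=
  [set x | forall i, `|x ord0 i - a ord0 i| < r].

Lemma cube_ball a r : 0 < r -> cube a r = ball a r.
Proof.
move=> r0; apply/seteqP; split => x /=.
  by move=> ax; split=> // i j; rewrite /ball /= ord1 distrC; exact: ax.
by move=> [_ ax] i; have := ax ord0 i; rewrite /ball /= distrC.
Qed.

Lemma measurable_cube a r : measurable (cube a r).
Proof.
rewrite (_ : cube a r = \big[setI/setT]_(i < n)
   ((fun v : 'rV[R]_n => v ord0 i) @^-1` ball (a ord0 i) r)).
  apply: bigsetI_measurable => i _; rewrite -[X in measurable X]setTI.
  by apply: measurable_rV_coord => //; exact: measurable_ball.
rewrite -bigcap_seq; apply/seteqP; split => x /=.
  by move=> ax i _; rewrite /ball /= distrC; exact: ax.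
by move=> ax i; have := ax i; rewrite /ball /= distrC; apply; rewrite mem_index_enum.
Qed.

(** The sigma-algebra is generated by the coordinates, not by the topology. The bridge: an open set
    is the union of the countably many cubes inside it with rational centre and radius
    [1 / (k + 1)]. *)
Lemma open_measurable_rV (U : set 'rV[R]_n) : open U -> measurable U.
Proof.
move=> oU.
pose q (p : 'rV[rat]_n) : 'rV[R]_n := map_mx ratr p.
pose F (p : 'rV[rat]_n * nat) :=
  if `[< cube (q p.1) p.2.+1%:R^-1 `<=` U >] then cube (q p.1) p.2.+1%:R^-1 else set0.
rewrite (_ : U = \bigcup_p F p).
  apply: countable_bigcupT_measurable => [|p]; first exact: countableP.
  by rewrite /F; case: ifP => // _; exact: measurable_cube.
apply/seteqP; split => x; last first.
  by move=> [p _]; rewrite /F; case: ifP => // /asboolP; apply.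
move=> Ux.
have /nbhs_ballP[e /= e0 eU] : nbhs x U by exact: open_nbhs_nbhs.
(* Half of [e], because a cube of radius [r] whose centre is within [r] of [x] reaches up to [2 r]
   from [x]. *)
have [k ke] : exists k : nat, k.+1%:R^-1 < e / 2.
  have e20 : 0 < e / 2 by rewrite divr_gt0.
  exists (Num.bound (e / 2)^-1); rewrite invf_plt ?posrE//.
  apply: lt_trans (archi_boundP _) _; first by rewrite invr_ge0 ltW.
  by rewrite ltr_nat.
have k0 : 0 < k.+1%:R^-1 :> R by rewrite invr_gt0.
have [r rE] : exists r : R, r = k.+1%:R^-1 by eexists.
rewrite -rE in k0 ke.
have /choice[p pP] i : exists p : rat, `|x ord0 i - ratr p| < r.
  have : x ord0 i - r < x ord0 i + r by lra.
  by move=> /rat_in_itvoo[p]; rewrite in_itv /= => /andP[? ?]; exists p; rewrite ltr_norml; apply/andP; split; lra.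
exists (\row_i p i, k) => //; rewrite /F /= -rE.
have -> : `[< cube (q (\row_i p i)) r `<=` U >].
  apply/asboolP => y yc; apply: eU; rewrite -cube_ball// => i.
  have := yc i; have := pP i; rewrite !mxE => h1 h2.
  rewrite (_ : _ - _ = (y ord0 i - ratr (p i)) - (x ord0 i - ratr (p i))); last by ring.
  by apply: le_lt_trans (ler_normB _ _) _; lra.
by move=> i; have := pP i; rewrite !mxE.
Qed.

Lemma continuous_measurable_rV (f : 'rV[R]_n -> R) :
  continuous f -> measurable_fun setT f.
Proof.
move=> cf; apply: (measurability (@RGenOpens.G R)).
  exact: RGenOpens.measurableE.
move=> _ [_ [a [b ->]] <-]; rewrite setTI; apply: open_measurable_rV.
by apply: open_comp => [x _|]; [exact: cf|exact: interval_open].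
Qed.

End cube.

(** Composing with a map that is affine along [v] leaves the difference quotient itself unchanged,
    so derivability and the derivative transfer together, without a chain rule. *)
Lemma quotient_comp_affine (R : realFieldType) (V W : normedModType R)
    (f : W -> R) (g : V -> W) a v w : (forall h : R, g (h *: v + a) = h *: w + g a) ->
  (fun h : R => h^-1 *: ((f \o g \o shift a) (h *: v) - (f \o g) a)) =
  (fun h : R => h^-1 *: ((f \o shift (g a)) (h *: w) - f (g a))).
Proof. by move=> gE; apply/funext => h /=; rewrite gE. Qed.

Lemma derivable_comp_affine (R : realFieldType) (V W : normedModType R)
    (f : W -> R) (g : V -> W) a v w : (forall h : R, g (h *: v + a) = h *: w + g a) ->
  derivable f (g a) w -> derivable (f \o g) a v.
Proof. by move=> gE; rewrite /derivable (quotient_comp_affine f gE). Qed.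

Lemma derive_comp_affine (R : realFieldType) (V W : normedModType R)
    (f : W -> R) (g : V -> W) a v w : (forall h : R, g (h *: v + a) = h *: w + g a) ->
  'D_v (f \o g) a = 'D_w f (g a).
Proof. by move=> gE; rewrite /derive (quotient_comp_affine f gE). Qed.

(** * Integrals of derivatives of compactly supported functions *)

Section cube_measure.
Context {R : realType}.
Local Notation mu n := (lebesgue_rV R n).

Lemma preimage_cons_cube n (a : 'rV[R]_n.+1) (r : R) :
  @rV_cons R n @^-1` cube a r =
  ball (a ord0 ord0) r `*` cube (rV_uncons a).2 r.
Proof.
apply/seteqP; split => -[t y] /=.
  move=> H; split => [|i].
    by have := H ord0; rewrite !mxE unlift_none /ball /= distrC.
  by have := H (lift ord0 i); rewrite !mxE liftK.
move=> [t0 yi] i; rewrite !mxE; case: (unliftP ord0 i) => [j ->|->] /=.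
  by have := yi j; rewrite mxE.
by move: t0; rewrite /ball /= distrC.
Qed.

Lemma lebesgue_rV_cube n (a : 'rV[R]_n) (r : R) : 0 < r ->
  mu n (cube a r) = ((2 * r) ^+ n)%:E.
Proof.
move=> r0; elim: n a => [|n IH] a.
  by rewrite /= diracE mem_set//= => -[].
rewrite /= /cons_measure /pushforward preimage_cons_cube.
rewrite product_measure1E ?IH; [|exact: measurable_ball|exact: measurable_cube].
rewrite exprS EFinM; congr (_ * _)%E.
by rewrite mulr_natl; exact: lebesgue_measure_ball (ltW r0).
Qed.

(** Working form of compact support: a cube has an explicit finite measure, and its slices along a
    coordinate lie in cubes of the same radius. *)
Definition supported n (r : R) (f : 'rV[R]_n -> R) : Prop :=
  forall x, ~ cube 0 r x -> f x = 0.

Lemma compact_cubeW n (a : 'rV[R]_n) (r : R) :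
  compact [set v : 'rV[R]_n | forall i, `[a ord0 i - r, a ord0 i + r]%classic (v ord0 i)].
Proof.
apply: (@rV_compact R n (fun i => `[a ord0 i - r, a ord0 i + r]%classic)) => i.
exact: segment_compact.
Qed.

Lemma supported_bounded n (r : R) (f : 'rV[R]_n -> R) : 0 < r -> continuous f ->
  supported r f -> exists2 M, 0 < M & forall x, `|f x| <= M.
Proof.
move=> r0 cf fr.
have := @compact_cubeW n 0 r.
set K := [set v | _] => cK.
have [|||x Kx xM] := @EVT_max_rV R n (fun x => `|f x|) K => //.
- by exists 0 => i /=; rewrite mxE sub0r add0r in_itv /=; apply/andP; split; lra.
- by apply: continuous_subspaceT => x; apply: continuous_comp; [exact: cf|exact: norm_continuous].
exists (`|f x| + 1) => [|y]; first by rewrite ltr_wpDl.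
have [Ky|Ky] := pselect (cube 0 r y); last by rewrite fr// normr0 addr_ge0.
rewrite ler_wpDr//; apply: xM; rewrite inE => i; have := Ky i.
by rewrite /= mxE subr0 sub0r add0r in_itv /= => /ltW; rewrite ler_norml.
Qed.

Lemma supported_integrable n (r : R) (f : 'rV[R]_n -> R) : 0 < r -> continuous f ->
  supported r f -> (mu n).-integrable setT (EFin \o f).
Proof.
move=> r0 cf fr; have [M M0 fM] := supported_bounded r0 cf fr.
have -> : EFin \o f = (EFin \o f) \_ (cube 0 r).
  by apply/funext => x; rewrite patchE; case: ifPn => // /negP; rewrite inE => /fr /= ->.
apply/(integrable_mkcond (EFin \o f) (measurable_cube 0 r)).
apply: measurable_bounded_integrable.
- exact: measurable_cube.
- by apply: (@le_lt_trans _ _ ((2 * r) ^+ n)%:E); rewrite ?ltry// -(lebesgue_rV_cube 0 r0).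
- apply: measurable_funTS; exact: continuous_measurable_rV.
- exists M; split; first exact: num_real.
  by move=> N MN x _ /=; apply: le_trans (fM x) (ltW MN).
Qed.

Lemma integral_derive1_eq0 (F : R -> R) (M : R) : 0 < M ->
  (forall x, derivable F x 1) -> continuous ('D_1 F) ->
  (forall x, M <= `|x| -> F x = 0) ->
  (\int[@lebesgue_measure R]_x ('D_1 F x)%:E = 0)%E.
Proof.
move=> M0 dF cF F0.
have F'0 x : M < `|x| -> 'D_1 F x = 0.
  move=> xM; rewrite -(derive_cst (0 : R) (x : R) (1 : R)); apply: near_eq_derive => //.
  have : nbhs x [set y | M < `|y|].
    apply: open_nbhs_nbhs; split=> //.
    apply: (@open_comp _ _ (@Num.norm R R) [set y | M < y]) => [y _|]; last exact: open_gt.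
    exact: norm_continuous.
  by apply: filterS => y /ltW /F0 ->.
pose N := M + 1.
have dN : {in `]-N, N[, forall x, derivable F x 1} by move=> x _.
have cFF : continuous F by move=> x; exact/differentiable_continuous/derivable1_diffP.
have F1 : derive1 F = 'D_1 F by apply/funext => x; rewrite derive1E.
have FTC := @continuous_FTC2 R ('D_1 F) F (- N) N.
have -> : (\int[@lebesgue_measure R]_x ('D_1 F x)%:E =
    \int[@lebesgue_measure R]_(x in `[(- N)%R, N]) ('D_1 F x)%:E)%E.
  rewrite [RHS]integral_mkcond; apply: eq_integral => x _.
  rewrite patchE; case: ifPn => // /negP; rewrite inE /= in_itv /= => xN.
  rewrite F'0// ltNge; apply/negP => xM; apply: xN.
  by rewrite -ler_norml (le_trans xM)// /N lerDl.
rewrite FTC.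
- by rewrite !F0 ?subee// ?normrN /N ger0_norm ?lerDl// addr_ge0// ltW.
- by rewrite /N; lra.
- exact: continuous_subspaceT.
- split=> //.
  + exact/cvg_at_right_filter/cFF.
  + exact/cvg_at_left_filter/cFF.
- by move=> x _; rewrite F1.
Qed.

Lemma rV_cons_shift0 n (h t : R) (y : 'rV[R]_n) :
  rV_cons (h *: 1 + t, y) = h *: delta_mx ord0 ord0 + rV_cons (t, y).
Proof.
apply/rowP => i; rewrite !mxE /=; case: (unliftP ord0 i) => [j ->|->] /=.
  by rewrite mulr0 add0r.
by rewrite mulr1 [_ *: _]mulr1.
Qed.

Lemma rV_cons_shiftS n (h t : R) (y : 'rV[R]_n) j :
  rV_cons (t, h *: delta_mx ord0 j + y) =
  h *: delta_mx ord0 (lift ord0 j) + rV_cons (t, y).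
Proof.
apply/rowP => i; rewrite !mxE /=; case: (unliftP ord0 i) => [k ->|->] /=.
  by rewrite !mxE (inj_eq lift_inj).
by rewrite mulr0 add0r.
Qed.

Lemma continuous_rowP (S : topologicalType) n (f : S -> 'rV[R]_n) :
  (forall i, continuous (fun x => f x ord0 i)) -> continuous f.
Proof.
move=> cf x; apply/cvg_ballP => e e0.
have : \forall y \near x, forall i, ball (f x ord0 i) e (f y ord0 i).
  by apply: filter_forall => i; have /cvg_ballP := cf i x; apply.
by apply: filterS => y xy; split=> // i j; rewrite ord1.
Qed.

Lemma continuous_rV_consl n (y : 'rV[R]_n) : continuous (fun t : R => rV_cons (t, y)).
Proof.
apply: continuous_rowP => i; under eq_fun do rewrite mxE.
by case: (unliftP ord0 i) => [j _|_] /= t; [exact: cvg_cst|exact: cvg_id].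
Qed.

Lemma continuous_rV_consr n (t : R) : continuous (fun y : 'rV[R]_n => rV_cons (t, y)).
Proof.
apply: continuous_rowP => i; under eq_fun do rewrite mxE.
by case: (unliftP ord0 i) => [j _|_] /= y; [exact: coord_continuous|exact: cst_continuous].
Qed.

(** The extra unit ensures that around a point outside the larger cube [f] vanishes on a whole ball,
    so that its derivative there is that of a constant. *)
Lemma supported_derive n (r : R) (f : 'rV[R]_n -> R) v :
  supported r f -> supported (r + 1) ('D_v f).
Proof.
move=> fr x xr; rewrite -(derive_cst (0 : R) x v); apply: near_eq_derive => //.
have : nbhs x (ball x 1) by exact: nbhsx_ballx.
apply: filterS => y xy; apply: fr => yr; apply: xr => i.
have := yr i; rewrite -cube_ball// in xy; have := xy i; rewrite !mxE !subr0 => h1 h2.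
rewrite (_ : x ord0 i = y ord0 i - (y ord0 i - x ord0 i)); last by rewrite subKr.
by apply: le_lt_trans (ler_normB _ _) _; exact: ltrD.
Qed.

Lemma integrable_rV_cons n (f : 'rV[R]_n.+1 -> R) : measurable_fun setT f ->
  (mu n.+1).-integrable setT (EFin \o f) ->
  (@lebesgue_measure R \x mu n)%E.-integrable setT (fun p => (f (rV_cons p))%:E).
Proof.
move=> mf /integrableP[mf' foo]; apply/integrableP; split.
  by apply/measurable_EFinP; apply: measurableT_comp => //; exact: measurable_rV_cons.
move: foo; rewrite /= /cons_measure ge0_integral_pushforward//.
  exact: measurable_rV_cons.
by apply/measurable_EFinP; exact: measurableT_comp.
Qed.

Lemma integral_rV_cons n (f : 'rV[R]_n.+1 -> R) : measurable_fun setT f ->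
  (mu n.+1).-integrable setT (EFin \o f) ->
  (\int[mu n.+1]_x (f x)%:E =
   \int[(@lebesgue_measure R \x mu n)]_p (f (rV_cons p))%:E)%E.
Proof.
move=> mf fi; rewrite /= /cons_measure integral_pushforward//.
- exact: measurable_rV_cons.
- exact/measurable_EFinP.
- exact: integrable_rV_cons.
Qed.

(** Induction on the dimension through Fubini. A derivative along the first coordinate is integrated
    in that coordinate first, by the fundamental theorem of calculus; any other one is a derivative
    of the slices, where the induction hypothesis applies. For [f] a product this becomes
    integration by parts. *)
Lemma integral_derive_eq0 n (f : 'rV[R]_n -> R) (i : 'I_n) (r : R) : 0 < r ->
  continuous f -> (forall x, derivable f x (delta_mx ord0 i)) ->
  continuous ('D_(delta_mx ord0 i) f) -> supported r f ->
  (\int[mu n]_x ('D_(delta_mx ord0 i) f x)%:E = 0)%E.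
Proof.
move=> r0; elim: n f i => [|n IH] f i; first by case: i.
move=> cf df cdf fr.
have Dr := supported_derive (delta_mx ord0 i) fr.
have r1 : 0 < r + 1 by lra.
have iD := supported_integrable r1 cdf Dr.
have mD := continuous_measurable_rV cdf.
have ig := integrable_rV_cons mD iD.
rewrite (integral_rV_cons mD iD).
case: (unliftP ord0 i) => [j ij|i0].
  rewrite -integral12_prod_meas1//; apply: integral0_eq => t _.
  rewrite /fubini_F.
  have E y : 'D_(delta_mx ord0 i) f (rV_cons (t, y)) =
      'D_(delta_mx ord0 j) (f \o (fun y => rV_cons (t, y))) y.
    by apply/esym/derive_comp_affine => h; rewrite rV_cons_shiftS ij.
  under eq_integral do rewrite E; apply: IH.
  - by move=> y; apply: continuous_comp; [exact: continuous_rV_consr|exact: cf].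
  - move=> y; apply: derivable_comp_affine (df _) => h.
    by rewrite rV_cons_shiftS ij.
  - rewrite (_ : 'D__ _ = ('D_(delta_mx ord0 i) f) \o (fun y => rV_cons (t, y))); last first.
      by apply/funext => y; rewrite -E.
    by move=> y; apply: continuous_comp; [exact: continuous_rV_consr|exact: cdf].
  - move=> y yr /=; apply: fr => H; apply: yr => k.
    by have := H (lift ord0 k); rewrite !mxE liftK.
rewrite -integral21_prod_meas1//; apply: integral0_eq => y _.
rewrite /fubini_G.
have E t : 'D_(delta_mx ord0 i) f (rV_cons (t, y)) =
    'D_1 (f \o (fun t => rV_cons (t, y))) t.
  by apply/esym/derive_comp_affine => h; rewrite rV_cons_shift0 i0.
under eq_integral do rewrite E; apply: (integral_derive1_eq0 r0).
- move=> t; apply: derivable_comp_affine (df _) => h.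
  by rewrite rV_cons_shift0 i0.
- rewrite (_ : 'D__ _ = ('D_(delta_mx ord0 i) f) \o (fun t => rV_cons (t, y))); last first.
    by apply/funext => t; rewrite -E.
  by move=> t; apply: continuous_comp; [exact: continuous_rV_consl|exact: cdf].
- move=> t tr /=; apply: fr => H; move: tr; rewrite leNgt.
  by have := H ord0; rewrite !mxE unlift_none /= subr0 => ->.
Qed.

End cube_measure.

(** * Stability of smooth functions *)

Section smooth_functions.
Context {R : realType} {d : nat}.
Implicit Types (f g psi : 'rV[R]_d -> R) (i j : 'I_d).

Local Notation e i := (delta_mx ord0 i : 'rV[R]_d).

(** Coinduction principle: in place of formulas for iterated derivatives, it suffices to exhibit a
    class of differentiable functions that is closed under every [partial i]. *)
Lemma smooth_coind (P : ('rV[R]_d -> R) -> Prop) :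
  (forall f, P f -> (forall x, differentiable f x) /\ forall i, P (partial i f)) ->
  forall f, P f -> smooth f.
Proof.
move=> PP f Pf s; have : P (foldr (@partial R d) f s).
  by elim: s => //= i s /PP[_]; exact.
by move=> /PP[].
Qed.

Lemma smooth_differentiable f x : smooth f -> differentiable f x.
Proof. by move=> /(_ [::]). Qed.

Lemma smooth_partial i f : smooth f -> smooth (partial i f).
Proof. by move=> sf s x; have := sf (rcons s i) x; rewrite foldr_rcons. Qed.

Lemma smooth_continuous f : smooth f -> continuous f.
Proof. by move=> sf x; exact/differentiable_continuous/smooth_differentiable. Qed.

Lemma smooth_derivable f x v : smooth f -> derivable f x v.
Proof. by move=> sf; exact/diff_derivable/smooth_differentiable. Qed.

Lemma partialD i f g : smooth f -> smooth g ->
  partial i (fun x => f x + g x) = (fun x => partial i f x + partial i g x).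
Proof.
by move=> sf sg; apply/funext => x; rewrite /partial -deriveD//; exact: smooth_derivable.
Qed.

Lemma partialZ i k f : smooth f ->
  partial i (fun x => k * f x) = (fun x => k * partial i f x).
Proof.
by move=> sf; apply/funext => x; rewrite /partial -[RHS]deriveZ//; exact: smooth_derivable.
Qed.

Lemma partialM i f g : smooth f -> smooth g ->
  partial i (fun x => f x * g x) =
  (fun x => partial i f x * g x + f x * partial i g x).
Proof.
move=> sf sg; apply/funext => x; rewrite /partial.
rewrite (_ : (fun x => _) = f * g)// deriveM; [|exact: smooth_derivable..].
by rewrite addrC [RHS]addrC mulrC [_ *: _]mulrC addrC [_ *: _]mulrC.
Qed.

Lemma smoothD f g : smooth f -> smooth g -> smooth (fun x => f x + g x).
Proof.
move=> sf sg; pose P (h : 'rV[R]_d -> R) := exists f g : 'rV[R]_d -> R, [/\ smooth f, smooth g & h = (fun x => f x + g x)].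
apply: (@smooth_coind P); last by exists f, g.
move=> _ [f1 [g1 [sf1 sg1 ->]]]; split=> [x|i].
  by apply: differentiableD; exact: smooth_differentiable.
exists (partial i f1), (partial i g1); split; rewrite ?partialD//; exact: smooth_partial.
Qed.

Lemma smoothZ k f : smooth f -> smooth (fun x => k * f x).
Proof.
move=> sf; pose P (h : 'rV[R]_d -> R) := exists2 f : 'rV[R]_d -> R, smooth f & h = (fun x => k * f x).
apply: (@smooth_coind P); last by exists f.
move=> _ [f1 sf1 ->]; split=> [x|i].
  exact/differentiableZ/smooth_differentiable.
exists (partial i f1); rewrite ?partialZ//; exact: smooth_partial.
Qed.

Lemma smoothN f : smooth f -> smooth (fun x => - f x).
Proof.
by move=> sf; have := smoothZ (-1) sf; under eq_fun do rewrite mulN1r.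
Qed.

Lemma smooth_cst (c : R) : smooth (fun _ : 'rV[R]_d => c).
Proof.
pose P (h : 'rV[R]_d -> R) := exists c, h = cst c.
apply: (@smooth_coind P); last by exists c.
move=> _ [k ->]; split=> [x|i]; first exact: differentiable_cst.
by exists 0; apply/funext => x; rewrite /partial derive_cst.
Qed.

(* Unlike products, sums of products are stable under partial derivatives. *)
Inductive sum_of_products : ('rV[R]_d -> R) -> Prop :=
| sum_of_products_mul f g of smooth f & smooth g : sum_of_products (fun x => f x * g x)
| sum_of_products_add f g of sum_of_products f & sum_of_products g :
    sum_of_products (fun x => f x + g x).

Lemma sum_of_products_smooth f : sum_of_products f -> smooth f.
Proof.
apply: smooth_coind => {}f; elim=> [{}f g sf sg|{}f g _ [df pf] _ [dg pg]].
  split=> [x|i].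
    by apply: differentiableM; exact: smooth_differentiable.
  rewrite partialM//; apply: sum_of_products_add; apply: sum_of_products_mul => //;
  exact: smooth_partial.
split=> [x|i]; first exact: differentiableD.
rewrite (_ : partial i _ = fun x => partial i f x + partial i g x).
  exact: sum_of_products_add.
by apply/funext => x; rewrite /partial -deriveD//; exact: diff_derivable.
Qed.

Lemma smoothM f g : smooth f -> smooth g -> smooth (fun x => f x * g x).
Proof. by move=> sf sg; exact/sum_of_products_smooth/sum_of_products_mul. Qed.

Lemma smooth_prod (I : Type) (r : seq I) (F : I -> 'rV[R]_d -> R) :
  (forall k, smooth (F k)) -> smooth (fun x => \prod_(i <- r) F i x).
Proof.
move=> sF; elim: r => [|k r IH].
  by under eq_fun do rewrite big_nil; exact: smooth_cst.
by under eq_fun do rewrite big_cons; exact: smoothM.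
Qed.

Lemma partial_reflect i f b : smooth f ->
  partial i (fun x => f (b - x)) = (fun x => - partial i f (b - x)).
Proof.
move=> sf; apply/funext => x; rewrite /partial.
rewrite (@derive_comp_affine _ _ _ f (fun x => b - x) x (e i) (- e i)).
  rewrite !deriveE ?linearN//; exact: smooth_differentiable.
by move=> h; rewrite opprD addrCA scalerN.
Qed.

Lemma smooth_reflect f b : smooth f -> smooth (fun x => f (b - x)).
Proof.
move=> sf; pose P (h : 'rV[R]_d -> R) := exists2 f : 'rV[R]_d -> R, smooth f & h = (fun x => f (b - x)).
apply: (@smooth_coind P); last by exists f.
move=> _ [f1 sf1 ->]; split=> [x|i].
  apply: (@differentiable_comp _ _ _ _ (fun x => b - x) f1).
    by apply: differentiableB; [exact: differentiable_cst|].
  exact: smooth_differentiable.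
exists (fun x => - partial i f1 x); first exact/smoothN/smooth_partial.
by rewrite partial_reflect.
Qed.

End smooth_functions.

(** * Test functions and the symmetry of second derivatives *)

Section test_functions.
Context {R : realType} {d : nat}.
Implicit Types (f g psi : 'rV[R]_d -> R) (i j : 'I_d).

Local Notation e i := (delta_mx ord0 i : 'rV[R]_d).

Lemma test_functionP psi : test_function psi <->
  smooth psi /\ exists2 r : R, 0 < r & supported r psi.
Proof.
split=> [[sp cp]|[sp [r r0 pr]]]; split=> //.
  have [M [_ Mb]] := compact_bounded cp.
  have M0 : 0 < `|M| + 2 by rewrite ltr_wpDl.
  exists (`|M| + 2) => // x xM; apply: contrapT => /eqP px; apply: xM.
  have := Mb (`|M| + 1); rewrite ltr_pwDr ?ler_norm// => /(_ isT x).
  rewrite cube_ball// -ball_normE /= sub0r normrN => xM.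
  apply: le_lt_trans (xM _) _; last by lra.
  exact: subset_closure.
apply: (subclosed_compact (@closed_closure _ _) (@compact_cubeW R d 0 r)).
have cK := compact_closed (@norm_hausdorff _ _) (@compact_cubeW R d 0 r).
move/closure_id : cK => ->; apply: closureS => x /= px i.
have : cube 0 r x by apply: contrapT => /pr; apply/eqP.
by move=> /(_ i); rewrite !mxE subr0 sub0r add0r /= in_itv /= -ler_norml => /ltW.
Qed.

Lemma norm_coord_le (x : 'rV[R]_d) i : `|x ord0 i| <= `|x|.
Proof.
rewrite [leRHS]/Num.norm /= mx_normrE.
exact: (le_bigmax _ (fun ij => `|x ij.1 ij.2|) (ord0, i)).
Qed.

Lemma test_smooth psi : test_function psi -> smooth psi.
Proof. by case. Qed.

Lemma test_partial i psi : test_function psi -> test_function (partial i psi).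
Proof.
move=> /test_functionP[sp [r r0 pr]]; apply/test_functionP; split.
  exact: smooth_partial.
exists (r + 1); [lra|exact: supported_derive].
Qed.

Lemma testD f g : test_function f -> test_function g ->
  test_function (fun x => f x + g x).
Proof.
move=> /test_functionP[sf [r r0 fr]] /test_functionP[sg [r' r'0 gr']].
apply/test_functionP; split; first exact: smoothD.
exists (Num.max r r'); first by rewrite lt_max r0.
move=> x xr; rewrite fr ?gr' ?addr0// => xr'; apply: xr => i;
  by rewrite lt_max xr' ?orbT.
Qed.

Lemma testZ k f : test_function f -> test_function (fun x => k * f x).
Proof.
move=> /test_functionP[sf [r r0 fr]]; apply/test_functionP; split.
  exact: smoothZ.
by exists r => // x /fr ->; rewrite mulr0.
Qed.

Lemma testM f g : test_function f -> smooth g -> test_function (fun x => f x * g x).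
Proof.
move=> /test_functionP[sf [r r0 fr]] sg; apply/test_functionP; split.
  exact: smoothM.
by exists r => // x /fr ->; rewrite mul0r.
Qed.

Lemma test_cst0 : test_function (fun _ : 'rV[R]_d => 0 : R).
Proof. by apply/test_functionP; split; [exact: smooth_cst|exists 1]. Qed.

Lemma test_sum (I : Type) (r : seq I) (F : I -> 'rV[R]_d -> R) :
  (forall k, test_function (F k)) -> test_function (fun x => \sum_(k <- r) F k x).
Proof.
move=> sF; elim: r => [|k r IH].
  by under eq_fun do rewrite big_nil; exact: test_cst0.
by under eq_fun do rewrite big_cons; exact: testD.
Qed.

Lemma test_reflect b f : test_function f -> test_function (fun x => f (b - x)).
Proof.
move=> /test_functionP[sf [r r0 fr]]; apply/test_functionP; split.
  exact: smooth_reflect.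
exists (r + `|b|) => [|x xr]; first by rewrite ltr_wpDr.
apply: fr => bxr; apply: xr => i; have := bxr i; rewrite !mxE !subr0 => h.
rewrite (_ : x ord0 i = b ord0 i - (b ord0 i - x ord0 i)); last by rewrite subKr.
apply: le_lt_trans (ler_normB _ _) _; rewrite addrC; apply: ltr_leD => //.
exact: norm_coord_le.
Qed.

Lemma is_derive_line i f b (t : R) : smooth f ->
  is_derive t (1 : R) (fun t : R => f (t *: e i + b)) (partial i f (t *: e i + b)).
Proof.
move=> sf.
have E (h : R) : (h *: 1 + t) *: e i + b = h *: e i + (t *: e i + b).
  by rewrite scalerDl addrA [_ *: 1]mulr1.
have Df : derivable (f \o (fun t : R => t *: e i + b)) t 1.
  by apply: derivable_comp_affine E _; exact: smooth_derivable.
have := derivableP Df.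
by rewrite (derive_comp_affine f (g := fun t : R => t *: e i + b) E).
Qed.

(** The mean value theorem twice: for the increment of [f] in direction [j] as a function of the
    shift along [i], then for [partial i f] along [j]. *)
Lemma second_difference i j f (a : 'rV[R]_d) (h : R) : smooth f -> 0 < h ->
  exists s t : R, [/\ 0 < s < h, 0 < t < h &
   f (h *: e i + (h *: e j + a)) - f (h *: e i + a) - f (h *: e j + a) + f a =
   h * (h * partial j (partial i f) (s *: e i + (t *: e j + a)))].
Proof.
move=> sf h0.
have mvt (F dF : R -> R) : (forall t : R, is_derive t (1 : R) F (dF t)) ->
    exists2 c, 0 < c < h & F h - F 0 = dF c * h.
  move=> FD; have FD' (x : R) : x \in `]0, h[ -> is_derive x (1 : R) F (dF x).
    by move=> _; exact: FD.
  have cF : {within `[0, h], continuous F}.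
    apply: continuous_subspaceT => x; apply/differentiable_continuous/derivable1_diffP.
    exact: (@ex_derive _ _ _ _ _ _ _ (FD x)).
  have [c ch ->] := MVT h0 FD' cF; exists c; last by rewrite subr0.
  by rewrite in_itv /= in ch.
pose F s := f (s *: e i + (h *: e j + a)) - f (s *: e i + a).
have [s|s sh FE] := mvt F (fun s => partial i f (s *: e i + (h *: e j + a)) -
   partial i f (s *: e i + a)).
  by apply: is_deriveB; exact: is_derive_line.
pose G t := partial i f (t *: e j + (s *: e i + a)).
have [t|t th GE] := mvt G (fun t => partial j (partial i f) (t *: e j + (s *: e i + a))).
  by apply: is_derive_line; exact: smooth_partial.
exists s, t; split=> //.
have FE' : f (h *: e i + (h *: e j + a)) - f (h *: e i + a) - f (h *: e j + a) + f a =
    F h - F 0.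
  rewrite /F !scale0r !add0r.
  move: (f _) (f (h *: e i + a)) (f (h *: e j + a)) (f a) => A B C D; ring.
have GE' : partial i f (s *: e i + (h *: e j + a)) - partial i f (s *: e i + a) =
    G h - G 0.
  by rewrite /G scale0r add0r [in RHS]addrCA.
by rewrite FE' FE GE' GE mulrC (mulrC h (partial _ _ _)) [t *: e j + _]addrCA.
Qed.

Lemma eq_of_nearby_values (A B : 'rV[R]_d -> R) a : continuous A -> continuous B ->
  (forall r : R, 0 < r -> exists p q, [/\ ball a r p, ball a r q & A p = B q]) ->
  A a = B a.
Proof.
move=> cA cB AB; apply/eqP; rewrite -subr_eq0 -normr_le0.
apply/ler_addgt0Pr => eps eps0; rewrite add0r.
have eps20 : 0 < eps / 2 by rewrite divr_gt0.
have /nbhs_ballP[r1 /= r10 H1] : \forall x \near a, `|A a - A x| < eps / 2.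
  by have /cvgrPdist_lt := cA a; apply.
have /nbhs_ballP[r2 /= r20 H2] : \forall x \near a, `|B a - B x| < eps / 2.
  by have /cvgrPdist_lt := cB a; apply.
have m0 : 0 < Num.min r1 r2 by rewrite lt_min r10.
have [p [q [ap aq E]]] := AB _ m0.
have h1 : `|A a - A p| < eps / 2.
  by apply: H1; apply: le_ball ap; rewrite ge_min lexx.
have h2 : `|B a - B q| < eps / 2.
  by apply: H2; apply: le_ball aq; rewrite ge_min lexx orbT.
apply: le_trans (ler_distD (A p) _ _) _.
rewrite [leRHS]splitr; apply: lerD; first exact: ltW.
by rewrite E distrC ltW.
Qed.

(** The second difference is symmetric in [i] and [j]. Being [h^2] times either mixed derivative at
    some point near [a], it makes these two continuous functions take a common value arbitrarily
    close to [a]. *)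
Lemma partialC i j f : smooth f -> partial i (partial j f) = partial j (partial i f).
Proof.
move=> sf; apply/funext => a; apply: eq_of_nearby_values.
- exact/smooth_continuous/smooth_partial/smooth_partial.
- exact/smooth_continuous/smooth_partial/smooth_partial.
move=> r r0; pose h := r / 2.
have h0 : 0 < h by rewrite divr_gt0.
have ba (k l : 'I_d) (s t : R) : 0 < s < h -> 0 < t < h ->
    ball a r (s *: e k + (t *: e l + a)).
  move=> /andP[s0 sh] /andP[t0 th]; rewrite -cube_ball// => m.
  rewrite !mxE /= addrA addrK (splitr r) -/h.
  apply: le_lt_trans (ler_normD _ _) _; rewrite !normrM (gtr0_norm s0) (gtr0_norm t0).
  have bnd (x : R) (b : bool) : 0 < x -> x < h -> x * `|b%:R| < h.
    by case: b => x0 xh; rewrite ?normr0 ?mulr0// normr1 mulr1.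
  by apply: ltrD; exact: bnd.
have [s [t [sh th E1]]] := second_difference j i a sf h0.
have [s' [t' [sh' th' E2]]] := second_difference i j a sf h0.
exists (s *: e j + (t *: e i + a)), (s' *: e i + (t' *: e j + a)); split.
- exact: ba.
- exact: ba.
apply: (@mulfI _ h); first by rewrite gt_eqF.
apply: (@mulfI _ h); first by rewrite gt_eqF.
apply: etrans (esym E1) _; apply: etrans _ E2.
by congr (_ + _); rewrite addrAC; congr (f _ - _ - _); exact: addrCA.
Qed.

End test_functions.

(** * Smooth bump functions *)

Section flat.
Context {R : realType}.
Implicit Types (k : nat) (t : R).

(** The powers [t^-k] are the ones that derivatives of [exp (-1/t)] produce; with them the
    derivative of a member is a linear combination of members. *)
Definition flat k t : R := if 0 < t then t^-1 ^+ k * expR (- t^-1) else 0.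

Lemma flat_gt0E k t : 0 < t -> flat k t = t^-1 ^+ k * expR (- t^-1).
Proof. by rewrite /flat => ->. Qed.

Lemma flat_le0E k t : t <= 0 -> flat k t = 0.
Proof. by rewrite /flat ltNge => ->. Qed.

Lemma flat_ge0 k t : 0 <= flat k t.
Proof.
rewrite /flat; case: ifP => // t0.
by rewrite mulr_ge0 ?expR_ge0// exprn_ge0// invr_ge0 ltW.
Qed.

Lemma flat0_le1 t : flat 0 t <= 1.
Proof.
rewrite /flat; case: ifP => // t0.
by rewrite expr0 mul1r -expR0 ler_expR oppr_le0 invr_ge0 ltW.
Qed.

(** From [exp s >= s^(k+2) / (k+2)!] at [s = 1/t]. The order [t^2] makes the difference quotient at
    [0] tend to [0]. *)
Lemma flat_le_sqr k t : flat k t <= (k.+2)`!%:R * t ^+ 2.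
Proof.
have [t0|t0] := leP t 0; first by rewrite flat_le0E// mulr_ge0 ?sqr_ge0.
rewrite flat_gt0E//.
have s0 : 0 < t^-1 by rewrite invr_gt0.
have sn : 0 < t^-1 ^+ k.+2 by rewrite exprn_gt0.
have f0 : 0 < (k.+2)`!%:R :> R by rewrite ltr0n fact_gt0.
have h : t^-1 ^+ k.+2 / k.+2`!%:R <= expR t^-1.
  by apply: le_trans (expR_ge1Dxn k.+1 (ltW s0)); rewrite lerDr.
rewrite expRN ler_pdivrMr ?expR_gt0//.
apply: le_trans (ler_wpM2l _ h); last by rewrite mulr_ge0 ?sqr_ge0// ltW.
rewrite [leRHS](_ : _ = t^-1 ^+ k)// (exprS _ k.+1) (exprS _ k).
by move: (_ ^+ k) => p; field; rewrite !gt_eqF.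
Qed.

Lemma is_derive_flat k t :
  is_derive t (1 : R) (flat k) (flat k.+2 t - k%:R * flat k.+1 t).
Proof.
have [t0|t0|->] := ltgtP t 0.
- rewrite !flat_le0E ?ltW// mulr0 subrr.
  apply: (@near_eq_is_derive _ _ _ (cst 0)).
  have : nbhs t [set y | y < 0] by apply: open_nbhs_nbhs; split => //; exact: open_lt.
  by apply: filterS => y /ltW y0; rewrite flat_le0E.
- rewrite !flat_gt0E//.
  have near_t : \forall y \near t, y^-1 ^+ k * expR (- y^-1) = flat k y.
    have : nbhs t [set y | 0 < y] by apply: open_nbhs_nbhs; split => //; exact: open_gt.
    by apply: filterS => y /= y0; rewrite flat_gt0E.
  have tn0 : t != 0 by rewrite gt_eqF.
  have dV : is_derive t (1 : R) (fun y : R => y^-1) (- t^-1 ^+ 2).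
    apply: is_derive_eq (is_deriveV tn0 (is_derive_id _ _)) _.
    by rewrite /= [_ *: _]mulr1 exprVn.
  have dX n : is_derive t (1 : R) (fun y : R => y^-1 ^+ n) (- (n%:R * t^-1 ^+ n.+1)).
    elim: n => [|n IH].
      by rewrite mul0r oppr0; exact: is_derive_cst.
    have := is_deriveM dV IH.
    rewrite (_ : (fun y => y^-1 ^+ n.+1) = (fun y : R => y^-1) * (fun y : R => y^-1 ^+ n)); last first.
      by apply/funext => y; rewrite exprS.
    move=> H; apply: is_derive_eq H _.
    rewrite -![_ *: _]/(_ * _) !exprS mulrS; ring.
  have dE : is_derive t (1 : R) (fun y : R => expR (- y^-1)) (t^-1 ^+ 2 * expR (- t^-1)).
    apply: is_derive_eq (is_derive1_comp (is_derive_expR _) (is_deriveN dV)) _.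
    by rewrite opprK mulrC.
  apply: near_eq_is_derive near_t _.
  apply: is_derive_eq (is_deriveM (dX k) dE) _.
  rewrite -![_ *: _]/(_ * _) !exprS; ring.
rewrite !flat_le0E ?lexx// mulr0 subrr.
suff D0 : (fun h => h^-1 *: ((flat k \o shift 0) (h *: 1) - flat k 0)) @ (0 : R)^' --> (0 : R).
  by apply: DeriveDef; [apply/cvg_ex; exists 0|exact: cvg_lim D0].
pose C : R := (k.+2)`!%:R.
have C0 : 0 < C by rewrite ltr0n fact_gt0.
apply/(@cvgrPdist_le R R R ((0:R)^')%classic) => eps eps0.
have : \forall h \near (0 : R)^', h != 0 /\ `|h| < eps / C.
  near=> h; split; near: h; [exact: nbhs_dnbhs_neq|apply: dnbhs0_lt; exact: divr_gt0].
apply: filterS => h [h0 hC]; rewrite sub0r normrN /=.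
rewrite (flat_le0E _ (lexx 0)) subr0 addr0 [h *: 1]mulr1.
rewrite [_ *: _]/(_ * _) normrM normfV ger0_norm ?flat_ge0//.
rewrite mulrC ler_pdivrMr ?normr_gt0//; apply: le_trans (flat_le_sqr _ _) _.
rewrite -/C -real_normK ?num_real// expr2 mulrA ler_wpM2r ?normr_ge0//.
by rewrite mulrC -ler_pdivlMr// ltW.
Unshelve. all: by end_near. Qed.

End flat.

Section bump.
Context {R : realType} {d : nat}.
Implicit Types (i j : 'I_d) (a b x : 'rV[R]_d).
Local Notation mu := (lebesgue_rV R d).
Local Notation e i := (delta_mx ord0 i : 'rV[R]_d).

(** The class fed to [smooth_coind]: [partial_flat] turns one term into a sum of two. *)
Inductive flat_sum i : ('rV[R]_d -> R) -> Prop :=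
| flat_sum_flat c k (l m : R) : flat_sum i (fun x => c * flat k (l * x ord0 i + m))
| flat_sum_add f g of flat_sum i f & flat_sum i g : flat_sum i (fun x => f x + g x).

Lemma flat_coord_differentiable i c k (l m : R) x :
  differentiable (fun x : 'rV[R]_d => c * flat k (l * x ord0 i + m)) x.
Proof.
apply: (@differentiableZ _ _ _ (fun x : 'rV[R]_d => flat k (l * x ord0 i + m))).
apply: (@differentiable_comp _ _ _ _ (fun x : 'rV[R]_d => l * x ord0 i + m) (flat k)).
  apply: differentiableD; last exact: differentiable_cst.
  apply: (@differentiableZ _ _ _ (fun x : 'rV[R]_d => x ord0 i)).
  exact: differentiable_coord.
by apply/derivable1_diffP; exact: (@ex_derive _ _ _ _ _ _ _ (is_derive_flat k _)).
Qed.

Lemma partial_flat i j c k (l m : R) :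
  partial j (fun x : 'rV[R]_d => c * flat k (l * x ord0 i + m)) =
  (fun x => c * (l * (i == j)%:R) * flat k.+2 (l * x ord0 i + m) +
            (- (c * (l * (i == j)%:R) * k%:R)) * flat k.+1 (l * x ord0 i + m)).
Proof.
apply/funext => x; rewrite /partial.
pose F t := c * flat k t.
have E (h : R) : l * (h *: e j + x) ord0 i + m =
    h *: (l * (i == j)%:R) + (l * x ord0 i + m).
  have scE (u v : R) : u *: v = u * v by [].
  rewrite !mxE eqxx /= scE; ring.
transitivity ('D_(l * (i == j)%:R) F (l * x ord0 i + m)).
  exact: (derive_comp_affine F (g := fun x : 'rV[R]_d => l * x ord0 i + m) E).
set t := l * x ord0 i + m.
have dF : is_derive t (1 : R) F (c *: (flat k.+2 t - k%:R * flat k.+1 t)).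
  exact: is_deriveZ (is_derive_flat _ _).
have diffF : differentiable F t by apply/derivable1_diffP; exact: (@ex_derive _ _ _ _ _ _ _ dF).
rewrite deriveE// -[X in 'd F t X]mulr1 -[X in 'd F t X]/(_ *: _) linearZ -deriveE//.
rewrite (derive_val (is_derive := dF)) /= -[LHS]/(_ * (_ * _)); ring.
Qed.

Lemma smooth_flat i c k (l m : R) :
  smooth (fun x : 'rV[R]_d => c * flat k (l * x ord0 i + m)).
Proof.
apply: (@smooth_coind _ _ (flat_sum i)); last exact: flat_sum_flat.
move=> f; elim=> {f} [c' k' l' m'|f g _ [df pf] _ [dg pg]].
  split=> [x|j]; first exact: flat_coord_differentiable.
  by rewrite partial_flat; apply: flat_sum_add; exact: flat_sum_flat.
split=> [x|j]; first exact: differentiableD.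
rewrite (_ : partial j _ = fun x => partial j f x + partial j g x).
  exact: flat_sum_add.
by apply/funext => x; rewrite /partial -deriveD//; exact: diff_derivable.
Qed.

Definition box a b : set 'rV[R]_d := [set x | forall i, a ord0 i < x ord0 i < b ord0 i].

(** Each factor is [exp (-1 / ((n+1) s))], where [s] is the signed distance of a coordinate to one
    face of the box: it is [0] for [s <= 0] and tends to [1] for [s > 0]. So the support stays in
    the box for every [n], while the product tends to the indicator. *)
Definition box_bump a b n x : R :=
  \prod_i (flat 0 (n.+1%:R * x ord0 i - n.+1%:R * a ord0 i) *
           flat 0 (- n.+1%:R * x ord0 i + n.+1%:R * b ord0 i)).

Lemma bump_ge0 a b n x : 0 <= box_bump a b n x.
Proof. by apply: prodr_ge0 => i _; rewrite mulr_ge0 ?flat_ge0. Qed.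

Lemma bump_le1 a b n x : box_bump a b n x <= 1.
Proof.
by apply: prodr_ile1 => i _; rewrite mulr_ge0 ?mulr_ile1 ?flat_ge0 ?flat0_le1.
Qed.

Lemma bump_notin_box a b n x : ~ box a b x -> box_bump a b n x = 0.
Proof.
move=> xab; have [i /negP] : exists i, ~ (a ord0 i < x ord0 i < b ord0 i).
  exact/existsNP.
rewrite negb_and -!leNgt => xi {xab}.
rewrite /box_bump (bigD1 i)//=; apply/eqP; rewrite !mulf_eq0.
case/orP: xi => xi; last first.
  rewrite [flat 0 (- _ * _ + _)]flat_le0E ?eqxx ?orbT//.
  by rewrite mulNr addrC subr_le0 ler_wpM2l.
by rewrite flat_le0E ?eqxx// subr_le0 ler_wpM2l.
Qed.

Lemma test_bump a b n : test_function (box_bump a b n).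
Proof.
apply/test_functionP; split.
  apply: smooth_prod => i; apply: smoothM.
    by under eq_fun do rewrite -[flat _ _]mul1r; exact: smooth_flat.
  by under eq_fun do rewrite -[flat _ _]mul1r; exact: smooth_flat.
exists (`|a| + `|b| + 1) => [|x xr]; first by rewrite ltr_wpDl// addr_ge0.
apply: bump_notin_box => xab; apply: xr => i.
have /andP[h1 h2] := xab i; rewrite !mxE subr0.
have := norm_coord_le a i; have := norm_coord_le b i.
have := normr_ge0 a; have := normr_ge0 b.
by rewrite !ler_norml ltr_norml => ? ? /andP[? ?] /andP[? ?]; apply/andP; split; lra.
Qed.

Lemma cvg_bump a b x : box_bump a b ^~ x @ \oo --> (\1_(box a b) x : R).
Proof.
have [xab|xab] := pselect (box a b x); last first.
  rewrite indicE memNset//; under eq_fun do rewrite bump_notin_box//.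
  exact: cvg_cst.
rewrite indicE mem_set//.
have F1 c : 0 < c -> (fun n : nat => flat 0 (n.+1%:R * c)) @ \oo --> (1 : R).
  move=> c0; rewrite -[X in _ --> X]expR0.
  rewrite (_ : (fun n => _) = expR \o (fun n : nat => - (c^-1 * n.+1%:R^-1))); last first.
    apply/funext => n /=; rewrite flat_gt0E ?mulr_gt0// expr0 mul1r invfM.
    by rewrite mulrC.
  apply: continuous_cvg; first exact: continuous_expR.
  have H : (fun n : nat => c^-1 * n.+1%:R^-1) @ \oo --> (0 : R).
    by rewrite -(mulr0 c^-1); apply: cvgM; [exact: cvg_cst|exact: cvg_harmonic].
  have : (fun n : nat => - (c^-1 * n.+1%:R^-1)) @ \oo --> (- 0 : R) by exact: cvgN.
  by rewrite oppr0.
pose G i n := flat 0 (n.+1%:R * x ord0 i - n.+1%:R * a ord0 i) *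
              flat 0 (- n.+1%:R * x ord0 i + n.+1%:R * b ord0 i) : R.
have G1 i : G i @ \oo --> (1 : R).
  have /andP[h1 h2] := xab i.
  rewrite (_ : G i = fun n => flat 0 (n.+1%:R * (x ord0 i - a ord0 i)) *
      flat 0 (n.+1%:R * (b ord0 i - x ord0 i))); last first.
    by apply/funext => n; rewrite /G !mulrBr mulNr [- _ + _]addrC.
  suff : (fun n : nat => flat 0 (n.+1%:R * (x ord0 i - a ord0 i)) *
      flat 0 (n.+1%:R * (b ord0 i - x ord0 i))) @ \oo --> (1 * 1 : R) by rewrite mulr1.
  by apply: cvgM; apply: F1; rewrite subr_gt0.
rewrite /box_bump -[true%:R]/(1 : R); elim: (index_enum _) => [|i s IH].
  by under eq_fun do rewrite big_nil; exact: cvg_cst.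
under eq_fun do rewrite big_cons.
have : (fun n => G i n * \prod_(j <- s) G j n) @ \oo --> (1 * 1 : R) by apply: cvgM.
by rewrite mulr1.
Qed.

End bump.

(** * Fundamental lemma of the calculus of variations *)

Section fundamental_lemma.
Context {R : realType} {d : nat}.
Local Notation mu := (lebesgue_rV R d).
Implicit Types (a b x : 'rV[R]_d) (A : set 'rV[R]_d).

Lemma supported_Lfun2 (r : R) (f : 'rV[R]_d -> R) : 0 < r -> continuous f ->
  supported r f -> f \in Lfun mu 2%:E.
Proof.
move=> r0 cf fr; apply/Lfun2P; split; first exact: continuous_measurable_rV.
under eq_fun do rewrite expr2.
apply: (@supported_integrable _ _ r (fun x => f x * f x)) => // [x|x /fr ->].
  by apply: continuousM; exact: cf.
by rewrite mulr0.
Qed.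

Lemma test_Lfun2 psi : test_function psi -> psi \in Lfun mu 2%:E.
Proof.
move=> /test_functionP[sp [r r0 pr]].
apply: (supported_Lfun2 r0 _ pr); exact: smooth_continuous.
Qed.

Lemma indic_cube_Lfun2 a (r : R) : 0 < r -> (\1_(cube a r) : 'rV[R]_d -> R) \in Lfun mu 2%:E.
Proof.
move=> r0; have m1 : measurable_fun setT (\1_(cube a r) : 'rV[R]_d -> R).
  by apply: measurable_indic; exact: measurable_cube.
apply/Lfun2P; split=> //; apply/integrableP; split.
  by apply/measurable_EFinP; exact: measurable_funX.
rewrite (eq_integral (fun x => (\1_(cube a r) x)%:E)).
  rewrite integral_indic//; last exact: measurable_cube.
  rewrite setIT; apply: (@le_lt_trans _ _ ((2 * r) ^+ d)%:E); rewrite ?ltry//.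
  by rewrite -(lebesgue_rV_cube a r0).
move=> x _; rewrite indicE; case: (_ \in _); first by rewrite expr1n /= normr1.
by rewrite expr0n /= normr0.
Qed.

Lemma measurable_box a b : measurable (box a b).
Proof.
rewrite (_ : box a b = \big[setI/setT]_(i < d)
   ((fun v : 'rV[R]_d => v ord0 i) @^-1` `]a ord0 i, b ord0 i[)).
  apply: bigsetI_measurable => i _; rewrite -[X in measurable X]setTI.
  by apply: measurable_rV_coord => //; exact: measurable_itv.
rewrite -bigcap_seq; apply/seteqP; split => x /=.
  by move=> ax i _; rewrite /= in_itv; exact: ax.
by move=> ax i; have := ax i; rewrite /= in_itv; apply; rewrite mem_index_enum.
Qed.

Lemma cubeE (r : R) : cube 0 r = box (const_mx (- r)) (const_mx r) :> set 'rV[R]_d.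
Proof.
by apply/seteqP; split => x /= H i; have := H i; rewrite !mxE subr0 ltr_norml.
Qed.

Lemma boxI a b a' b' : box a b `&` box a' b' =
  box (\row_i Num.max (a ord0 i) (a' ord0 i)) (\row_i Num.min (b ord0 i) (b' ord0 i)).
Proof.
apply/seteqP; split => x /=.
  move=> [H H'] i; have /andP[h1 h2] := H i; have /andP[h1' h2'] := H' i.
  by rewrite !mxE gt_max lt_min h1 h2 h1'.
move=> H; split=> i; have := H i; rewrite !mxE gt_max lt_min;
by move=> /andP[/andP[? ?] /andP[? ?]]; apply/andP.
Qed.

Definition boxes : set (set 'rV[R]_d) := [set A | exists a b, A = box a b].

(** Half of a pi-lambda argument: boxes are the sets whose indicators are limits of bump functions,
    and they are also stable under intersection. *)
Lemma measurable_rV_boxes : @measurable _ 'rV[R]_d = <<s boxes>>.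
Proof.
apply/seteqP; split; last first.
  apply: smallest_sub; first exact: sigma_algebra_measurable.
  by move=> _ [a [b ->]]; exact: measurable_box.
apply: smallest_sub; first exact: smallest_sigma_algebra.
rewrite -bigcup_seq; apply: bigcup_sub => i _ _ [Y mY <-]; rewrite setTI.
pose C := [set Y : set R | <<s boxes>> ((fun v : 'rV[R]_d => v ord0 i) @^-1` Y)].
suff : @measurable _ R `<=` C by exact.
have RE : @measurable _ R = <<s @RGenOpens.G R>> by exact: RGenOpens.measurableE.
rewrite RE; apply: smallest_sub.
  have [s0 sD sU] := @smallest_sigma_algebra _ setT boxes.
  split.
  - by rewrite /C /= preimage_set0.
  - by move=> A CA; rewrite /C /= setTD preimage_setC -setTD; exact: sD.
  - by move=> F CF; rewrite /C /= preimage_bigcup; exact: sU.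
move=> _ [x [y ->]]; rewrite /C /=.
(* Coordinate [i] is confined to the given interval and the others to []-k, k[], a constraint that
   disappears in the union over [k]. *)
rewrite (_ : _ @^-1` _ = \bigcup_k box
  (\row_j (if j == i then x else - k%:R)) (\row_j (if j == i then y else k%:R))).
  have [_ _] := @smallest_sigma_algebra _ setT boxes; apply => k.
  by apply: sub_gen_smallest; exists (\row_j (if j == i then x else - k%:R)),
    (\row_j (if j == i then y else k%:R)).
apply/seteqP; split => v /=.
  rewrite in_itv /= => vi; exists (Num.bound `|v|) => // j; rewrite !mxE.
  case: eqP => [->//|_]; rewrite -ltr_norml.
  exact: le_lt_trans (norm_coord_le v j) (archi_boundP (normr_ge0 _)).
by move=> [k _] /(_ i); rewrite !mxE eqxx in_itv.
Qed.

Lemma boxes_setI_closed : setI_closed boxes.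
Proof.
by move=> _ _ [a [b ->]] [a' [b' ->]]; rewrite boxI; eexists; eexists.
Qed.

(** Dominated convergence along [box_bump a b n]. The dominating function is [|v|] cut off to a
    cube, integrable as a product of two square integrable functions. *)
Lemma integral_box_eq0 (v : 'rV[R]_d -> R) : v \in Lfun mu 2%:E ->
  (forall psi, test_function psi -> rdot mu v psi = 0) ->
  forall a b, (\int[mu]_x (v x * \1_(box a b) x)%:E = 0)%E.
Proof.
move=> vL v0 a b.
pose s : R := `|a| + `|b| + 1.
have s0 : 0 < s by rewrite ltr_wpDl// addr_ge0.
have boxs x : box a b x -> cube 0 s x.
  move=> xab i; have /andP[h1 h2] := xab i; rewrite !mxE subr0.
  have := norm_coord_le a i; have := norm_coord_le b i.
  have := normr_ge0 a; have := normr_ge0 b; rewrite /s.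
  by rewrite !ler_norml ltr_norml => ? ? /andP[? ?] /andP[? ?]; apply/andP; split; lra.
have mv := Lfun2_measurable vL.
have mb n : measurable_fun setT (box_bump a b n).
  exact: Lfun2_measurable (test_Lfun2 (test_bump a b n)).
have m1 : measurable_fun setT (\1_(box a b) : 'rV[R]_d -> R).
  by apply: measurable_indic; exact: measurable_box.
have := @dominated_convergence _ _ _ mu setT measurableT
  (fun n x => (v x * box_bump a b n x)%:E) (fun x => (v x * \1_(box a b) x)%:E)
  (fun x => `|(v x * \1_(cube 0 s) x)%:E|%E).
case.
- by move=> n; apply/measurable_EFinP; exact: measurable_funM.
- by apply/measurable_EFinP; exact: measurable_funM.
- apply: aeW => x _; apply: cvg_EFin; first exact: nearW.
  by apply: cvgM; [exact: cvg_cst|exact: cvg_bump].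
- apply: integrable_abse; apply: Lfun2_mul_integrable => //; exact: indic_cube_Lfun2.
- apply: aeW => x n _; rewrite !abse_EFin lee_fin !normrM ler_wpM2l//.
  have [/boxs xs|xb] := pselect (box a b x); last by rewrite bump_notin_box// normr0.
  by rewrite indicE mem_set// normr1 ger0_norm ?bump_ge0// bump_le1.
move=> _ _ lim; apply/esym/(cvg_unique _ _ lim) => //.
rewrite (_ : [sequence _]_n = cst 0); first exact: cvg_cst.
apply/funext => n /=; rewrite -[LHS]fineK.
  by have := v0 _ (test_bump a b n); rewrite /rdot /Rintegral => ->.
apply: integrable_fin_num => //; apply: Lfun2_mul_integrable => //.
exact: test_Lfun2 (test_bump a b n).
Qed.

(** After a cutoff, the measurable sets over which [v] integrates to [0] form a Dynkin class
    containing the boxes, hence are all measurable sets. *)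
Lemma test_orthogonal_eq0 (v : 'rV[R]_d -> R) : v \in Lfun mu 2%:E ->
  (forall psi, test_function psi -> rdot mu v psi = 0) ->
  {ae mu, forall x, v x = 0}.
Proof.
move=> vL v0; have ibox := integral_box_eq0 vL v0.
have mv := Lfun2_measurable vL.
(* A square integrable [v] may fail to be integrable; cut off to a cube it is, and countably many
   cubes cover the space. *)
suff H (N : nat) : {ae mu, forall x, (v x * \1_(cube 0 N.+1%:R) x)%:E = 0%E}.
  have := ae_foralln H; apply: filterS => x Hx.
  have := Hx (Num.bound `|x|); rewrite indicE mem_set ?mulr1; first by case.
  move=> i; rewrite !mxE subr0; apply: le_lt_trans (norm_coord_le x i) _.
  by apply: lt_trans (archi_boundP (normr_ge0 _)) _; rewrite ltr_nat.
set w := fun x => (v x * \1_(cube 0 N.+1%:R) x)%:E.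
have iw : mu.-integrable setT w.
  by apply: Lfun2_mul_integrable => //; apply: indic_cube_Lfun2; rewrite ltr0n.
have mw : measurable_fun setT w by exact: measurable_int iw.
have iwS A : measurable A -> mu.-integrable A w.
  by move=> mA; apply: integrableS iw.
pose D := [set A | measurable A /\ (\int[mu]_(x in A) w x = 0)%E].
suff DP : @measurable _ 'rV[R]_d `<=` D.
  have : ae_eq mu setT w (cst 0%E).
    apply: integral_ae_eq => // A _ mA; rewrite integral0; exact: (DP A mA).2.
  by apply: filterS => x /(_ I).
rewrite measurable_rV_boxes -(setI_closed_g_dynkin_g_sigma_algebra boxes_setI_closed).
have wbox A : boxes A -> (\int[mu]_(x in A) w x = 0)%E.
  move=> [a [b ->]]; rewrite integral_mkcond.
  have [a' [b' E]] : exists a' b', box a b `&` cube 0 N.+1%:R = box a' b'.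
    by rewrite cubeE boxI; do 2 eexists.
  rewrite -[RHS](ibox a' b') -E; apply: eq_integral => x _.
  rewrite patchE /w !indicE in_setI; case: (_ \in box a b) => //=.
  by rewrite mulr0.
(* Stability under complements uses the integral over the whole space; [w] lives on a cube, which is
   itself a box. *)
have wT : (\int[mu]_x w x = 0)%E.
  by rewrite -[RHS](ibox (const_mx (- N.+1%:R)) (const_mx N.+1%:R)) -cubeE.
apply: smallest_sub; last first.
  by move=> A bA; split; [case: bA => a [b ->]; exact: measurable_box|exact: wbox].
split.
- by split.
- move=> A [mA A0]; have mCA : measurable (~` A) by exact: measurableC.
  split=> //; move: wT; rewrite -(setUv A) integral_setU//.
  + by rewrite A0 add0e.
  + by rewrite setUv.
  + by apply/disj_setPS => x [].
- move=> F tF DF; have mF k : measurable (F k) by have [] := DF k.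
  split; first exact: bigcupT_measurable.
  rewrite integral_bigcup//; last by apply: iwS; exact: bigcupT_measurable.
  by apply: eseries0 => k _ _; have [] := DF k.
Qed.

End fundamental_lemma.

(** * A Taylor estimate for second differences *)

Section taylor.
Context {R : realType}.

(** A crude integration of a bound, with constant [B] rather than [B / (k+1)]: only the power of [t]
    matters later. *)
Lemma mvt_bound (G dG : R -> R) (B t : R) k : 0 < t ->
  (forall s : R, is_derive s (1 : R) G (dG s)) -> G 0 = 0 ->
  (forall s, 0 < s < t -> `|dG s| <= B * s ^+ k) -> 0 <= B ->
  `|G t| <= B * t ^+ k.+1.
Proof.
move=> t0 GD G0 dGB B0.
have GD' (x : R) : x \in `]0, t[ -> is_derive x (1 : R) G (dG x).
  by move=> _; exact: GD.
have cG : {within `[0, t], continuous G}.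
  apply: continuous_subspaceT => x; apply/differentiable_continuous/derivable1_diffP.
  exact: (@ex_derive _ _ _ _ _ _ _ (GD x)).
have [c] := MVT t0 GD' cG; rewrite in_itv /= => /andP[c0 ct].
rewrite G0 !subr0 => ->; rewrite normrM (gtr0_norm t0) exprSr mulrA ler_pM2r//.
apply: le_trans (dGB c _) _; first by rewrite c0.
by rewrite ler_wpM2l// lerXn2r ?nnegrE ?ltW.
Qed.

(** [mvt_bound] is applied three times, from the second derivative down to [F]. Symmetrizing in [t]
    cancels the first order term, and each combination met on the way vanishes at [0]. *)
Lemma taylor_second_difference (F F1 F2 F3 : R -> R) (M t : R) : 0 < t -> 0 <= M ->
  (forall s : R, is_derive s (1 : R) F (F1 s)) ->
  (forall s : R, is_derive s (1 : R) F1 (F2 s)) ->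
  (forall s : R, is_derive s (1 : R) F2 (F3 s)) ->
  (forall s, `|F3 s| <= M) ->
  `|F t + F (- t) - 2 * F 0 - t ^+ 2 * F2 0| <= 2 * M * t ^+ 3.
Proof.
move=> t0 M0 D1 D2 D3 F3M.
have DN (G G' : R -> R) : (forall s : R, is_derive s (1 : R) G (G' s)) ->
    forall s : R, is_derive s (1 : R) (fun s => G (- s)) (- G' (- s)).
  move=> GD s.
  have := is_derive1_comp (GD (- s)) (is_deriveNid s (1 : R)).
  by move=> H; apply: is_derive_eq H _; rewrite mulrN1.
have B2 s : 0 < s -> `|F2 s + F2 (- s) - 2 * F2 0| <= 2 * M * s ^+ 1.
  move=> s0.
  apply: (@mvt_bound (fun s => F2 s + F2 (- s) - 2 * F2 0) (fun s => F3 s - F3 (- s))) => //.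
  - move=> x; have := is_deriveB (is_deriveD (D3 x) (DN _ _ D3 x)) (is_derive_cst (2 * F2 0) x 1).
    by move=> H; apply: is_derive_eq H _; rewrite subr0.
  - by rewrite oppr0; ring.
  - move=> x _; rewrite expr0 mulr1; apply: le_trans (ler_normB _ _) _.
    by rewrite mulr_natl mulr2n lerD.
  - by rewrite mulr_ge0.
have B1 s : 0 < s -> `|F1 s - F1 (- s) - 2 * s * F2 0| <= 2 * M * s ^+ 2.
  move=> s0.
  apply: (@mvt_bound (fun s => F1 s - F1 (- s) - 2 * s * F2 0)
    (fun s => F2 s + F2 (- s) - 2 * F2 0)) => //.
  - move=> x.
    have Dl : is_derive x (1 : R) (fun s : R => 2 * s * F2 0) (2 * F2 0).
      have := is_deriveZ (2 * F2 0) (is_derive_id x (1 : R)).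
      rewrite (_ : (2 * F2 0) \*: id = (fun s : R => 2 * s * F2 0)); last first.
        by apply/funext => y; rewrite /= [_ *: _]/(_ * _) mulrAC.
      by move=> H; apply: is_derive_eq H _; rewrite [_ *: _]mulr1.
    have := is_deriveB (is_deriveB (D2 x) (DN _ _ D2 x)) Dl.
    by move=> H; apply: is_derive_eq H _; rewrite opprK.
  - by rewrite oppr0; ring.
  - by move=> x /andP[x0 _]; exact: B2.
  - by rewrite mulr_ge0.
apply: (@mvt_bound (fun t => F t + F (- t) - 2 * F 0 - t ^+ 2 * F2 0)
    (fun s => F1 s - F1 (- s) - 2 * s * F2 0)) => //.
- move=> x.
  have Dl : is_derive x (1 : R) (fun s : R => s ^+ 2 * F2 0) (2 * x * F2 0).
    have := is_deriveZ (F2 0) (is_deriveM (is_derive_id x (1 : R)) (is_derive_id x (1 : R))).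
    rewrite (_ : F2 0 \*: _ = (fun s : R => s ^+ 2 * F2 0)); last first.
      by apply/funext => y; rewrite /= [_ *: _]/(_ * _) mulrC.
    by move=> H; apply: is_derive_eq H _; rewrite /= -![_ *: _]/(_ * _); ring.
  have := is_deriveB (is_deriveB (is_deriveD (D1 x) (DN _ _ D1 x)) (is_derive_cst (2 * F 0) x 1)) Dl.
  by move=> H; apply: is_derive_eq H _; rewrite subr0.
- by rewrite oppr0; ring.
- by move=> s /andP[s0 _]; exact: B1.
- by rewrite mulr_ge0.
Qed.

End taylor.

(** * A Liouville theorem for [1 - Delta] *)

Section liouville.
Context {R : realType} {d : nat}.
Local Notation mu := (lebesgue_rV R d).
Local Notation e i := (delta_mx ord0 i : 'rV[R]_d).
Implicit Types (psi f : 'rV[R]_d -> R) (i : 'I_d) (x y z : 'rV[R]_d).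

Definition laplacian psi x : R := \sum_i partial i (partial i psi) x.

Lemma test_laplacian psi : test_function psi -> test_function (laplacian psi).
Proof. by move=> tp; apply: test_sum => i; do 2 apply: test_partial. Qed.

Lemma test_helmholtz psi : test_function psi ->
  test_function (fun x => psi x - laplacian psi x).
Proof.
move=> tp; have := testD tp (testZ (-1) (test_laplacian tp)).
by under eq_fun do rewrite mulN1r.
Qed.

Variable v : 'rV[R]_d -> R.
Hypothesis vL : v \in Lfun mu 2%:E.

(** [K] depends on the radius but not on the centre, as all translates of a cube have the same
    measure. The boundedness of [conv] over the whole space rests on this uniformity. *)
Lemma rdot_cube_bound (r : R) : 0 < r -> exists2 K : R, 0 <= K &
  forall f x (M : R), f \in Lfun mu 2%:E ->
    (forall y, `|f y| <= M * \1_(cube x r) y) -> `|rdot mu v f| <= M * K.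
Proof.
move=> r0; pose K := (rdot mu v v + (2 * r) ^+ d) / 2.
have K0 : 0 <= K.
  by rewrite divr_ge0// addr_ge0 ?rdot_ge0// exprn_ge0// mulr_ge0// ltW.
(* AM-GM: [|v f| <= M (v^2 + 1) / 2] on the cube, where [f] is supported. *)
exists K => // f x M fL fM.
have iL := indic_cube_Lfun2 x r0.
have M0 : 0 <= M.
  have := fM x; rewrite indicE mem_set ?mulr1; first exact: le_trans.
  by move=> i; rewrite subrr normr0.
apply: le_trans (le_normr_Rintegral _ _) _ => //; first exact: Lfun2_mul_integrable.
have iS : mu.-integrable setT
    (EFin \o (fun y => v y * v y + \1_(cube x r) y * \1_(cube x r) y)).
  exact: (integrableD measurableT (Lfun2_mul_integrable vL vL) (Lfun2_mul_integrable iL iL)).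
have -> : M * K = (\int[mu]_y (M / 2 * (v y * v y + \1_(cube x r) y * \1_(cube x r) y)))%R.
  rewrite RintegralZl//.
  rewrite RintegralD//; [|exact: Lfun2_mul_integrable..].
  rewrite /K mulrA mulrAC; congr (_ * (_ + _)).
  have E := lebesgue_rV_cube x r0.
  rewrite /Rintegral (eq_integral (fun y => (\1_(cube x r) y)%:E)).
    rewrite integral_indic//; last exact: measurable_cube.
    by rewrite setIT [X in fine X](_ : _ = ((2 * r) ^+ d)%:E).
  by move=> y _; rewrite indicE; case: (_ \in _); rewrite ?mulr1 ?mulr0.
apply: le_Rintegral => //.
- by apply: integrable_norm; exact: Lfun2_mul_integrable.
- exact: (integrableZl measurableT (M / 2) iS).
- move=> y _; rewrite normrM; have := fM y; have := normr_ge0 (v y).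
  rewrite -[v y * v y]/(v y ^+ 2) -(real_normK (num_real (v y))).
  rewrite indicE; move: `|v y| `|f y| => A B A0.
  case: (_ \in _); rewrite /= ?mulr1n ?mulr0n ?mulr1 ?mulr0 => BM.
    apply: le_trans (ler_wpM2l A0 BM) _; rewrite -subr_ge0.
    have -> : M / 2 * (A ^+ 2 + 1) - A * M = M * (A - 1) ^+ 2 / 2 by field.
    by rewrite divr_ge0// mulr_ge0// sqr_ge0.
  apply: le_trans (ler_wpM2l A0 BM) _; rewrite mulr0 addr0.
  by rewrite mulr_ge0 ?divr_ge0// sqr_ge0.
Qed.

(** The convolution of [v] with [psi], with all translations put on the smooth factor. *)
Definition conv psi x : R := rdot mu v (fun y => psi (x - y)).

Hypothesis v_helmholtz : forall psi, test_function psi ->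
  rdot mu v (fun y => psi y - laplacian psi y) = 0.

Lemma rdotDr f g : f \in Lfun mu 2%:E -> g \in Lfun mu 2%:E ->
  rdot mu v (fun y => f y + g y) = rdot mu v f + rdot mu v g.
Proof. by move=> fL gL; rewrite rdotC rdotDl// !(rdotC _ _ v). Qed.

Lemma rdotZr (k : R) f : f \in Lfun mu 2%:E ->
  rdot mu v (fun y => k * f y) = k * rdot mu v f.
Proof. by move=> fL; rewrite rdotC rdotZl// !(rdotC _ _ v). Qed.

Lemma rdotBr f g : f \in Lfun mu 2%:E -> g \in Lfun mu 2%:E ->
  rdot mu v (fun y => f y - g y) = rdot mu v f - rdot mu v g.
Proof. by move=> fL gL; rewrite rdotC rdotBl// !(rdotC _ _ v). Qed.

(** The weak equation is tested against [y => psi (x - y)]; the two sign changes in its second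
    derivatives cancel. *)
Lemma conv_laplacian psi x : test_function psi -> conv (laplacian psi) x = conv psi x.
Proof.
move=> tp; have tr := test_reflect x tp.
have E : laplacian (fun y => psi (x - y)) = (fun y => laplacian psi (x - y)).
  apply/funext => y; rewrite /laplacian; apply: eq_bigr => i _.
  rewrite partial_reflect; last exact: test_smooth.
  rewrite (_ : (fun x0 => _) = (fun z => -1 * partial i psi (x - z))); last first.
    by apply/funext => z; rewrite mulN1r.
  rewrite partialZ; last exact/smooth_reflect/smooth_partial/test_smooth.
  rewrite partial_reflect; last exact/smooth_partial/test_smooth.
  by rewrite mulN1r opprK.
have := v_helmholtz tr.
have -> := rdotBr (test_Lfun2 tr) (test_Lfun2 (test_laplacian tr)).
by rewrite E => /subr0_eq/esym.
Qed.

Lemma rdot_sumr (I : Type) (s : seq I) (F : I -> 'rV[R]_d -> R) :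
  (forall k, F k \in Lfun mu 2%:E) ->
  rdot mu v (fun y => \sum_(k <- s) F k y) = \sum_(k <- s) rdot mu v (F k).
Proof.
move=> FL; have sL r : (fun y => \sum_(k <- r) F k y) \in Lfun mu 2%:E.
  elim: r => [|k r IH]; last by under eq_fun do rewrite big_cons; exact: Lfun2D.
  by under eq_fun do rewrite big_nil; exact: test_Lfun2 test_cst0.
elim: s => [|k s IH].
  under eq_fun do rewrite big_nil; rewrite big_nil.
  by have := rdotZr 0 vL; under eq_fun do rewrite mul0r; rewrite mul0r.
by under eq_fun do rewrite big_cons; rewrite rdotDr// IH big_cons.
Qed.

(** Taylor's estimate is applied to [psi] under the integral. The remainder is at most [2 M t^3],
    with [M] bounding a third derivative, and lives on one cube, so [rdot_cube_bound] integrates it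
    uniformly in [x]. *)
Lemma second_difference_bound psi i : test_function psi -> exists2 C : R, 0 <= C &
  forall x (t : R), 0 < t -> t <= 1 ->
  t ^+ 2 * conv (partial i (partial i psi)) x <=
  conv psi (t *: e i + x) + conv psi (- t *: e i + x) - 2 * conv psi x + C * t ^+ 3.
Proof.
move=> tp; have /test_functionP[sp [r r0 pr]] := tp.
have tp2 : test_function (partial i (partial i psi)) by do 2 apply: test_partial.
have /test_functionP[sp3 [r3 r30 pr3]] := test_partial i tp2.
have [M M0 MP] := supported_bounded r30 (smooth_continuous sp3) pr3.
have pr2 := supported_derive (e i) (supported_derive (e i) pr).
(* Each of the two derivatives enlarges the support by one unit; the same cube absorbs shifts by
   [t <= 1]. *)
have r20 : 0 < r + 1 + 1 by lra.
have [K K0 KP] := rdot_cube_bound r20.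
have rr : r <= r + 1 + 1 by lra.
have r0' := ltW r0; have r20' := ltW r20.
exists (2 * M * K) => [|x t t0 t1]; first by rewrite !mulr_ge0// ltW.
pose D y := psi (t *: e i + x - y) + psi (- t *: e i + x - y) - 2 * psi (x - y)
            - t ^+ 2 * partial i (partial i psi) (x - y).
have trL f b : test_function f -> (fun y => f (b - y)) \in Lfun mu 2%:E.
  by move=> tf; exact/test_Lfun2/test_reflect.
have L1 := trL _ (t *: e i + x) tp; have L2 := trL _ (- t *: e i + x) tp.
have L3 := trL _ x tp; have L4 := trL _ x tp2.
have DE : rdot mu v D = conv psi (t *: e i + x) + conv psi (- t *: e i + x)
    - 2 * conv psi x - t ^+ 2 * conv (partial i (partial i psi)) x.
  rewrite /D rdotBr ?rdotBr ?rdotDr ?rdotZr//.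
  - exact: Lfun2D.
  - exact: Lfun2Z.
  - by apply: Lfun2B; [exact: Lfun2D|exact: Lfun2Z].
  - exact: Lfun2Z.
have DL : D \in Lfun mu 2%:E.
  by apply: Lfun2B; [apply: Lfun2B; [exact: Lfun2D|exact: Lfun2Z]|exact: Lfun2Z].
have DB y : `|D y| <= 2 * M * t ^+ 3 * \1_(cube x (r + 1 + 1)) y.
  rewrite indicE; have [yx|yx] := pselect (cube x (r + 1 + 1) y).
    rewrite mem_set// mulr1.
    have := @taylor_second_difference R (fun s => psi (s *: e i + (x - y)))
      (fun s => partial i psi (s *: e i + (x - y)))
      (fun s => partial i (partial i psi) (s *: e i + (x - y)))
      (fun s => partial i (partial i (partial i psi)) (s *: e i + (x - y))) M t t0 (ltW M0).
    rewrite /D scale0r add0r !addrA; apply.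
    - by move=> s; apply: is_derive_line.
    - by move=> s; apply: is_derive_line; apply: smooth_partial.
    - by move=> s; apply: is_derive_line; do 2 apply: smooth_partial.
    - by move=> s; exact: MP.
  have nx k : 0 <= k -> k <= r + 1 + 1 -> ~ cube 0 k (x - y).
    move=> k0 kr H; apply: yx => j; have := H j; rewrite !mxE subr0 distrC => /lt_le_trans; exact.
  have nt (s : R) : `|s| <= 1 -> ~ cube 0 r (s *: e i + x - y).
    move=> s1 H; apply: yx => j; have := H j; rewrite !mxE subr0 /= => h.
    rewrite distrC (_ : x ord0 j - y ord0 j = (s * (j == i)%:R + x ord0 j - y ord0 j) - s * (j == i)%:R); last by ring.
    apply: le_lt_trans (ler_normB _ _) _; apply: (@le_lt_trans _ _ (`|s * (j == i)%:R + x ord0 j - y ord0 j| + 1)).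
      by rewrite lerD2l normrM; case: (_ == _); rewrite ?normr1 ?mulr1 ?normr0 ?mulr0.
    by apply: lt_trans (_ : _ < r + 1) _; [rewrite ltrD2r|rewrite ltrDl].
  have z1 : psi (t *: e i + x - y) = 0 by apply: pr; apply: nt; rewrite gtr0_norm.
  have z2 : psi (- t *: e i + x - y) = 0.
    by apply: pr; apply: nt; rewrite normrN gtr0_norm.
  have z3 : psi (x - y) = 0 by apply: pr; exact: nx.
  have z4 : partial i (partial i psi) (x - y) = 0 by apply: pr2; exact: nx.
  by rewrite memNset// mulr0 /D z1 z2 z3 z4 !mulr0 addr0 !subr0 normr0.
have := KP D x _ DL DB; rewrite DE => /ler_normlP[+ _].
have -> : 2 * M * t ^+ 3 * K = 2 * M * K * t ^+ 3 by ring.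
move: (conv _ _) (conv _ _) (conv _ _) (t ^+ 2 * conv _ _) (_ * t ^+ 3) => A B C E F; lra.
Qed.

(* Bounded solutions of [g - laplacian g = 0] vanish: at points where [g] is
   close to its supremum [S], second differences of step [t] are almost
   nonpositive, so that [t^2 S <= B t^3] for all small [t]. *)
Lemma conv_le0 psi x : test_function psi -> conv psi x <= 0.
Proof.
move=> tp; have /test_functionP[sp [r r0 pr]] := tp.
have [M M0 MP] := supported_bounded r0 (smooth_continuous sp) pr.
have [K K0 KP] := rdot_cube_bound r0.
have ub y : conv psi y <= M * K.
  apply: le_trans (ler_norm _) _; apply: (KP _ y) => [|z].
    exact/test_Lfun2/test_reflect.
  rewrite indicE; have [zy|zy] := pselect (cube y r z).
    by rewrite mem_set// mulr1.
  rewrite memNset// mulr0 pr ?normr0// => H; apply: zy => j.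
  by have := H j; rewrite !mxE subr0 distrC.
have hS : has_sup (range (conv psi)).
  by split; [exists (conv psi 0), 0|exists (M * K) => _ [y _ <-]].
pose S := sup (range (conv psi)).
have leS y : conv psi y <= S by apply: sup_upper_bound => //; exists y.
pose C i := s2val (cid2 (second_difference_bound i tp)).
have C0 i : 0 <= C i := s2valP (cid2 (second_difference_bound i tp)).
have CP i := s2valP' (cid2 (second_difference_bound i tp)).
suff S0 : S <= 0 by exact: le_trans S0.
pose B := \sum_i C i.
have B0 : 0 <= B by apply: sumr_ge0.
(* [second_difference_bound] summed over the coordinates: the left sides add up to [t^2] times the
   convolution with the Laplacian, that is with [psi], and the shifted values are at most [S]. *)
have key y (t : R) : 0 < t -> t <= 1 ->
    t ^+ 2 * conv psi y <= (2 * (S - conv psi y)) *+ d + B * t ^+ 3.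
  move=> t0 t1; rewrite -(conv_laplacian y tp) {1}/conv rdot_sumr; last first.
    by move=> i; apply/test_Lfun2/(test_reflect y); do 2 apply: test_partial.
  rewrite mulr_sumr -[X in _ *+ X]card_ord -sumr_const mulr_suml -big_split /=.
  apply: ler_sum => i _; have := CP i y t t0 t1; rewrite -/(C i).
  have := leS (t *: e i + y); have := leS (- t *: e i + y).
  rewrite conv_laplacian// -/(conv _ y) => h1 h2 /le_trans; apply; lra.
apply: (@le0_of_le_geometric _ _ B) => n; set t := 2^-1 ^+ n.
have t0 : 0 < t by rewrite exprn_gt0.
have t1 : t <= 1 by rewrite exprn_ile1// invf_le1 ?ler1n.
apply/ler_addgt0Pr => eps eps0.
have t20 : 0 < t ^+ 2 by rewrite exprn_gt0.
have q0 : 0 < t ^+ 2 + 2 * d%:R by rewrite ltr_wpDr ?mulr_ge0.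
(* Replacing [S] by its value at [y] costs at most [(t^2 + 2 d) delta = eps t^2]; dividing by [t^2]
   leaves [S <= B t + eps]. *)
pose delta := eps * t ^+ 2 / (t ^+ 2 + 2 * d%:R).
have delta0 : 0 < delta by rewrite divr_gt0 ?mulr_gt0.
have [_ [y _ <-] yS] := sup_adherent delta0 hS.
rewrite -/S in yS; have k1 := key y t t0 t1; rewrite -mulr_natr in k1.
rewrite -(ler_pM2l t20).
have dE : delta * (t ^+ 2 + 2 * d%:R) = eps * t ^+ 2 by rewrite /delta divfK// gt_eqF.
have h1 : t ^+ 2 * (S - conv psi y) <= t ^+ 2 * delta.
  by rewrite ler_wpM2l ?ltW// ltrBlDr -ltrBlDl.
have h2 : 2 * (S - conv psi y) * d%:R <= 2 * delta * d%:R.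
  by rewrite ler_wpM2r// ler_wpM2l// ltW// ltrBlDr -ltrBlDl.
rewrite mulrDr; move: k1 h1 h2 dE; rewrite (exprS t 2); move: (t ^+ 2) => u; lra.
Qed.

(** [conv_le0] for a test function and for its opposite forces [conv] to vanish at the origin, where
    the convolution with the reflection of [psi] is the pairing with [psi]. *)
Lemma helmholtz_rdot_eq0 psi : test_function psi -> rdot mu v psi = 0.
Proof.
move=> tp.
have conv0 f : test_function f -> conv f 0 = 0.
  move=> tf; apply/eqP; rewrite eq_le conv_le0//=.
  have := conv_le0 0 (testZ (-1) tf); rewrite /conv rdotZr ?mulN1r ?oppr_le0//.
  by apply: test_Lfun2; exact: test_reflect.
have := conv0 _ (test_reflect 0 tp); rewrite /conv.
by under eq_fun do rewrite !sub0r opprK.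
Qed.

End liouville.

(** * Test functions as vectors of [L^2], and weak derivatives *)

Section test_in_L2.
Context {R : realType} {d : nat}.
Local Notation mu := (lebesgue_rV R d).
Local Notation L2 := (L2 mu).
Local Notation ip := (@inner _ _ R mu).
Implicit Types (psi eta f g : 'rV[R]_d -> R) (i j : 'I_d) (u w : L2).

Let hV : hilbert ip := hilbert_L2 mu.

(** Total, with default value [0], so that identities can be written without membership proofs;
    [toL2P] gives its meaning on test functions. *)
Definition toL2 psi : L2 := xget 0 [set u | represents u (fun x => (psi x)%:C)].

Lemma toL2P psi : test_function psi -> represents (toL2 psi) (fun x => (psi x)%:C).
Proof.
move=> tp; have [u up] : exists u : L2, represents u (fun x => (psi x)%:C).
  apply: representsP; apply/L2funP; split; first exact: test_Lfun2.
  exact: test_Lfun2 test_cst0.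
have := @xgetPex _ (0 : L2) [set u : L2 | represents u (fun x => (psi x)%:C)].
by apply; exists u.
Qed.

Lemma rdot0r (a : 'rV[R]_d -> R) : rdot mu a (fun=> 0) = 0.
Proof.
rewrite /rdot; under eq_Rintegral do rewrite mulr0.
by rewrite /Rintegral integral0.
Qed.

Lemma inner_toL2 u psi : test_function psi ->
  inner u (toL2 psi) = rdot mu (fun x => Re (repr u x)) psi +i*
                       rdot mu (fun x => Im (repr u x)) psi.
Proof.
move=> tp; rewrite (innerE (represents_repr u) (toL2P tp)) /=.
by rewrite !rdot0r addr0 subr0.
Qed.

Lemma inner_toL2_Cintegral u psi : test_function psi ->
  inner u (toL2 psi) = Cintegral mu (fun x => repr u x * (psi x)%:C).
Proof.
move=> tp; rewrite (inner_represents (represents_repr u) (toL2P tp)).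
by congr Cintegral; apply/funext => x; rewrite conjc_real.
Qed.

Lemma inner_toL2_toL2 psi eta : test_function psi -> test_function eta ->
  inner (toL2 psi) (toL2 eta) = (rdot mu psi eta)%:C.
Proof.
move=> tp te; rewrite (innerE (toL2P tp) (toL2P te)) /= !rdot0r addr0 subr0.
by congr Complex; rewrite rdotC rdot0r.
Qed.

Lemma toL2D f g : test_function f -> test_function g ->
  toL2 (fun x => f x + g x) = toL2 f + toL2 g.
Proof.
move=> tf tg; apply: represents_inj (toL2P (testD tf tg)) _.
have := representsD (toL2P tf) (toL2P tg).
by under eq_fun do rewrite -rmorphD.
Qed.

Lemma toL2Z (k : R) f : test_function f ->
  toL2 (fun x => k * f x) = k%:C *: toL2 f.
Proof.
move=> tf; apply: represents_inj (toL2P (testZ k tf)) _.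
have := representsZ k%:C (toL2P tf).
by under eq_fun do rewrite -rmorphM.
Qed.

Lemma toL20 : toL2 (fun _ : 'rV[R]_d => 0) = 0.
Proof.
have := toL2Z 0 test_cst0.
by under eq_fun do rewrite mul0r; rewrite scale0r.
Qed.

Lemma toL2_orthogonal_eq0 u :
  (forall psi, test_function psi -> inner u (toL2 psi) = 0) -> u = 0.
Proof.
move=> u0.
have re : {ae mu, forall x, Re (repr u x) = 0}.
  apply: (test_orthogonal_eq0 (repr_Re u)) => psi tp.
  by have := u0 _ tp; rewrite inner_toL2// => -[].
have im : {ae mu, forall x, Im (repr u x) = 0}.
  apply: (test_orthogonal_eq0 (repr_Im u)) => psi tp.
  by have := u0 _ tp; rewrite inner_toL2// => -[].
apply: (ip_eq0 hV); rewrite (sqn_represents (f := fun=> 0)).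
  by rewrite /= !rdot0r addr0.
split; first exact: (rpred0 (L2fun mu)).
by apply: filterS2 re im => x; case: (repr u x) => a b /= -> ->.
Qed.

(** As test functions are real, the hypothesis splits into one for the real part of [u] and one for
    its imaginary part; the Liouville theorem for real functions handles each. *)
Lemma toL2_helmholtz_eq0 u : (forall psi, test_function psi ->
  inner u (toL2 (fun x => psi x - laplacian psi x)) = 0) -> u = 0.
Proof.
move=> uh; apply: toL2_orthogonal_eq0 => psi tp.
rewrite inner_toL2// (helmholtz_rdot_eq0 (repr_Re u))//; last first.
  by move=> eta te; have := uh _ te; rewrite inner_toL2 => [[]|]; last exact: test_helmholtz.
rewrite (helmholtz_rdot_eq0 (repr_Im u))//.
by move=> eta te; have := uh _ te; rewrite inner_toL2 => [[]|]; last exact: test_helmholtz.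
Qed.

Lemma rdot_partial i psi eta : test_function psi -> test_function eta ->
  rdot mu (partial i psi) eta = - rdot mu psi (partial i eta).
Proof.
move=> tp te; have tpe := testM tp (test_smooth te).
have := testM tp (test_smooth te) => /test_functionP[s [r r0 sr]].
have H : (\int[mu]_x (partial i (fun x => psi x * eta x) x)%:E = 0)%E :=
  integral_derive_eq0 r0 (smooth_continuous s) (fun x => @smooth_derivable _ _ _ x _ s)
  (smooth_continuous (smooth_partial i s)) sr.
rewrite partialM in H; [|exact: test_smooth..].
apply/eqP; rewrite -addr_eq0 /rdot -RintegralD//.
- by rewrite /Rintegral H.
- by apply: Lfun2_mul_integrable; apply: test_Lfun2 => //; exact: test_partial.
- by apply: Lfun2_mul_integrable; apply: test_Lfun2 => //; exact: test_partial.
Qed.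

Lemma is_weak_partialP i u w : is_weak_partial i u w <->
  forall psi, test_function psi ->
    inner u (toL2 (partial i psi)) = - inner w (toL2 psi).
Proof.
split=> H psi tp; have := H psi tp;
by rewrite !inner_toL2_Cintegral//; exact: test_partial.
Qed.

Lemma is_weak_partial_uniq i u w w' :
  is_weak_partial i u w -> is_weak_partial i u w' -> w = w'.
Proof.
move=> /is_weak_partialP H /is_weak_partialP H'.
apply/eqP; rewrite -subr_eq0; apply/eqP; apply: toL2_orthogonal_eq0 => psi tp.
rewrite (ipBl hV); apply/eqP; rewrite subr_eq0; apply/eqP.
by apply: oppr_inj; rewrite -H// -H'.
Qed.

Lemma weak_partialE i u w : is_weak_partial i u w -> weak_partial i u = w.
Proof.
move=> uw; apply: (@is_weak_partial_uniq i u) => //.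
have := @xgetPex _ (0 : L2) [set w : L2 | is_weak_partial i u w].
by apply; exists w.
Qed.

Lemma weak_partialP i u : (exists w, is_weak_partial i u w) ->
  is_weak_partial i u (weak_partial i u).
Proof. by move=> [w uw]; rewrite (weak_partialE uw). Qed.

Lemma is_weak_partial_linear i a u w u' w' :
  is_weak_partial i u w -> is_weak_partial i u' w' ->
  is_weak_partial i (a *: u + u') (a *: w + w').
Proof.
move=> /is_weak_partialP H /is_weak_partialP H'; apply/is_weak_partialP => psi tp.
by rewrite !(ipDl hV) !(ipZl hV) H// H'// opprD mulrN.
Qed.

Lemma is_weak_partial_toL2 i psi : test_function psi ->
  is_weak_partial i (toL2 psi) (toL2 (partial i psi)).
Proof.
move=> tp; apply/is_weak_partialP => eta te.
rewrite !inner_toL2_toL2 ?(rdot_partial i tp te)//; try exact: test_partial.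
by rewrite rmorphN opprK.
Qed.

(** Weak differentiation is a closed operation: this is how limits of test functions enter the
    Sobolev space. *)
Lemma is_weak_partial_lim i (u w : nat -> L2) l l' (C C' : R) :
  (forall n, is_weak_partial i (u n) (w n)) ->
  (forall n, nrm ip (u n - l) <= C * 2^-1 ^+ n) ->
  (forall n, nrm ip (w n - l') <= C' * 2^-1 ^+ n) ->
  is_weak_partial i l l'.
Proof.
move=> uw ul wl; apply/is_weak_partialP => psi tp.
rewrite -(ipNr hV); apply: (ip_lim hV ul wl) => n.
by rewrite (ipNr hV); have /is_weak_partialP := uw n; apply.
Qed.

End test_in_L2.

(** * Convergence at a geometric rate *)

Section geometric_convergence.
Context {R : realType} {V : lmodType R[i]}.
Variable ip : V -> V -> R[i].
Hypothesis hV : hilbert ip.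

Definition gcvg (u : nat -> V) l : Prop :=
  exists C : R, forall n, nrm ip (u n - l) <= C * 2^-1 ^+ n.

Lemma gcvgD u l u' l' : gcvg u l -> gcvg u' l' ->
  gcvg (fun n => u n + u' n) (l + l').
Proof.
move=> [C H] [C' H']; exists (C + C') => n; rewrite opprD addrACA.
by apply: le_trans (nrmD hV _ _) _; rewrite mulrDl lerD.
Qed.

Lemma gcvgN u l : gcvg u l -> gcvg (fun n => - u n) (- l).
Proof. by move=> [C H]; exists C => n; rewrite -opprD (nrmN hV). Qed.

Lemma gcvg_sum (I : Type) (s : seq I) (u : I -> nat -> V) (l : I -> V) :
  (forall i, gcvg (u i) (l i)) -> gcvg (fun n => \sum_(i <- s) u i n) (\sum_(i <- s) l i).
Proof.
move=> H; elim: s => [|i s IH].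
  by exists 0 => n; rewrite !big_nil subrr (nrm0 hV) mul0r.
by under eq_fun do rewrite big_cons; rewrite big_cons; exact: gcvgD.
Qed.

Lemma gcvg_uniq u l l' : gcvg u l -> gcvg u l' -> l = l'.
Proof.
move=> [C H] [C' H']; apply: subr0_eq; apply: (nrm_eq0 hV).
apply: (@le0_of_le_geometric _ _ (C + C')) => n.
apply: le_trans (nrmB_triangle hV (u n) _ _) _.
rewrite mulrDl; apply: lerD; last exact: H'.
by rewrite (nrmBC hV); exact: H.
Qed.

Lemma gcvg_complete (u : nat -> V) (c : R) : 0 <= c ->
  (forall n, nrm ip (u n.+1 - u n) <= c * 2^-1 ^+ n) -> exists l, gcvg u l.
Proof. by move=> c0 H; exact: (ip_complete hV c0 H). Qed.

Lemma gcvg_ip u u' l l' v v' : gcvg u l -> gcvg u' l' ->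
  (forall n, ip (u n) v = ip (u' n) v') -> ip l v = ip l' v'.
Proof. by move=> [C H] [C' H']; exact: (ip_lim hV H H'). Qed.

End geometric_convergence.

(** * The space [H^2] and its core of complex test functions *)

Section sobolev.
Context {R : realType} {d : nat}.
Local Notation mu := (lebesgue_rV R d).
Local Notation L2 := (L2 mu).
Local Notation ip := (@inner _ _ R mu).
Local Notation W := (@weak_partial R d).
Local Notation T := (neg_laplacian R d).
Implicit Types (psi eta f g : 'rV[R]_d -> R) (i j : 'I_d) (u w : L2).

Let hV : hilbert ip := hilbert_L2 mu.

Lemma is_weak_partial0 i : is_weak_partial i (0 : L2) 0.
Proof.
by apply/is_weak_partialP => psi tp; rewrite !(ip0l hV) oppr0.
Qed.

Lemma sobolev1_linear a u w : sobolev1 u -> sobolev1 w -> sobolev1 (a *: u + w).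
Proof.
move=> Su Sw i; have [u' uu'] := Su i; have [w' ww'] := Sw i.
by exists (a *: u' + w'); exact: is_weak_partial_linear.
Qed.

Lemma weak_partial_linear i a u w : sobolev1 u -> sobolev1 w ->
  W i (a *: u + w) = a *: W i u + W i w.
Proof.
move=> Su Sw; apply: weak_partialE.
by apply: is_weak_partial_linear; exact: weak_partialP.
Qed.

Lemma sobolev2_submodule : submodule (@sobolev2 R d).
Proof.
split=> [|a u w [u1 u2] [w1 w2]].
  split=> [i|i j]; first by exists 0; exact: is_weak_partial0.
  by exists 0; rewrite (weak_partialE (is_weak_partial0 i)); exact: is_weak_partial0.
split=> [|i]; first exact: sobolev1_linear.
by rewrite weak_partial_linear//; exact: sobolev1_linear.
Qed.

Lemma neg_laplacian_linear a u w : sobolev2 u -> sobolev2 w ->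
  T (a *: u + w) = a *: T u + T w.
Proof.
move=> [u1 u2] [w1 w2]; rewrite /= scalerN -opprD scaler_sumr -big_split /=.
congr (- _); apply: eq_bigr => i _.
by rewrite weak_partial_linear// weak_partial_linear.
Qed.

(** Test functions are real-valued, while the density argument requires a complex subspace; pairs
    provide it. *)
Definition complex_test f g : L2 := toL2 f + 'i *: toL2 g.

Definition core : set L2 := [set u | exists f g,
  [/\ test_function f, test_function g & u = complex_test f g]].

Lemma core_submodule : submodule core.
Proof.
split=> [|a u w [f [g [tf tg ->]]] [f' [g' [tf' tg' ->]]]].
  exists (fun=> 0), (fun=> 0); split; try exact: test_cst0.
  by rewrite /complex_test toL20 scaler0 addr0.
exists (fun x => (Re a * f x + - Im a * g x) + f' x),
  (fun x => (Im a * f x + Re a * g x) + g' x); split.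
- by repeat first [exact: tf|exact: tg|exact: tf'|exact: testZ|apply: testD].
- by repeat first [exact: tf|exact: tg|exact: tg'|exact: testZ|apply: testD].
rewrite /complex_test !toL2D ?toL2Z//; try by repeat first [exact: testZ|apply: testD].
rewrite !scalerDr !scalerA; move: (toL2 f) (toL2 g) (toL2 f') ('i *: toL2 g') => A B C E.
rewrite [in RHS]addrACA; congr (_ + _).
rewrite [in RHS]addrACA -!scalerDl; congr (_ *: _ + _ *: _).
  by case: a => a b; congr Complex => /=; ring.
by case: a => a b; congr Complex => /=; ring.
Qed.

Lemma sqn_complex_test f g : test_function f -> test_function g ->
  sqn ip (complex_test f g) = rdot mu f f + rdot mu g g.
Proof.
move=> tf tg; rewrite (sqn_represents (representsD (toL2P tf) (representsZ 'i (toL2P tg)))).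
have -> : (fun x => Re ((f x)%:C + 'i * (g x)%:C)) = f by apply/funext => x /=; ring.
by have -> : (fun x => Im ((f x)%:C + 'i * (g x)%:C)) = g by apply/funext => x /=; ring.
Qed.

Lemma is_weak_partial_complex_test i f g : test_function f -> test_function g ->
  is_weak_partial i (complex_test f g) (complex_test (partial i f) (partial i g)).
Proof.
move=> tf tg; rewrite /complex_test addrC [X in is_weak_partial _ _ X]addrC.
by apply: is_weak_partial_linear; exact: is_weak_partial_toL2.
Qed.

Lemma weak_partial_complex_test i f g : test_function f -> test_function g ->
  W i (complex_test f g) = complex_test (partial i f) (partial i g).
Proof. by move=> tf tg; exact/weak_partialE/is_weak_partial_complex_test. Qed.

Lemma core_sobolev2 u : core u -> sobolev2 u.
Proof.
move=> [f [g [tf tg ->]]]; split=> [i|i j].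
  by eexists; exact: is_weak_partial_complex_test.
rewrite weak_partial_complex_test//.
by eexists; apply: is_weak_partial_complex_test; exact: test_partial.
Qed.

Lemma toL2_sum (I : Type) (s : seq I) (F : I -> 'rV[R]_d -> R) :
  (forall k, test_function (F k)) ->
  toL2 (fun x => \sum_(k <- s) F k x) = \sum_(k <- s) toL2 (F k).
Proof.
move=> tF; elim: s => [|k s IH].
  by under eq_fun do rewrite big_nil; rewrite big_nil toL20.
under eq_fun do rewrite big_cons.
by rewrite toL2D ?IH ?big_cons//; exact: test_sum.
Qed.

Lemma toL2_helmholtz f : test_function f ->
  toL2 (fun x => f x - laplacian f x) =
  toL2 f - \sum_i toL2 (partial i (partial i f)).
Proof.
move=> tf; have := toL2D tf (testZ (-1) (test_laplacian tf)).
under eq_fun do rewrite mulN1r; move=> ->; congr (_ + _).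
rewrite toL2Z ?toL2_sum; last exact: test_laplacian.
  by rewrite rmorphN1 scaleN1r.
by move=> i; do 2 apply: test_partial.
Qed.

Lemma core_helmholtz f g : test_function f -> test_function g ->
  T (complex_test f g) + complex_test f g =
  complex_test (fun x => f x - laplacian f x) (fun x => g x - laplacian g x).
Proof.
move=> tf tg.
have E : T (complex_test f g) = - \sum_i complex_test (partial i (partial i f)) (partial i (partial i g)).
  rewrite /=; congr (- _); apply: eq_bigr => i _.
  rewrite (weak_partial_complex_test i tf tg) weak_partial_complex_test//; exact: test_partial.
have E' : complex_test (fun x => f x - laplacian f x) (fun x => g x - laplacian g x) =
    (toL2 f - \sum_i toL2 (partial i (partial i f))) +
    'i *: (toL2 g - \sum_i toL2 (partial i (partial i g))).
  exact: (congr2 (fun a b => a + 'i *: b) (toL2_helmholtz tf) (toL2_helmholtz tg)).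
rewrite E {}E' addrC.
by rewrite scalerBr [RHS]addrACA -opprD scaler_sumr -big_split.
Qed.

End sobolev.

(** * The elliptic estimate and surjectivity of [1 - Delta] *)

Section helmholtz.
Context {R : realType} {d : nat}.
Local Notation mu := (lebesgue_rV R d).
Local Notation L2 := (L2 mu).
Local Notation ip := (@inner _ _ R mu).
Local Notation W := (@weak_partial R d).
Local Notation T := (neg_laplacian R d).
Implicit Types (psi eta f g : 'rV[R]_d -> R) (i j : 'I_d) (u w : L2).

Let hV : hilbert ip := hilbert_L2 mu.

(** Up to sign, both sides are the pairing of the same third derivative with [partial j f],
    integrated by parts along [j] or along [i]. The square of the Laplacian thereby becomes a sum of
    squares. *)
Lemma rdot_partial2 i j f : test_function f ->
  rdot mu (partial i (partial i f)) (partial j (partial j f)) =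
  rdot mu (partial j (partial i f)) (partial j (partial i f)).
Proof.
move=> tf; have tp (k : 'I_d) (h : 'rV[R]_d -> R) : test_function h -> test_function (partial k h) by exact: test_partial.
have ti := tp i _ tf; have tj := tp j _ tf.
have E1 := rdot_partial j (tp i _ ti) tj.
have E2 := rdot_partial i (tp j _ ti) tj.
have C1 := partialC j i (test_smooth ti).
have C2 := partialC i j (test_smooth tf).
rewrite C1 in E1; rewrite C2 in E2.
exact: oppr_inj (etrans (esym E1) E2).
Qed.

Lemma rdot_laplacian (v f : 'rV[R]_d -> R) : v \in Lfun mu 2%:E -> test_function f ->
  rdot mu v (laplacian f) = \sum_i rdot mu v (partial i (partial i f)).
Proof.
move=> vL tf; apply: (rdot_sumr vL) => i; apply: test_Lfun2.
by apply: test_partial; exact: test_partial.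
Qed.

Lemma rdot_helmholtz f : test_function f ->
  rdot mu (fun x => f x - laplacian f x) (fun x => f x - laplacian f x) =
  rdot mu f f + 2 * \sum_i rdot mu (partial i f) (partial i f) +
  \sum_i \sum_j rdot mu (partial j (partial i f)) (partial j (partial i f)).
Proof.
move=> tf; have tl := test_laplacian tf.
have fL := test_Lfun2 tf; have lL := test_Lfun2 tl.
have tp (k : 'I_d) (h : 'rV[R]_d -> R) : test_function h -> test_function (partial k h) by exact: test_partial.
have pL k : partial k (partial k f) \in Lfun mu 2%:E.
  exact: test_Lfun2 (tp _ _ (tp _ _ tf)).
have E1 : rdot mu f (laplacian f) = - \sum_i rdot mu (partial i f) (partial i f).
  apply: etrans (rdot_laplacian fL tf) _; rewrite -sumrN; apply: eq_bigr => i _.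
  by apply: oppr_inj; rewrite opprK; exact: esym (rdot_partial i tf (tp i _ tf)).
have E2 : rdot mu (laplacian f) (laplacian f) =
    \sum_i \sum_j rdot mu (partial j (partial i f)) (partial j (partial i f)).
  apply: etrans (rdot_laplacian lL tf) _; apply: eq_bigr => i _.
  apply: etrans (rdotC _ _ _) _; apply: etrans (rdot_laplacian (pL i) tf) _.
  by apply: eq_bigr => j _; exact: rdot_partial2.
have hL := Lfun2B fL lL.
have E3 : rdot mu f (fun x => f x - laplacian f x) = rdot mu f f - rdot mu f (laplacian f).
  exact: rdotBr.
have E4 : rdot mu (laplacian f) (fun x => f x - laplacian f x) =
    rdot mu f (laplacian f) - rdot mu (laplacian f) (laplacian f).
  by apply: etrans (rdotBr lL fL lL) _; congr (_ - _); exact: rdotC.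
apply: etrans (rdotBl fL lL hL) _; rewrite E3 E4 E1 E2; ring.
Qed.

(** All terms on the right of [rdot_helmholtz] are nonnegative, so each is bounded by the left side.
    Convergence of [T u + u] thus forces convergence of all derivatives up to order two. *)
Lemma core_elliptic u : core u ->
  [/\ nrm ip u <= nrm ip (T u + u),
      forall i, nrm ip (W i u) <= nrm ip (T u + u) &
      forall i j, nrm ip (W j (W i u)) <= nrm ip (T u + u)].
Proof.
move=> [f [g [tf tg ->]]].
have tp (k : 'I_d) (h : 'rV[R]_d -> R) : test_function h -> test_function (partial k h) by exact: test_partial.
rewrite (core_helmholtz tf tg).
have le3 (x a b c : R) : 0 <= a -> 0 <= b -> 0 <= c ->
    [\/ x <= a, x <= b | x <= c] -> x <= a + 2 * b + c.
  by move=> ? ? ? [] ?; lra.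
have bound (h : 'rV[R]_d -> R) : test_function h ->
  [/\ rdot mu h h <= rdot mu (fun x => h x - laplacian h x) (fun x => h x - laplacian h x),
      forall i, rdot mu (partial i h) (partial i h) <=
        rdot mu (fun x => h x - laplacian h x) (fun x => h x - laplacian h x) &
      forall i j, rdot mu (partial j (partial i h)) (partial j (partial i h)) <=
        rdot mu (fun x => h x - laplacian h x) (fun x => h x - laplacian h x)].
  move=> th; rewrite (rdot_helmholtz th).
  have s1 : 0 <= \sum_i rdot mu (partial i h) (partial i h).
    by apply: sumr_ge0 => i _; exact: rdot_ge0.
  have s2 : 0 <= \sum_i \sum_j rdot mu (partial j (partial i h)) (partial j (partial i h)).
    by apply: sumr_ge0 => i _; apply: sumr_ge0 => j _; exact: rdot_ge0.
  have s0 := rdot_ge0 mu h.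
  split=> [|i|i j]; first by apply: le3 => //; exact: Or31.
    have h1 : rdot mu (partial i h) (partial i h) <= \sum_i rdot mu (partial i h) (partial i h).
      rewrite (bigD1 i)//= lerDl; apply: sumr_ge0 => k _; exact: rdot_ge0.
    by apply: le3 => //; exact: Or32 h1.
  have h1 : \sum_j rdot mu (partial j (partial i h)) (partial j (partial i h)) <=
       \sum_i \sum_j rdot mu (partial j (partial i h)) (partial j (partial i h)).
    rewrite [leRHS](bigD1 i)//= lerDl; apply: sumr_ge0 => k _.
    by apply: sumr_ge0 => l _; exact: rdot_ge0.
  have h2 : rdot mu (partial j (partial i h)) (partial j (partial i h)) <=
      \sum_j rdot mu (partial j (partial i h)) (partial j (partial i h)).
    rewrite [leRHS](bigD1 j)//= lerDl; apply: sumr_ge0 => k _; exact: rdot_ge0.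
  by apply: le3 => //; exact: Or33 (le_trans h2 h1).
have [f0 f1 f2] := bound f tf; have [g0 g1 g2] := bound g tg.
have thf := test_helmholtz tf; have thg := test_helmholtz tg.
have EF := sqn_complex_test thf thg.
have le_nrm f' g' (uu : L2) : test_function f' -> test_function g' ->
    uu = complex_test f' g' ->
    rdot mu f' f' <= rdot mu (fun x => f x - laplacian f x) (fun x => f x - laplacian f x) ->
    rdot mu g' g' <= rdot mu (fun x => g x - laplacian g x) (fun x => g x - laplacian g x) ->
    nrm ip uu <= nrm ip (complex_test (fun x => f x - laplacian f x) (fun x => g x - laplacian g x)).
  move=> tf' tg' -> hf hg; apply: ler_wsqrtr.
  apply: le_trans (_ : _ <= rdot mu f' f' + rdot mu g' g') _.
    by rewrite (sqn_complex_test tf' tg').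
  by rewrite EF; exact: lerD hf hg.
have W1 i := weak_partial_complex_test i tf tg.
have W2 i j := weak_partial_complex_test j (tp i _ tf) (tp i _ tg).
split=> [|i|i j].
- exact: le_nrm tf tg erefl f0 g0.
- exact: le_nrm (tp i _ tf) (tp i _ tg) (W1 i) (f1 i) (g1 i).
- exact: le_nrm (tp j _ (tp i _ tf)) (tp j _ (tp i _ tg))
    (etrans (congr1 _ (W1 i)) (W2 i j)) (f2 i j) (g2 i j).
Qed.

Lemma laplacian0 : laplacian (fun _ : 'rV[R]_d => 0) = (fun=> 0).
Proof.
have p0 i : partial i (fun _ : 'rV[R]_d => 0 : R) = (fun=> 0).
  by apply/funext => x; rewrite /partial derive_cst.
by apply/funext => x; rewrite /laplacian big1// => i _; rewrite !p0.
Qed.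

Lemma core_dense F e : 0 < e -> exists2 u, core u & nrm ip (F - (T u + u)) <= e.
Proof.
move=> e0; have [C0 CC] := @core_submodule R d.
pose S := [set T u + u | u in core].
have SS : submodule S.
  split.
    exists 0 => //; have := neg_laplacian_linear (-1) (core_sobolev2 C0) (core_sobolev2 C0).
    by rewrite !scaleN1r oppr0 add0r addNr => ->; rewrite addr0.
  move=> a _ _ [u Cu <-] [w Cw <-]; exists (a *: u + w); first exact: CC.
  rewrite neg_laplacian_linear; [|exact: core_sobolev2..].
  by rewrite scalerDr addrACA.
have orth v : (forall s, S s -> ip s v = 0) -> v = 0.
  move=> Sv; apply: toL2_helmholtz_eq0 => psi tp.
  have t0 := @test_cst0 R d.
  have Cp : core (complex_test psi (fun=> 0)) by exists psi, (fun=> 0).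
  have := Sv _ (imageP (fun u => T u + u) Cp).
  rewrite (core_helmholtz tp t0) => H.
  rewrite (ipC hV); apply/eqP; rewrite conjc_eq0; apply/eqP; apply: etrans _ H.
  rewrite /complex_test laplacian0; under [fun x => 0 - _]eq_fun do rewrite subr0.
  by rewrite toL20 scaler0 addr0.
have [s [u Cu <-] ue] := dense_of_orthogonal hV SS orth F e0.
by exists u.
Qed.

(** The approximating sequence is kept in the conclusion because integration by parts on [H^2] is
    deduced from it. *)
Lemma helmholtz_onto F : exists u, [/\ sobolev2 u, T u + u = F &
  exists un : nat -> L2, [/\ forall n, core (un n), gcvg ip un u &
    forall i, gcvg ip (fun n => W i (un n)) (W i u)]].
Proof.
have h0 n : 0 < (2^-1 : R) ^+ n by rewrite exprn_gt0.
pose un n := s2val (cid2 (core_dense F (h0 n))).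
have unC n : core (un n) := s2valP (cid2 (core_dense F (h0 n))).
have unF n : nrm ip (F - (T (un n) + un n)) <= 2^-1 ^+ n :=
  s2valP' (cid2 (core_dense F (h0 n))).
have [C0 CC] := @core_submodule R d.
have CB u w : core u -> core w -> core (u - w).
  by move=> Cu Cw; rewrite addrC -scaleN1r; exact: CC.
have sob n := core_sobolev2 (unC n).
have WB i u w : sobolev1 u -> sobolev1 w -> W i (u - w) = W i u - W i w.
  by move=> Su Sw; rewrite addrC -scaleN1r weak_partial_linear// scaleN1r addrC.
have diff n : nrm ip (T (un n.+1 - un n) + (un n.+1 - un n)) <= 2 * 2^-1 ^+ n.
  have -> : T (un n.+1 - un n) + (un n.+1 - un n) =
      (T (un n.+1) + un n.+1) - (T (un n) + un n).
    have := neg_laplacian_linear (-1) (sob n) (sob n.+1).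
    rewrite !scaleN1r [- un n + _]addrC [- T _ + _]addrC => ->.
    by rewrite addrACA opprD.
  apply: le_trans (nrmB_triangle hV F _ _) _; rewrite (nrmBC hV).
  apply: le_trans (lerD (unF n.+1) (unF n)) _.
  have := ltW (h0 n); rewrite (exprS _ n); move: (_ ^+ n) => p; lra.
(* Used with [P] the identity, a first and a second weak derivative, each dominated by [T + 1] on
   the core. *)
have cv (P : L2 -> L2) :
    (forall n, P (un n.+1 - un n) = P (un n.+1) - P (un n)) ->
    (forall w, core w -> nrm ip (P w) <= nrm ip (T w + w)) ->
    exists l, gcvg ip (fun n => P (un n)) l.
  move=> PB Pb; apply: (gcvg_complete hV (c := 2)) => // n.
  by rewrite -PB; apply: le_trans (Pb _ _) (diff n); exact: CB.
have [u uu] : exists u, gcvg ip un u.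
  by apply: (cv id) => // w /core_elliptic[].
have WE i n : W i (un n.+1 - un n) = W i (un n.+1) - W i (un n).
  by apply: WB; [have [] := sob n.+1|have [] := sob n].
have cv1 i : exists l, gcvg ip (fun n => W i (un n)) l.
  by apply: cv => [n|w /core_elliptic[]//]; exact: WE.
have cv2 i j : exists l, gcvg ip (fun n => W j (W i (un n))) l.
  apply: (cv (fun w => W j (W i w))) => [n|w /core_elliptic[_ _]//].
  rewrite WE WB//; [have [_] := sob n.+1|have [_] := sob n]; exact.
pose v i := sval (cid (cv1 i)); have vP i := svalP (cid (cv1 i)).
pose w i j := sval (cid (cv2 i j)); have wP i j := svalP (cid (cv2 i j)).
have uv i : is_weak_partial i u (v i).
  have [C1 H1] := uu; have [C2 H2] := vP i.
  apply: is_weak_partial_lim H1 H2 => n; apply: weak_partialP.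
  by have [+ _] := sob n; apply.
have vw i j : is_weak_partial j (v i) (w i j).
  have [C1 H1] := vP i; have [C2 H2] := wP i j.
  apply: is_weak_partial_lim H1 H2 => n; apply: weak_partialP.
  by have [_ +] := sob n; apply.
have Wu i : W i u = v i by exact: weak_partialE (uv i).
exists u; split.
- split=> [i|i j]; first by exists (v i).
  by rewrite Wu; exists (w i j).
(* This sequence tends to [F] by the choice of [un], and to [T u + u] term by term. *)
- apply: (gcvg_uniq hV (u := fun n => T (un n) + un n)); last first.
    by exists 1 => n; rewrite (nrmBC hV) mul1r.
  apply: (gcvgD hV) uu; apply: (gcvgN hV).
  apply: (gcvg_sum hV) => i; rewrite Wu (weak_partialE (vw i i)); exact: wP.
- by exists un; split=> // i; rewrite Wu; exact: vP.
Qed.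

End helmholtz.

(** * Nonnegativity of the Laplacian on [H^2] *)

Section neg_laplacian.
Context {R : realType} {d : nat}.
Local Notation mu := (lebesgue_rV R d).
Local Notation L2 := (L2 mu).
Local Notation ip := (@inner _ _ R mu).
Local Notation W := (@weak_partial R d).
Local Notation T := (neg_laplacian R d).
Implicit Types (f g : 'rV[R]_d -> R) (i : 'I_d) (u w : L2).

Let hV : hilbert ip := hilbert_L2 mu.

(** Both derivatives move from [w] to [psi] with two cancelling signs, so [w] is orthogonal to every
    [(1 - Delta) psi] and the Liouville theorem applies. *)
Lemma helmholtz_inj w : sobolev2 w -> T w + w = 0 -> w = 0.
Proof.
move=> [w1 w2] Tw; apply: toL2_helmholtz_eq0 => psi tp.
rewrite toL2_helmholtz// (ipBr hV) (ip_sumr hV).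
have E i : inner w (toL2 (partial i (partial i psi))) = inner (W i (W i w)) (toL2 psi).
  have /is_weak_partialP H := weak_partialP (w1 i).
  have /is_weak_partialP H' := weak_partialP (w2 i i).
  apply: etrans (H _ (test_partial i tp)) _.
  by apply: oppr_inj; rewrite opprK; exact: H'.
under eq_bigr do rewrite E.
by rewrite -(ip_suml hV) -(ipBl hV) addrC Tw (ip0l hV).
Qed.

(* By injectivity of [T + 1], [u] is the solution given by [helmholtz_onto],
   hence a limit of test functions together with its first derivatives. *)
Lemma weak_partial_by_parts i u : sobolev2 u ->
  ip (W i (W i u)) u = - ip (W i u) (W i u).
Proof.
move=> su; have [u1 u2] := su.
have [u' [su' Fu' [un [unC cu cWu]]]] := helmholtz_onto (T u + u).
have uu' : u = u'.
  apply: subr0_eq; apply: helmholtz_inj.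
    rewrite addrC -scaleN1r; exact: (@sobolev2_submodule R d).2.
  have -> : u - u' = -1 *: u' + u by rewrite scaleN1r addrC.
  have -> := neg_laplacian_linear (-1) su' su.
  rewrite !scaleN1r addrACA -opprD addrC; apply/eqP; rewrite subr_eq0; apply/eqP.
  exact: esym Fu'.
rewrite -{}uu' in cu cWu.
(* With a test function in place of [u] this is the definition of the weak derivative of [W i u]; it
   survives the limit since [un] and its first derivatives both converge. *)
have H : ip u (W i (W i u)) = ip (- W i u) (W i u).
  apply: (gcvg_ip hV cu (gcvgN hV (cWu i))) => n.
  have [f [g [tf tg E]]] := unC n; rewrite E (weak_partial_complex_test i tf tg).
  have /is_weak_partialP H := weak_partialP (u2 i i).
  have Hr h : test_function h -> inner (toL2 h) (W i (W i u)) =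
      - inner (toL2 (partial i h)) (W i u).
    by move=> th; rewrite (ipC hV) [in RHS](ipC hV) (H _ th) rmorphN opprK.
  rewrite /complex_test (ipNl hV) !(ipDl hV) !(ipZl hV) !Hr//.
  by rewrite mulrN opprD.
by rewrite (ipC hV) H (ipNl hV) (ip_re hV) rmorphN; congr (- _); exact: conjc_real.
Qed.

Lemma neg_laplacian_ge0 u : sobolev2 u -> 0 <= ip (T u) u.
Proof.
move=> su; rewrite /= (ipNl hV) (ip_suml hV) -sumrN; apply: sumr_ge0 => i _.
by rewrite weak_partial_by_parts// opprK (ip_re hV) ler0c (ip_ge0 hV).
Qed.

End neg_laplacian.

(** * Resolvent sets of nonnegative operators on [L^2] *)

Section resolvent.
Context {d : measure_display} {T : measurableType d} {R : realType}.
Variable mu : {measure set T -> \bar R}.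
Local Notation ip := (@inner _ _ R mu).
Let hV : hilbert ip := hilbert_L2 mu.

(** Injectivity and the bound [c^-1] on the inverse both come from [nonneg_lower_bound], so only
    surjectivity is left to the caller. It serves the Laplacian and the perturbed operator alike. *)
Lemma resolvent_set_nonneg (A : operator mu) (z : R[i]) :
  submodule (op_dom A) ->
  (forall a u v, op_dom A u -> op_dom A v -> A (a *: u + v) = a *: A u + A v) ->
  (forall u, op_dom A u -> 0 <= ip (A u) u) ->
  (forall x : R, 0 <= x -> z <> x%:C) ->
  (forall f, exists2 u, op_dom A u & A u - z *: u = f) ->
  resolvent_set A z.
Proof.
move=> DA AL A0 zoff onto.
have [c c0 cP] := nonneg_lower_bound hV A0 zoff.
split=> [f|]; last first.
  exists c^-1 => u Du; rewrite mulrC ler_pdivlMr// mulrC; exact: cP.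
have [u Du uf] := onto f; exists u; split=> // v [Dv vf].
apply: subr0_eq; apply: (nrm_eq0 hV).
have E : u - v = -1 *: v + u by rewrite scaleN1r addrC.
have Duv : op_dom A (u - v) by rewrite E; exact: DA.2.
have A0' : A (u - v) - z *: (u - v) = 0.
  rewrite E AL// !scaleN1r scalerDr scalerN opprD opprK addrACA uf.
  have -> : - A v + z *: v = - f by rewrite -vf opprB addrC.
  by rewrite addNr.
by have := cP _ Duv; rewrite A0' (nrm0 hV) pmulr_rle0.
Qed.

Lemma resolventE (A : operator mu) (z : R[i]) f u : resolvent_set A z ->
  op_dom A u -> A u - z *: u = f -> resolvent A z f = u.
Proof.
move=> [/(_ f)[v [vP vU]] _] Du uf; rewrite -(vU u)//.
have := @xgetPex _ (0 : L2 mu) [set u | op_dom A u /\ A u - z *: u = f].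
by move=> H; apply/esym/vU/H; exists v.
Qed.

Lemma resolventP (A : operator mu) (z : R[i]) f : resolvent_set A z ->
  op_dom A (resolvent A z f) /\ A (resolvent A z f) - z *: resolvent A z f = f.
Proof.
move=> rA; have [/(_ f)[v [[Dv vf] _]] _] := rA.
by rewrite (resolventE rA Dv vf).
Qed.

End resolvent.

(** * Finite rank perturbations, for an abstract right inverse [R0] of [T - z] *)

Section finite_rank_perturbation.
Context {R : realType} {V : lmodType R[i]}.
Variable ip : V -> V -> R[i].
Hypothesis hV : hilbert ip.
Variables (D : set V) (T : V -> V).
Hypothesis DS : submodule D.
Hypothesis TL : forall a u v, D u -> D v -> T (a *: u + v) = a *: T u + T v.
Hypothesis T0 : forall u, D u -> 0 <= ip (T u) u.
Variables (N : nat) (phi : 'I_N -> V).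
Hypothesis phi_orthonormal : forall i j, ip (phi i) (phi j) = (i == j)%:R.
Implicit Types (u v f : V) (c : 'I_N -> R[i]).

Definition perturbed u := T u + \sum_j ip u (phi j) *: phi j.
Local Notation H := perturbed.

Lemma perturbed_linear a u v : D u -> D v -> H (a *: u + v) = a *: H u + H v.
Proof.
move=> Du Dv; rewrite /H TL// scalerDr addrACA; congr (_ + _).
rewrite scaler_sumr -big_split; apply: eq_bigr => j _ /=.
by rewrite (ipDl hV) (ipZl hV) scalerDl scalerA.
Qed.

Lemma perturbed_ge0 u : D u -> 0 <= ip (H u) u.
Proof.
move=> Du; rewrite (ipDl hV) (ip_suml hV) addr_ge0 ?T0//.
apply: sumr_ge0 => j _; rewrite (ipZl hV) (ipC hV u).
exact: mulcJ_ge0.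
Qed.

Lemma ip_orthonormal c k : ip (\sum_j c j *: phi j) (phi k) = c k.
Proof.
rewrite (ip_suml hV) (bigD1 k)//= (ipZl hV) phi_orthonormal eqxx mulr1.
rewrite big1 ?addr0// => j jk; rewrite (ipZl hV) phi_orthonormal (negbTE jk).
by rewrite mulr0.
Qed.

Variables (z : R[i]) (R0 : V -> V).
Hypothesis z_off : forall x : R, 0 <= x -> z <> x%:C.
Hypothesis R0D : forall f, D (R0 f).
Hypothesis R0E : forall f, T (R0 f) - z *: R0 f = f.

Let S u := T u - z *: u.
Let A := \matrix_(i < N, j < N) ((i == j)%:R + ip (R0 (phi j)) (phi i)).

Let HE u : H u - z *: u = S u + \sum_j ip u (phi j) *: phi j.
Proof. by rewrite /H addrAC. Qed.

Let SL a u v : D u -> D v -> S (a *: u + v) = a *: S u + S v.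
Proof.
move=> Du Dv; rewrite /S TL// scalerDr scalerBr opprD addrACA.
by rewrite !scalerA (mulrC z).
Qed.

Let S0 : S 0 = 0.
Proof.
have := SL (-1) DS.1 DS.1; rewrite !scaleN1r oppr0 addr0 => ->.
by rewrite addNr.
Qed.

Let sum_R0 c : D (\sum_j c j *: R0 (phi j)) /\
  S (\sum_j c j *: R0 (phi j)) = \sum_j c j *: phi j.
Proof.
apply: (big_ind2 (fun u v => D u /\ S u = v)) => [|u u' v v' [Du <-] [Dv <-]|j _].
- by split; [exact: DS.1|].
- by have := DS.2 1 u v Du Dv; have := SL 1 Du Dv; rewrite !scale1r => -> Duv.
- have := SL (c j) (R0D (phi j)) DS.1; have := DS.2 (c j) _ _ (R0D (phi j)) DS.1.
  by rewrite S0 !addr0 [S (R0 _)]R0E.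
Qed.

(* A kernel vector of [A^T] gives the coefficients of an element of the kernel
   of [H - z]. *)
Lemma perturbation_matrix_unit : A \in unitmx.
Proof.
have [c c0 cP] := nonneg_lower_bound hV perturbed_ge0 z_off.
rewrite -unitmx_tr -row_free_unit; apply: inj_row_free => v vA.
have [Du Su] := sum_R0 (fun j => v ord0 j).
set u := \sum_j _ in Du Su.
have Hu : H u - z *: u = 0.
  rewrite HE Su -big_split big1// => i _ /=; rewrite -scalerDl.
  (* The coefficient of [phi i] is entry [i] of the product of the row [v] with the transpose of
     [A], which is [0]. *)
  suff -> : v ord0 i + ip u (phi i) = 0 by rewrite scale0r.
  have := congr1 (fun M : 'rV_N => M ord0 i) vA; rewrite !mxE => <-.
  rewrite (ip_suml hV) [RHS](eq_bigr (fun j => (i == j)%:R * v ord0 j +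
      ip (v ord0 j *: R0 (phi j)) (phi i))); last first.
    by move=> j _; rewrite !mxE (ipZl hV) mulrDr [v _ _ * _%:R]mulrC.
  rewrite big_split /=; congr (_ + _).
  rewrite (bigD1 i)//= eqxx mul1r big1 ?addr0// => j.
  by rewrite eq_sym => /negbTE ->; rewrite mul0r.
have u0 : u = 0.
  by apply: (nrm_eq0 hV); have := cP u Du; rewrite Hu (nrm0 hV) pmulr_rle0.
(* [S u] is the combination of the [phi j] with coefficients [v], so orthonormality reads [v] off
   [S 0 = 0]. *)
apply/rowP => k; rewrite mxE -(ip_orthonormal (fun j => v ord0 j) k) -Su u0 S0.
exact: (ip0l hV).
Qed.

(** For [u = R0 f - sum_i g_i R0 phi_i], applying [H - z] gives
    [f + sum_k (<u, phi_k> - g_k) phi_k]. The coefficients must therefore satisfy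
    [g_k = <u, phi_k>], which is the linear system [A g = b]. *)
Lemma perturbed_resolvent f :
  let u := R0 f - \sum_(i < N) \sum_(j < N)
                    (invmx A i j * ip (R0 f) (phi j)) *: R0 (phi i) in
  D u /\ H u - z *: u = f.
Proof.
set b := fun j => ip (R0 f) (phi j).
set g := fun i => \sum_j invmx A i j * b j.
move=> u; have [Dg Sg] := sum_R0 g.
have uE : u = -1 *: (\sum_i g i *: R0 (phi i)) + R0 f.
  rewrite scaleN1r addrC /u; congr (_ - _); apply: eq_bigr => i _.
  by rewrite -scaler_suml.
have Au k : \sum_i A k i * g i = b k.
  have := congr1 (fun M : 'cV_N => M k ord0)
    (mulKVmx perturbation_matrix_unit (\col_j b j)).
  rewrite !mxE => <-; apply: eq_bigr => i _; rewrite !mxE; congr (_ * _).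
  by apply: eq_bigr => j _; rewrite mxE.
have ipu k : ip u (phi k) = g k.
  rewrite uE (ipDl hV) (ipZl hV) (ip_suml hV) -/(b k) mulN1r -Au addrC -sumrB.
  rewrite (bigD1 k)//= big1 ?addr0 => [|i ik].
    by rewrite mxE (ipZl hV) eqxx mulrDl mul1r [g k * _]mulrC addrK.
  by rewrite mxE (ipZl hV) eq_sym (negbTE ik) add0r [g i * _]mulrC subrr.
split; first by rewrite uE; exact: DS.2.
rewrite HE; under [X in _ + X]eq_bigr do rewrite ipu.
by rewrite uE SL// Sg [S (R0 f)]R0E scaleN1r addrAC addNr add0r.
Qed.

End finite_rank_perturbation.

Theorem proposition4p1 (R : realType) (d N : nat) (d_ge1 : (1 <= d)%N)
    (N_ge1 : (1 <= N)%N) (phi : 'I_N -> L2 (lebesgue_rV R d))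
    (phi_orthonormal : forall i j, inner (phi i) (phi j) = (i == j)%:R)
    (z : R[i]) (z_off : forall x : R, 0 <= x -> z <> x%:C) :
  let H := hamiltonian phi in
  let R0 := resolvent (neg_laplacian R d) z in
  let A := \matrix_(i < N, j < N) ((i == j)%:R + inner (R0 (phi j)) (phi i)) in
  [/\ resolvent_set (neg_laplacian R d) z,
      A \in unitmx,
      resolvent_set H z
    & forall f : L2 (lebesgue_rV R d),
        resolvent H z f =
        R0 f - \sum_(i < N) \sum_(j < N)
                 (invmx A i j * inner (R0 f) (phi j)) *: R0 (phi i)].
Proof.
move=> H R0 A.
have hV : hilbert (@inner _ _ R (lebesgue_rV R d)) := hilbert_L2 _.
have TS := @sobolev2_submodule R d.
have TL := @neg_laplacian_linear R d.
have T0 := @neg_laplacian_ge0 R d.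
have T1 f : exists2 u, sobolev2 u & neg_laplacian R d u + u = f.
  by have [u [su uf _]] := helmholtz_onto f; exists u.
have rT : resolvent_set (neg_laplacian R d) z.
  apply: (@resolvent_set_nonneg _ _ _ _ (neg_laplacian R d) z TS TL T0 z_off).
  exact: (nonneg_resolvent hV TS TL T0 T1 z_off).
have R0D f : sobolev2 (R0 f) by have [] := resolventP f rT.
have R0E f : neg_laplacian R d (R0 f) - z *: R0 f = f by have [] := resolventP f rT.
have HL := perturbed_linear hV TL phi.
have H0 := perturbed_ge0 hV T0 phi.
have HR := perturbed_resolvent hV TS TL T0 phi_orthonormal z_off R0D R0E.
(* The explicit formula itself supplies surjectivity of [H - z]; uniqueness of solutions then
   identifies it with the resolvent. *)
have rH : resolvent_set H z.
  apply: (@resolvent_set_nonneg _ _ _ _ H z TS HL H0 z_off) => f.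
  by have [Du uf] := HR f; eexists; [exact: Du|exact: uf].
split=> // [|f].
  exact: (perturbation_matrix_unit hV TS TL T0 phi_orthonormal z_off R0D R0E).
by have [Du uf] := HR f; exact: (resolventE rH Du uf).
Qed.
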